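(* Consider the unconstrained nonconvex multi-agent problem and the Zeroth-order Feedback Optimization (ZFO) algorithm described in the context. Suppose $\sigma>0$ (noisy observations), and let $\epsilon>0$ be sufficiently small. If the algorithm's parameters satisfy $$u\leq\frac{\sqrt{\epsilon}}{4L\sqrt{d}},\qquad \eta\leq\frac{\epsilon u^2/\sigma^2}{2L\bar b\sqrt{n}\,d},\qquad T-B+1\geq\left\lceil\frac{6}{\eta\epsilon}\max\{f(x(0))-f^\ast,1\}\right\rceil,$$ then $$\frac{1}{T-B+1}\sum_{t=B}^{T}\mathbb{E}\left[\|\nabla f(x(t))\|^2\right]\leq\epsilon .$$ Moreover, if all the conditions on the parameters are satisfied with equality, then $T=\Theta\left(\dfrac{\bar b\sqrt{n}\,d^2}{\epsilon^3}\right)$.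
   Context: Problem (unconstrained nonconvex setting). There are $n$ agents; agent $i$ has an action $x^i\in\mathbb{R}^{d_i}$, $d=\sum_id_i$, $x=(x^1,\ldots,x^n)\in\mathbb{R}^d$. Each local cost $f_i:\mathbb{R}^d\to\mathbb{R}$ is $G$-Lipschitz and $L$-smooth ($|f_i(x)-f_i(y)|\le G\|x-y\|$, $\|\nabla f_i(x)-\nabla f_i(y)\|\le L\|x-y\|$, $\ell_2$ norms). The objective is $f=\frac1n\sum_{i=1}^nf_i$, possibly nonconvex, and $f^\ast=\inf_{x\in\mathbb{R}^d}f(x)>-\infty$. ZFO algorithm (unconstrained). Parameters: step size $\eta>0$, smoothing radius $u>0$, number of iterations $T\ge B$, an initial action profile $x(0)\in\mathbb{R}^d$. The agents are joined by a communication network, a connected undirected graph on $\{1,\ldots,n\}$; $b_{ij}$ is the graph distance between $i$ and $j$. At each time $t=0,1,2,\ldots$: (1) each agent $i$ draws $z^i(t)\sim\mathcal{N}(0,I_{d_i})$, afresh at each time and independently across agents; $z(t)=(z^1(t),\ldots,z^n(t))$; (2) agent $i$ observes $\hat f_i^\pm(t)=f_i(x(t)\pm uz(t))+\varepsilon_i^\pm(t)$ and computes $D_i(t)=\frac{\hat f_i^+(t)-\hat f_i^-(t)}{2u}$; the noises $\varepsilon_i^\pm(t)$ have zero mean and variance at most $\sigma^2$, and are independent of each other and of the action profile; (3) agent $i$ keeps for every $j$ a pair $(D^i_j(t),\tau^i_j(t))$, initialised as $(0,-1)$ at time $-1$. It sets $D^i_i(t)=D_i(t)$, $\tau^i_i(t)=t$;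 for $j\ne i$ it adopts, among the pairs concerning $j$ received at time $t$ from its neighbours (its own previous pair standing in for a neighbour from which nothing arrives), the one with the largest time stamp; it then sends all its pairs to its neighbours. Thus $D^i_j(t)=D_j(\tau^i_j(t))$, with the convention $D_j(s)=0$, $z(s)=0$ for $s<0$. It forms $G^i(t)=\frac1n\sum_{j=1}^nD^i_j(t)\,z^i(\tau^i_j(t))$; $G(t)=(G^1(t),\ldots,G^n(t))$; (4) $x(t+1)=x(t)-\eta G(t)$. Delays. There is $\Delta\ge0$ with $t-\tau^i_j(t)\le b_{ij}+\Delta$ for all $t\ge0$ and all $i,j$. Define $$\bar b=\left(\frac{\sum_{i,j=1}^n(b_{ij}+\Delta)^2}{n^2}\right)^{1/2},\qquad B=\max_{i,j}b_{ij}+\Delta .$$ *)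

(* Defs.v *)
From HB Require Import structures.
From mathcomp Require Export all_boot all_order all_algebra.
From mathcomp Require Export all_classical all_reals all_analysis.

Set Implicit Arguments.
Unset Strict Implicit.
Unset Printing Implicit Defensive.

Export Order.TTheory GRing.Theory Num.Theory.
Export numFieldNormedType.Exports.

Global Open Scope classical_set_scope.
Global Open Scope ring_scope.

(* The library norm on row vectors is the sup norm, hence [norm2]. *)
Definition norm2 {R : realType} {m : nat} (x : 'rV[R]_m) : R :=
  Num.sqrt (\sum_k x ord0 k ^+ 2).

Definition gradient {R : realType} {m : nat} (f : 'rV[R]_m -> R)
    (x : 'rV[R]_m) : 'rV[R]_m :=
  \row_k 'D_(delta_mx ord0 k) f x.

Definition lipschitz2 {R : realType} {m : nat} (G : R) (f : 'rV[R]_m -> R) :=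
  forall x y, `|f x - f y| <= G * norm2 (x - y).

Definition smooth2 {R : realType} {m : nat} (L : R) (f : 'rV[R]_m -> R) :=
  (forall x, differentiable f x) /\
  (forall x y, norm2 (gradient f x - gradient f y) <= L * norm2 (x - y)).

(* x = (x^1, ..., x^n) with x^i = submxrow x i in 'rV_(dim i). *)
Notation profile R dim := 'rV[R]_(\sum_i dim i).

Definition objective {R : realType} {n : nat} {dim : 'I_n -> nat}
    (f : 'I_n -> profile R dim -> R) (x : profile R dim) : R :=
  n%:R^-1 * \sum_i f i x.

Definition infimum {R : realType} {m : nat} (f : 'rV[R]_m -> R) : R :=
  inf (range f).

(* In a connected graph on n vertices every distance is less than n, so the
   search always succeeds. *)
Definition gdist {n : nat} (e : rel 'I_n) (i j : 'I_n) : nat :=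
  find (fun k => [exists p : k.-tuple 'I_n, path e i p && (last i p == j)])
       (iota 0 n).

Definition connected_graph {n : nat} (e : rel 'I_n) : Prop :=
  [/\ symmetric e, irreflexive e & forall i j, connect e i j].

Definition avg_delay (R : realType) {n : nat} (e : rel 'I_n) (Delta : nat) : R :=
  Num.sqrt ((\sum_i \sum_j (gdist e i j + Delta)%:R ^+ 2) / n%:R ^+ 2).

Definition max_delay {n : nat} (e : rel 'I_n) (Delta : nat) : nat :=
  (\max_i \max_j gdist e i j + Delta)%N.

Section protocol.
Context {R : realType} {n : nat} (dim : 'I_n -> nat).

(* [tab t i j] is the pair (D^i_j(t), tau^i_j(t)) held by agent i. *)
Definition table := nat -> 'I_n -> 'I_n -> R * int.

Definition previous_pair (tab : table) (t : nat) (i j : 'I_n) : R * int :=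
  if t is s.+1 then tab s i j else (0, -1).

(* [arr t i k] lists the sending times of the messages from agent k that reach
   agent i at time t; without losses or latency, arr t.+1 i k = [:: t]. *)
Definition candidate_pairs (e : rel 'I_n) (arr : nat -> 'I_n -> 'I_n -> seq nat)
    (tab : table) (t : nat) (i j : 'I_n) : seq (R * int) :=
  flatten [seq if arr t i k is [::] then [:: previous_pair tab t i j]
               else [seq tab s k j | s <- arr t i k]
          | k <- enum 'I_n & e i k].

Definition at_stamp {V : zmodType} (a : nat -> V) (s : int) : V :=
  if s is Posz t then a t else 0.

Definition stack (z : forall i : 'I_n, nat -> 'rV[R]_(dim i)) (t : nat)
    : profile R dim :=
  \mxrow_i z i t.

Definition observed_difference (f : 'I_n -> profile R dim -> R) (u : R)
    (z : forall i : 'I_n, nat -> 'rV[R]_(dim i)) (noiseP noiseM : 'I_n -> nat -> R)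
    (x : nat -> profile R dim) (i : 'I_n) (t : nat) : R :=
  ((f i (x t + u *: stack z t) + noiseP i t)
   - (f i (x t - u *: stack z t) + noiseM i t)) / (2 * u).

Definition local_estimate (z : forall i : 'I_n, nat -> 'rV[R]_(dim i))
    (tab : table) (t : nat) (i : 'I_n) : 'rV[R]_(dim i) :=
  n%:R^-1 *: \sum_j (tab t i j).1 *: at_stamp (z i) (tab t i j).2.

(* One realisation of the algorithm, for given perturbations, noises and
   message arrivals.  Ties between candidates with the same stamp are harmless:
   such pairs are equal. *)
Record zfo_run (e : rel 'I_n) (arr : nat -> 'I_n -> 'I_n -> seq nat)
    (f : 'I_n -> profile R dim -> R) (u eta : R) (x0 : profile R dim)
    (z : forall i : 'I_n, nat -> 'rV[R]_(dim i)) (noiseP noiseM : 'I_n -> nat -> R)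
    (x : nat -> profile R dim) (tab : table) : Prop := {
  run_init : x 0%N = x0;
  run_own : forall t i,
    tab t i i = (observed_difference f u z noiseP noiseM x i t, t%:Z);
  run_adopt : forall t i j, i != j ->
    tab t i j \in candidate_pairs e arr tab t i j /\
    (forall p, p \in candidate_pairs e arr tab t i j -> p.2 <= (tab t i j).2);
  run_step : forall t,
    x t.+1 = x t - eta *: \mxrow_i local_estimate z tab t i
}.

End protocol.

Definition mutually_independent {d : measure_display} {Omega : measurableType d}
    {R : realType} (P : probability Omega R) {I : eqType}
    (X : I -> {RV P >-> R}) : Prop :=
  forall (s : seq I) (A : I -> set R), uniq s -> (forall i, measurable (A i)) ->
    P (\bigcap_(i in [set i | i \in s]) (X i @^-1` A i)) =
    (\prod_(i <- s) P (X i @^-1` A i))%E.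

Section randomness.
Context {d : measure_display} {Omega : measurableType d} {R : realType}
  {P : probability Omega R} {n : nat} {dim : 'I_n -> nat}.

(* [z i t k] is the k-th coordinate of z^i(t). *)
Definition perturbation (z : forall i : 'I_n, nat -> 'I_(dim i) -> {RV P >-> R})
    (w : Omega) (i : 'I_n) (t : nat) : 'rV[R]_(dim i) :=
  \row_k z i t k w.

Definition primitive_variable
    (z : forall i : 'I_n, nat -> 'I_(dim i) -> {RV P >-> R})
    (noiseP noiseM : 'I_n -> nat -> {RV P >-> R})
    (a : nat * ({i : 'I_n & 'I_(dim i)} + ('I_n + 'I_n))) : {RV P >-> R} :=
  match a.2 with
  | inl ik => z (tag ik) a.1 (tagged ik)
  | inr (inl i) => noiseP i a.1
  | inr (inr i) => noiseM i a.1
  end.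

(* N(0, I_m) is the law of m independent standard normal coordinates. *)
Record zfo_randomness (z : forall i : 'I_n, nat -> 'I_(dim i) -> {RV P >-> R})
    (noiseP noiseM : 'I_n -> nat -> {RV P >-> R}) (sigma : R) : Prop := {
  rand_gaussian : forall i t k (A : set R), measurable A ->
    distribution P (z i t k) A = normal_prob 0 1 A;
  rand_meanP : forall i t, ('E_P[noiseP i t] = 0)%E;
  rand_meanM : forall i t, ('E_P[noiseM i t] = 0)%E;
  rand_varP : forall i t, ('V_P[noiseP i t] <= (sigma ^+ 2)%:E)%E;
  rand_varM : forall i t, ('V_P[noiseM i t] <= (sigma ^+ 2)%:E)%E;
  rand_indep : mutually_independent (primitive_variable z noiseP noiseM)
}.

End randomness.

Record problem {R : realType} {n : nat} {dim : 'I_n -> nat} (G L : R)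
    (f : 'I_n -> profile R dim -> R) : Prop := {
  cost_lipschitz : forall i, lipschitz2 G (f i);
  cost_smooth : forall i, smooth2 L (f i);
  objective_bounded : has_lbound (range (objective f))
}.

(* Main.v *)
From HB Require Import structures.
From mathcomp Require Import measurable_realfun ring lra zify.
Require Import Defs.
Set Implicit Arguments.
Unset Strict Implicit.
Unset Printing Implicit Defensive.

(** Work in flat coordinates: [Z t] stacks the perturbations at time [t], and the
coordinate [k] of the step is the average over [j] of [D_j(s) Z_k(s)] at the stale
times [s = tau_kj(t)], which do not depend on the randomness.  The iterate [x(s)]
depends on the variables of times before [s] only, so integrating one variable at a
time against its own law (Fubini on [R * Omega], where [Omega] carries the
sigma-algebra of the other variables) shows three things: the noise averages out;
by Stein's identity in the coordinate [k], [D_j(s) Z_k(s)] has the conditional mean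
of the average of the partial derivatives of [f_j] at [x(s) + u Z(s)] and
[x(s) - u Z(s)]; and there [Z(s)] may be exchanged for [Z(t)], so that the smoothing
biases of all the coordinates refer to the same point and add up to [L u sqrt d].
What remains is the descent lemma, with the drift [x(t) - x(s)] and the squared step
controlled by the second moment of [D_j Z_k], which the noise term
[sigma^2 / (2 u^2)] dominates.  The leading terms sum to
[(1/6 + 1/8 + 15/32) eps < 7/8 eps]. *)

(** * Independence *)

(** Conditional expectations are never formed. Measurability of [Y : knowing S -> R] says that [Y]
    is a function of the variables indexed by [S], and a conditional mean is expressed by testing
    against bounded weights known before time [t]; the weight used is a partial derivative of the
    objective at the stale iterate, bounded by [G]. Measurability of the iterates is derived from
    the recursion.

    The sum starts at [B] because an earlier stamp may still be -1; the phase before [B] costs a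
    drift of the objective from its initial value. The factor [bbar sqrt n] is a Cauchy-Schwarz
    inequality over pairs of agents, between the delays and the square roots of the block
    dimensions.

    Constants: 7/8 is what Young's inequality on the smoothing bias leaves of the squared gradient;
    1/8 comes from the bound on [u], 1/6 from the number of iterations; 15/32 = 5/16 + 5/32 is the
    delay error plus the quadratic term, both from the bound on [eta] and the noise part
    [5/8 sigma^2 / u^2] of the second moment. The room left below 7/8 pays for the terms of higher
    order in [eps], which [eps0] makes small. *)

Section independence.
Context {d : measure_display} {Omega : measurableType d} {R : realType}
  {P : probability Omega R} {I : choiceType} (xi : I -> {RV P >-> R}).
Hypothesis xi_indep : mutually_independent xi.

Definition cylinder (s : seq I) (A : I -> set R) : set Omega :=
  \bigcap_(i in [set i | i \in s]) (xi i @^-1` A i).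

Definition cylinders (S : set I) : set (set Omega) :=
  [set E | exists s A, [/\ uniq s, forall i, i \in s -> S i,
     forall i, measurable (A i) & E = cylinder s A]].

(** The points are those of [Omega]; only the sigma-algebra shrinks, so that one function can be
    measurable for several [S]. *)
Local Notation knowing S := (g_sigma_algebraType (cylinders S)).

Lemma cylinders_setI (S : set I) : setI_closed (cylinders S).
Proof.
move=> _ _ [s1 [A1 [u1 S1 m1 ->]]] [s2 [A2 [u2 S2 m2 ->]]].
(* Two constraints on an index merge into one set; an index missing from one list is unconstrained
   there, hence [setT]. *)
pose A i := (if i \in s1 then A1 i else setT) `&` (if i \in s2 then A2 i else setT).
exists (undup (s1 ++ s2)), A; split.
- exact: undup_uniq.
- by move=> i; rewrite mem_undup mem_cat => /orP[/S1|/S2].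
- by move=> i; apply: measurableI; case: ifP.
apply/seteqP; split=> w.
  move=> [w1 w2] i /= _; split => /=; case: ifPn => // iS; [exact: w1|exact: w2].
move=> wA; split=> i /= iS.
  by have /= := wA i; rewrite mem_undup mem_cat iS/= => /(_ isT)[]; rewrite iS.
by have /= := wA i; rewrite mem_undup mem_cat iS/= orbT => /(_ isT)[_]; rewrite iS.
Qed.

Lemma cylinders_setT (S : set I) : cylinders S setT.
Proof.
exists [::], (fun=> setT); split => //.
by apply/seteqP; split=> // w _ i.
Qed.

Lemma cylinders_measurable (S : set I) : cylinders S `<=` measurable.
Proof.
move=> _ [s [A [us _ mA ->]]]; apply: fin_bigcap_measurable => //.
by move=> i _; exact: measurable_funPTI.
Qed.

Lemma knowing_measurable (S : set I) (E : set Omega) :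
  measurable (E : set (knowing S)) -> measurable E.
Proof.
have sub := smallest_sub (@sigma_algebra_measurable _ Omega) (@cylinders_measurable S).
exact: sub.
Qed.

Lemma measurable_knowing_id (S : set I) :
  measurable_fun setT (id : Omega -> knowing S).
Proof. by move=> _ E mE; rewrite setTI; exact: (@knowing_measurable S). Qed.

Lemma knowing_fun (S : set I) d' (T : measurableType d') (Y : Omega -> T) :
  measurable_fun setT (Y : knowing S -> T) -> measurable_fun setT Y.
Proof.
by move=> mY _ A mA; rewrite setTI; apply: (@knowing_measurable S);
  rewrite -[X in measurable X]setTI; exact: mY.
Qed.

Lemma knowing_sub (S S' : set I) d' (T : measurableType d') (Y : Omega -> T) :
  S `<=` S' ->
  measurable_fun setT (Y : knowing S -> T) -> measurable_fun setT (Y : knowing S' -> T).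
Proof.
move=> SS' mY _ A mA; have := mY measurableT A mA.
apply: sub_smallest2r => [|E]; first exact: smallest_sigma_algebra.
by move=> [s [B [us sS mB ->]]]; exists s, B; split => // i /sS /SS'.
Qed.

Lemma knowing_xi (S : set I) b : S b ->
  measurable_fun setT (xi b : knowing S -> R).
Proof.
move=> Sb _ A mA; rewrite setTI; apply: sub_sigma_algebra.
exists [:: b], (fun=> A); split => //; first by move=> i; rewrite inE => /eqP ->.
apply/seteqP; split => [w wA i /=|w]; first by rewrite inE => /eqP ->.
by move=> /(_ b) /=; apply; rewrite inE.
Qed.

(** Both sides are finite measures in [E]. On the pi-system of cylinders over [S] they agree by
    independence along the list [a :: s], which has no repetition because [a] lies outside [S]. *)
Lemma indep_event (S : set I) a (A : set R) (E : set (knowing S)) :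
  ~ S a -> measurable A -> measurable E ->
  P (xi a @^-1` A `&` E) = (P (xi a @^-1` A) * P E)%E.
Proof.
move=> Sa mA mE.
have mxA : measurable (xi a @^-1` A) by exact: measurable_funPTI.
pose m1 : {measure set Omega -> \bar R} := mrestr P mxA.
have pge : 0 <= fine (P (xi a @^-1` A)) by exact: fine_ge0.
pose m2 : {measure set Omega -> \bar R} := mscale (NngNum pge) P.
rewrite setIC; change (m1 E = P (xi a @^-1` A) * P E)%E.
have m2E F : m2 F = (P (xi a @^-1` A) * P F)%E.
  change ((fine (P (xi a @^-1` A)))%:E * P F = P (xi a @^-1` A) * P F)%E.
  by rewrite fineK// fin_num_measure.
rewrite -m2E.
apply: (@g_sigma_algebra_measure_unique _ _ _ (cylinders S) _ (fun=> setT) _ _ m1 m2) => //.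
- exact: cylinders_measurable.
- by move=> _; exact: cylinders_setT.
- by rewrite bigcup_const//; exists 0%N.
- exact: cylinders_setI.
- move=> _ [s [B [us sS mB ->]]].
  rewrite m2E; change (P (cylinder s B `&` xi a @^-1` A) =
    P (xi a @^-1` A) * P (cylinder s B))%E.
  have as' : a \notin s by apply/negP => /sS.
  pose B' i := if i == a then A else B i.
  have := @xi_indep (a :: s) B'; rewrite /= as' us => /(_ isT).
  rewrite big_cons /B' eqxx => H.
  have E1 : \bigcap_(i in [set i | i \in a :: s]) (xi i @^-1` B' i) =
     cylinder s B `&` xi a @^-1` A.
    apply/seteqP; split=> w.
      move=> Hw; split.
        move=> i /= si; have /= := Hw i; rewrite inE si orbT => /(_ isT).
        by rewrite /B'; case: eqP => [ia|//]; rewrite -ia si in as'.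
      by have /= := Hw a; rewrite inE eqxx => /(_ isT); rewrite /B' eqxx.
    move=> [H1 H2] i /=; rewrite inE /B'; case: eqP => [->|_] //= is'; exact: H1.
  rewrite /B' in E1; rewrite -E1 H; last by move=> i; case: ifP.
  congr (_ * _)%E.
  rewrite (_ : cylinder s B = \bigcap_(i in [set i | i \in s]) (xi i @^-1` B i))//.
  rewrite xi_indep//; apply: eq_big_seq => i si.
  by case: eqP => [ia|//]; rewrite -ia si in as'.
- move=> _; change (P (setT `&` xi a @^-1` A) < +oo)%E.
  by rewrite setTI (le_lt_trans (probability_le1 _ _)) ?ltry.
Qed.

(** The identity into the coarser sigma-algebra: its distribution is [P] restricted to the events
    that [S] determines. *)
Definition forget (S : set I) (w : Omega) : knowing S := w.

HB.instance Definition _ (S : set I) :=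
  isMeasurableFun.Build _ _ _ _ (forget S) (@measurable_knowing_id S).

Definition with_xi (S : set I) (a : I) (w : Omega) : R * knowing S := (xi a w, w).

Lemma measurable_with_xi (S : set I) (a : I) : measurable_fun setT (with_xi S a).
Proof.
by apply/measurable_fun_pairP; split; [exact: measurable_funP|exact: measurable_knowing_id].
Qed.

HB.instance Definition _ (S : set I) (a : I) :=
  isMeasurableFun.Build _ _ _ _ (with_xi S a) (@measurable_with_xi S a).

(** Rectangles determine a product measure, and on them the claim is [indep_event]. The second
    component is the whole outcome, so that an integrand may depend on all the variables of [S] at
    once. *)
Lemma law_with_xi (S : set I) a (E : set (R * knowing S)) : ~ S a -> measurable E ->
  (distribution P (xi a) \x distribution P (forget S))%E E =
  distribution P (with_xi S a) E.
Proof.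
move=> Sa mE; apply: product_measure_unique => // A B mA mB.
by rewrite /distribution /pushforward /= -(indep_event Sa mA mB).
Qed.

Local Open Scope ereal_scope.

Lemma indep_tonelli (S : set I) a (Phi : R * knowing S -> \bar R) :
  ~ S a -> measurable_fun setT Phi -> (forall y, 0 <= Phi y) ->
  \int[P]_w Phi (xi a w, w) =
  \int[P]_w \int[distribution P (xi a)]_s Phi (s, w).
Proof.
move=> Sa mPhi Phi0.
rewrite -(@ge0_integral_distribution _ _ _ _ _ P (with_xi S a))//.
rewrite -(@eq_measure_integral _ _ _ setT _ (distribution P (xi a) \x distribution P (forget S))%E);
  last by move=> A mA _; exact: law_with_xi.
rewrite fubini_tonelli2//.
rewrite (@ge0_integral_distribution _ _ _ _ _ P (forget S))//.
- exact: measurable_fun_fubini_tonelli_G.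
- by move=> y; apply: integral_ge0.
Qed.

(** Integrability is asked only along [(xi a w, w)]; the equality of the laws carries it to the
    product. *)
Lemma indep_fubini (S : set I) a (Phi : R * knowing S -> \bar R) :
  ~ S a -> measurable_fun setT Phi ->
  P.-integrable setT (fun w => Phi (xi a w, w)) ->
  \int[P]_w Phi (xi a w, w) =
  \int[P]_w \int[distribution P (xi a)]_s Phi (s, w).
Proof.
move=> Sa mPhi iPhi.
rewrite -(@integral_distribution _ _ _ _ _ P (with_xi S a))//.
have iD : (distribution P (with_xi S a)).-integrable setT Phi.
  by apply: integrable_pushforward => //; exact: measurable_with_xi.
have iprod : (distribution P (xi a) \x distribution P (forget S)).-integrable setT Phi.
  case/integrableP : iD => _ iD; apply/integrableP; split => //.
  apply: le_lt_trans iD.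
  rewrite (@eq_measure_integral _ _ _ setT (distribution P (with_xi S a)))//.
  by move=> A mA _; exact: law_with_xi.
rewrite -(@eq_measure_integral _ _ _ setT _ (distribution P (xi a) \x distribution P (forget S))%E);
  last by move=> A mA _; exact: law_with_xi.
rewrite -integral21_prod_meas1//.
have mG := measurable_fubini_G iprod.
(* The positive and negative parts are transported separately, which asks only for measurability of
   the inner integral. *)
rewrite integralE [RHS]integralE; congr (_ - _).
- by rewrite (@ge0_integral_distribution _ _ _ _ _ P (forget S))//; exact: measurable_funepos.
- by rewrite (@ge0_integral_distribution _ _ _ _ _ P (forget S))//; exact: measurable_funeneg.
Qed.

End independence.

(** * Gaussian integrals *)

Section gaussian.
Context {R : realType}.
Notation mu := (@lebesgue_measure R).
Notation N01 := (@normal_prob R 0 1).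
Notation phi := (@normal_pdf R 0 1).

Local Open Scope ereal_scope.

(** The density integrates to the normal law over every measurable set, hence agrees almost
    everywhere with the Radon-Nikodym derivative in the change of variables. *)
Lemma integral_normal (f : R -> \bar R) : N01.-integrable setT f ->
  \int[N01]_x f x = \int[mu]_x (f x * (phi x)%:E).
Proof.
move=> fi; have mf := measurable_int _ fi.
have dom := @normal_prob_dominates R 0%R 1%R.
rewrite -(Radon_Nikodym_change_of_variables dom)//=.
apply: ae_eq_integral => //.
- by apply: emeasurable_funM => //; apply: (measurable_int mu); exact: Radon_Nikodym_integrable.
- by apply: emeasurable_funM => //=; apply/measurable_EFinP; exact: measurable_normal_pdf.
- apply: ae_eqe_mul2l => /=; rewrite Radon_NikodymE//=.
  case: cid => /= h [h1 h2 h3]; apply: integral_ae_eq => //=.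
  + by apply/measurable_EFinP; exact: measurable_normal_pdf.
  + by move=> E _ mE; rewrite -h3.
Qed.

Import HBNNSimple.

(** Monotone approximation by simple functions: these are bounded, hence integrable for the normal
    law, and [integral_normal] applies to them. *)
Lemma ge0_integral_normal (f : R -> \bar R) : measurable_fun setT f ->
  (forall x, 0 <= f x) ->
  \int[N01]_x f x = \int[mu]_x (f x * (phi x)%:E).
Proof.
move=> mf f0; pose g := nnsfun_approx measurableT mf.
have cvg_g x : EFin (g n x) @[n --> \oo] --> f x by apply: cvg_nnsfun_approx.
have ndg x m n : (m <= n)%N -> (g m x <= g n x)%R.
  by move=> mn; exact/lefP/nd_nnsfun_approx.
have mg n : measurable_fun setT (fun x => (g n x)%:E).
  by apply/measurable_EFinP; exact: measurable_funP.
have gE x : f x = limn (fun n => (g n x)%:E) by apply/esym/cvg_lim => //; exact: cvg_g.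
have phi0 x : 0 <= (phi x)%:E by rewrite lee_fin normal_pdf_ge0.
transitivity (limn (fun n => \int[N01]_x (g n x)%:E)).
  rewrite -monotone_convergence//.
  - exact: eq_integral.
  - by move=> n x _; rewrite lee_fin.
  - by move=> x _ a b ab; rewrite lee_fin ndg.
transitivity (limn (fun n => \int[mu]_x ((g n x)%:E * (phi x)%:E))); last first.
  rewrite -monotone_convergence//.
  - apply: eq_integral => x _; apply/cvg_lim => //.
    by apply: cvgeZr => //; exact: cvg_g.
  - move=> n; apply: emeasurable_funM; first exact (mg n).
    by apply/measurable_EFinP; exact: measurable_normal_pdf.
  - by move=> n x _; apply: mule_ge0 => //; rewrite lee_fin.
  - by move=> x _ a b ab; apply: lee_wpmul2r => //; rewrite lee_fin ndg.
apply: congr_lim; apply/funext => n; rewrite integral_normal//.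
have [M [Mreal hM]] := simple_bounded (g n).
apply: (@le_integrable _ _ _ _ setT measurableT _ (cst (M + 1)%:E)) => //.
- exact (mg n).
- move=> x _ /=; rewrite lee_fin; apply: (@le_trans _ _ (M + 1)%R); last exact: ler_norm.
  by apply: hM; rewrite ?ltrDl.
- exact: finite_measure_integrable_cst.
Qed.

Lemma integrable_normalP (f : R -> \bar R) : measurable_fun setT f ->
  mu.-integrable setT (fun x => f x * (phi x)%:E) <-> N01.-integrable setT f.
Proof.
have mphi : measurable_fun setT (fun x => (phi x)%:E).
  by apply/measurable_EFinP; exact: measurable_normal_pdf.
move=> mf; have H : \int[N01]_x `|f x| = \int[mu]_x `|f x * (phi x)%:E|.
  rewrite ge0_integral_normal//; last exact: measurableT_comp.
  apply: eq_integral => x _; rewrite abseM; congr (_ * _).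
  by rewrite gee0_abs ?lee_fin ?normal_pdf_ge0.
split=> /integrableP[_ h]; apply/integrableP; split => //.
- by rewrite H.
- exact: emeasurable_funM.
- by rewrite -H.
Qed.

Local Close Scope ereal_scope.

Lemma phiE x : phi x = normal_peak 1 * expR (- x ^+ 2 / 2).
Proof.
rewrite normal_pdfE ?oner_neq0//; congr (_ * expR _).
by rewrite subr0 expr1n.
Qed.

(** With [y = x ^+ 2 / 8] one has [x ^+ 4 = 64 * y ^+ 2] and [y ^+ 2 <= expR (y *+ 2)]; this
    exponential factor turns variance 1 into variance 2, whose density is integrable. *)
Lemma fourth_power_phi_le x :
  x ^+ 4 * phi x <= 64 * (normal_peak 1 / normal_peak (Num.sqrt 2)) *
    normal_pdf 0 (Num.sqrt 2) x.
Proof.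
have s2 : Num.sqrt 2 != 0 :> R by rewrite gt_eqF// sqrtr_gt0.
have p2 : normal_peak (Num.sqrt 2) != 0 :> R by rewrite gt_eqF ?normal_peak_gt0.
rewrite phiE normal_pdfE// /normal_fun subr0 sqr_sqrtr//.
have -> : - x ^+ 2 / (2 *+ 2) = - x ^+ 2 / 2 + x ^+ 2 / 8 *+ 2 :> R by lra.
rewrite expRD; move: (normal_peak (Num.sqrt 2)) p2 => p2 p20.
rewrite [leLHS](_ : _ = (normal_peak 1 * expR (- x ^+ 2 / 2)) * x ^+ 4); last by ring.
rewrite [leRHS](_ : _ = (normal_peak 1 * expR (- x ^+ 2 / 2)) * (64 * expR (x ^+ 2 / 8 *+ 2)));
  last by field.
rewrite ler_wpM2l ?mulr_ge0 ?expR_ge0 ?normal_peak_ge0//.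
have -> : x ^+ 4 = 64 * (x ^+ 2 / 8) ^+ 2 by field.
rewrite ler_wpM2l// mulr2n expRD -expr2.
have y0 : 0 <= x ^+ 2 / 8 by rewrite divr_ge0 ?sqr_ge0.
rewrite ler_sqr ?nnegrE ?expR_ge0//.
by apply: le_trans (expR_ge1Dx _); rewrite lerDr.
Qed.

Lemma normal_integrable (f : R -> R) (K : R) : measurable_fun setT f ->
  (forall x, `|f x| <= K * (1 + x ^+ 4)) -> N01.-integrable setT (EFin \o f).
Proof.
move=> mf fK.
have int4 : N01.-integrable setT (fun x => (x ^+ 4)%:E).
  apply/integrable_normalP.
    by apply/measurable_EFinP; exact: measurable_funX.
  pose K4 := 64 * (normal_peak 1 / normal_peak (Num.sqrt (2 : R))).
  have i2 := integrableZl measurableT K4 (integrable_normal_pdf 0 (Num.sqrt 2 : R)).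
  apply: (le_integrable measurableT _ _ i2).
  - apply: emeasurable_funM; apply/measurable_EFinP; first exact: measurable_funX.
    exact: measurable_normal_pdf.
  - move=> x _; rewrite -!EFinM !abse_EFin lee_fin ger0_norm.
      exact: le_trans (fourth_power_phi_le x) (ler_norm _).
    by rewrite mulr_ge0 ?normal_pdf_ge0// exprn_even_ge0.
have i3 := integrableZl measurableT K (integrableD measurableT
  (finite_measure_integrable_cst N01 1 measurableT) int4).
apply: (le_integrable measurableT _ _ i3).
- exact/measurable_EFinP.
- move=> x _; rewrite -EFinD -EFinM /= lee_fin; exact: le_trans (fK x) (ler_norm _).
Qed.

Lemma is_derive_phi x : is_derive (x : R) 1 phi (- x * phi x).
Proof.
have -> : phi = (fun x => normal_peak 1 * expR (- x ^+ 2 / 2)).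
  by apply/funext => y; exact: phiE.
have d1 : is_derive x 1 (fun y : R => - y ^+ 2 / 2) (- x).
  have -> : (fun y : R => - y ^+ 2 / 2) = (- 2^-1) *: (id : R -> R) ^+ 2.
    apply/funext => y; change (- y ^+ 2 / 2 = - 2^-1 * (y * y)); lra.
  apply: is_derive_eq.
  by rewrite /GRing.scale /= /GRing.scale /=; field.
have d2 := is_derive1_comp (is_derive_expR _) d1.
have -> : (fun y : R => normal_peak 1 * expR (- y ^+ 2 / 2)) =
   normal_peak 1 *: (expR \o (fun y : R => - y ^+ 2 / 2)) by [].
apply: is_derive_eq.
by rewrite /GRing.scale /=; ring.
Qed.

Lemma expR_sqr_le (x : R) : x != 0 -> expR (- x ^+ 2 / 2) <= 2 / x ^+ 2.
Proof.
move=> x0; have x2 : 0 < x ^+ 2 by rewrite exprn_even_gt0.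
rewrite mulNr expRN -[leRHS]invrK lef_pV2 ?posrE ?expR_gt0 ?invr_gt0 ?divr_gt0//.
by rewrite invf_div; apply: le_trans (expR_ge1Dx _); rewrite lerDr.
Qed.

(** Integration by parts against [phi' = - s phi]: [h'] is the derivative of [g * phi], its integral
    over [[-n, n]] is a boundary term that tends to 0, and dominated convergence identifies the
    limit with the integral over the line. *)
Lemma stein (g g' : R -> R) (K : R) :
  (forall s : R, is_derive s 1 g (g' s)) -> continuous g' ->
  (forall s, `|g s| <= K * (1 + `|s|)) -> (forall s, `|g' s| <= K) ->
  (\int[N01]_s (s * g s)%:E = \int[N01]_s (g' s)%:E)%E.
Proof.
move=> dg cg' gK g'K.
have K0 : 0 <= K by exact: le_trans (g'K 0).
have cg : continuous g.
  by move=> x; apply: differentiable_continuous; apply/derivable1_diffP; exact: ex_derive.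
have cphi : continuous phi by apply: continuous_normal_pdf; exact: oner_neq0.
have mg : measurable_fun setT g by exact: continuous_measurable_fun.
have mg' : measurable_fun setT g' by exact: continuous_measurable_fun.
have mphi : measurable_fun setT phi by exact: measurable_normal_pdf.
have i1 : N01.-integrable setT (EFin \o (fun s => s * g s)).
  apply: (@normal_integrable _ (2 * K)); first exact: measurable_funM.
  move=> x; rewrite normrM.
  apply: (@le_trans _ _ (`|x| * (K * (1 + `|x|)))); first by rewrite ler_wpM2l.
  rewrite (_ : x ^+ 4 = `|x| ^+ 4); last by rewrite -normrX ger0_norm// exprn_even_ge0.
  have := normr_ge0 x; move: `|x| => y y0.
  have : y * (1 + y) <= 2 * (1 + y ^+ 4).
    have := sqr_ge0 (y - 1); have := sqr_ge0 (y ^+ 2 - 1).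
    by rewrite (_ : y ^+ 4 = (y ^+ 2) ^+ 2) -?exprM//; nra.
  by move/(ler_wpM2l K0); lra.
have i2 : N01.-integrable setT (EFin \o g').
  apply: (@normal_integrable _ K) => // x; apply: le_trans (g'K x) _.
  by rewrite ler_peMr// lerDl exprn_even_ge0.
have j1 : mu.-integrable setT (fun x => (x * g x * phi x)%:E).
  have /integrable_normalP := i1; apply.
  by apply/measurable_EFinP; exact: measurable_funM.
have j2 : mu.-integrable setT (fun x => (g' x * phi x)%:E).
  by have /integrable_normalP := i2; apply; exact/measurable_EFinP.
rewrite (integral_normal i1) (integral_normal i2).
pose h x := g x * phi x.
pose h' x := g' x * phi x - x * g x * phi x.
have dh x : is_derive (x : R) 1 h (h' x).
  apply: (is_derive_eq (is_deriveM (dg x) (is_derive_phi x))).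
  by rewrite /h' /GRing.scale /=; ring.
have ch' : continuous h'.
  move=> x; apply: (@cvgB _ R^o).
    by apply: cvgM; [exact: cg'|exact: cphi].
  by apply: cvgM; [apply: cvgM; [exact: cvg_id|exact: cg]|exact: cphi].
have mh' : measurable_fun setT h' by exact: continuous_measurable_fun.
have jh : mu.-integrable setT (EFin \o h').
  by have := integrableB measurableT j2 j1.
pose fn (n : nat) := (EFin \o h') \_ `[- n%:R, n%:R].
have cvg1 : (\int[mu]_x fn n x)%E @[n --> \oo] --> (\int[mu]_x (h' x)%:E)%E.
  apply: (@dominated_cvg _ _ _ mu setT measurableT fn (EFin \o h') (abse \o (EFin \o h'))).
  - move=> n; apply/(measurable_restrictT _ _).1 => //.
    by apply: measurable_funTS; exact/measurable_EFinP.
  - move=> x _; apply: cvg_near_cst; near=> n; apply/eqP.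
    rewrite /fn patchE mem_set//= in_itv/= -ler_norml.
    by near: n; exact: nbhs_infty_ger.
  - by [].
  - exact: integrable_abse.
  - move=> n x _; rewrite /fn patchE; case: ifPn => // _.
    by rewrite abse0 /= lee_fin normr_ge0.
have cvg0 : (\int[mu]_x fn n x)%E @[n --> \oo] --> 0%E.
  (* The shift to [n.+1] makes the interval nondegenerate and puts its endpoints where [hb]
     holds. *)
  rewrite -cvg_shiftS /=.
  have En n : (\int[mu]_x fn n.+1 x)%E = (h n.+1%:R - h (- n.+1%:R))%:E.
    rewrite /fn -integral_mkcond; apply: continuous_FTC2.
    - by rewrite gtrN.
    - exact: continuous_subspaceT.
    - split => [x _||]; first exact: ex_derive.
      + apply: cvg_at_right_filter; apply: differentiable_continuous.
        by apply/derivable1_diffP; exact: ex_derive.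
      + apply: cvg_at_left_filter; apply: differentiable_continuous.
        by apply/derivable1_diffP; exact: ex_derive.
    - by move=> x _; rewrite derive1E; exact: derive_val.
  under eq_fun do rewrite En.
  apply: cvg_EFin; first exact: nearW.
  (* Each of the two endpoints contributes [4 * K]: a factor 2 from [1 + |y| <= 2 |y|] and a factor
     2 from [expR_sqr_le]. *)
  pose C := 8 * K * normal_peak (1 : R).
  have hb (y : R) : 1 <= `|y| -> `|h y| <= 4 * K * normal_peak 1 * `|y|^-1.
    move=> y1; have y0 : y != 0 by rewrite -normr_gt0; exact: lt_le_trans y1.
    have yn : 0 < `|y| by rewrite normr_gt0.
    rewrite /h normrM phiE normrM !(ger0_norm (normal_peak_ge0 1)) (ger0_norm (expR_ge0 _)).
    apply: (@le_trans _ _ (K * (1 + `|y|) * (normal_peak 1 * (2 / y ^+ 2)))).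
      rewrite ler_pM ?mulr_ge0 ?normal_peak_ge0 ?expR_ge0//.
      by rewrite ler_wpM2l ?normal_peak_ge0// expR_sqr_le.
    rewrite -(real_normK (num_real y)).
    move: `|y| y1 yn => x x1 x0.
    apply: (@le_trans _ _ (K * (x + x) * (normal_peak 1 * (2 / x ^+ 2)))).
      rewrite ler_wpM2r ?ler_wpM2l ?lerD2r//.
      by rewrite mulr_ge0 ?normal_peak_ge0// divr_ge0// sqr_ge0.
    by rewrite le_eqVlt; apply/orP; left; apply/eqP; field; rewrite gt_eqF.
  apply: norm_cvg0; apply: (@squeeze_cvgr _ _ _ _ (cst 0) (fun n => C * harmonic n)).
  - apply: nearW => n /=; rewrite normr_ge0 /=.
    apply: le_trans (ler_normB _ _) _.
    have n1 : 1 <= n.+1%:R :> R by rewrite ler1n.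
    have := hb n.+1%:R; have := hb (- n.+1%:R); rewrite normrN ger0_norm// => /(_ n1) b1 /(_ n1) b2.
    apply: le_trans (lerD b2 b1) _; rewrite /harmonic /C /=.
    rewrite le_eqVlt; apply/orP; left; apply/eqP; rewrite -mulrDl; congr (_ * _).
    by ring.
  - exact: cvg_cst.
  - by rewrite -[X in _ --> X](mulr0 C); apply: cvgMr; exact: cvg_harmonic.
have E : (\int[mu]_x (h' x)%:E = 0)%E by exact: (cvg_unique _ cvg1 cvg0).
have := integralB measurableT j2 j1.
rewrite -[LHS]/(\int[mu]_x (h' x)%:E)%E E => /esym/eqP.
rewrite sube_eq//; first by rewrite add0e => /eqP ->.
exact: integrable_fin_num.
Unshelve. all: by end_near. Qed.

(** Stein's identity for [g = id]. *)
Lemma normal_second_moment : (\int[N01]_s (s ^+ 2)%:E = 1)%E.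
Proof.
rewrite (@stein id (cst 1) 1)//.
- by rewrite (integral_cst N01 measurableT 1%E) mul1e; exact: (probability_setT N01).
- by move=> x; exact: cvg_cst.
- by move=> s; rewrite mul1r lerDr.
- by move=> s; rewrite normr1.
Qed.

(** The fourth moment of the standard normal law, kept as a symbol: it enters only the cost part of
    the second moment, next to [G ^+ 2]. *)
Definition gaussian_kurtosis : R := fine (\int[N01]_s (s ^+ 4)%:E)%E.

Lemma gaussian_kurtosis_ge0 : 0 <= gaussian_kurtosis.
Proof.
rewrite /gaussian_kurtosis; apply: fine_ge0; apply: integral_ge0 => s _.
by rewrite lee_fin exprn_even_ge0.
Qed.

Lemma normal_fourth_moment : (\int[N01]_s (s ^+ 4)%:E = gaussian_kurtosis%:E)%E.
Proof.
rewrite /gaussian_kurtosis fineK//; apply: integrable_fin_num => //.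
apply: (@normal_integrable (fun s => s ^+ 4) 1); first exact: measurable_funX.
by move=> x; rewrite mul1r ger0_norm ?exprn_even_ge0// lerDr.
Qed.

End gaussian.

Section borel_alias.
Context {R : realType}.

(* The normal law lives on [measurableTypeR R], which has the Borel sets of [R]
   but another display. *)
Definition to_borel (x : R) : measurableTypeR R := x.

Lemma measurable_to_borel : measurable_fun setT to_borel.
Proof. by move=> _ A mA; rewrite setTI. Qed.

HB.instance Definition _ := isMeasurableFun.Build _ _ _ _ to_borel measurable_to_borel.

Lemma normal_law_integral (Q : probability R R) (g : R -> \bar R) :
  measurable_fun setT g ->
  (forall A : set R, measurable A -> Q A = normal_prob 0 1 A) ->
  (\int[Q]_s g s = \int[normal_prob 0 1]_s g s)%E.
Proof.
move=> mg QN.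
have mg' : measurable_fun [set: measurableTypeR R] g by exact mg.
rewrite -(@eq_measure_integral _ (measurableTypeR R) R setT (normal_prob 0 1)
  (distribution Q to_borel)); last by move=> A mA _; exact: QN.
rewrite [LHS]integralE [RHS]integralE; congr (_ - _)%E.
- by rewrite ge0_integral_distribution//; exact: measurable_funepos.
- by rewrite ge0_integral_distribution//; exact: measurable_funeneg.
Qed.
End borel_alias.

(** * Euclidean geometry *)

Section euclidean.
Context {R : realType}.

(** Expand the nonnegative sum of [(B * a i - A * b i) ^+ 2], with [A] and [B] the two norms; these
    are divided out at the end, so a vanishing norm is treated apart. *)
Lemma cauchy_schwarz_sum (I : finType) (p : pred I) (a b : I -> R) :
  \sum_(i | p i) a i * b i <=
  Num.sqrt (\sum_(i | p i) a i ^+ 2) * Num.sqrt (\sum_(i | p i) b i ^+ 2).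
Proof.
have sq0 c : 0 <= \sum_(i | p i) c i ^+ 2 :> R.
  by apply: sumr_ge0 => i _; exact: sqr_ge0.
have [a0|a0] := eqVneq (\sum_(i | p i) a i ^+ 2) 0.
  rewrite a0 sqrtr0 mul0r big1 // => i pi.
  have /eqP : a i ^+ 2 = 0.
    by apply: (psumr_eq0P _ a0) => // j _; exact: sqr_ge0.
  by rewrite sqrf_eq0 => /eqP ->; rewrite mul0r.
have [b0|b0] := eqVneq (\sum_(i | p i) b i ^+ 2) 0.
  rewrite b0 sqrtr0 mulr0 big1 // => i pi.
  have /eqP : b i ^+ 2 = 0.
    by apply: (psumr_eq0P _ b0) => // j _; exact: sqr_ge0.
  by rewrite sqrf_eq0 => /eqP ->; rewrite mulr0.
set A := Num.sqrt (\sum_(i | p i) a i ^+ 2); set B := Num.sqrt _.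
have A0 : 0 < A by rewrite sqrtr_gt0 lt0r a0 sq0.
have B0 : 0 < B by rewrite sqrtr_gt0 lt0r b0 sq0.
have AE : A ^+ 2 = \sum_(i | p i) a i ^+ 2 by rewrite sqr_sqrtr.
have BE : B ^+ 2 = \sum_(i | p i) b i ^+ 2 by rewrite sqr_sqrtr.
have : 0 <= \sum_(i | p i) (B * a i - A * b i) ^+ 2.
  by apply: sumr_ge0 => i _; exact: sqr_ge0.
have -> : \sum_(i | p i) (B * a i - A * b i) ^+ 2 =
    B ^+ 2 * A ^+ 2 - 2 * A * B * (\sum_(i | p i) a i * b i) + A ^+ 2 * B ^+ 2.
  rewrite {1}AE {2}BE !mulr_sumr -sumrB -big_split /=.
  by apply: eq_bigr => i _; ring.
move: (\sum_(i | p i) a i * b i) => S H.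
have : 0 <= (2 * A * B) * (A * B - S) by move: H; rewrite !expr2; lra.
by rewrite pmulr_rge0 ?subr_ge0// !mulr_gt0.
Qed.

(** Nonnegativity of the empirical variance. *)
Lemma sqr_mean_le (n : nat) (a : 'I_n -> R) :
  (n%:R^-1 * \sum_j a j) ^+ 2 <= n%:R^-1 * \sum_j a j ^+ 2.
Proof.
case: n a => [|n] a; first by rewrite !big_ord0 !mulr0 expr0n.
set A := n.+1%:R^-1 * \sum_j a j.
have SA : \sum_j a j = n.+1%:R * A by rewrite /A mulVKf ?pnatr_eq0.
have : 0 <= \sum_j (a j - A) ^+ 2 by apply: sumr_ge0 => j _; exact: sqr_ge0.
rewrite (eq_bigr (fun j => a j ^+ 2 + (- (2 * A) * a j + A ^+ 2))); last first.
  by move=> j _; ring.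
rewrite !big_split /= -mulr_sumr SA sumr_const card_ord -mulr_natl => H.
rewrite ler_pdivlMl ?ltr0n// -subr_ge0; apply: le_trans H _.
by rewrite le_eqVlt; apply/orP; left; apply/eqP; ring.
Qed.

Context {m : nat}.
Implicit Types x y v : 'rV[R]_m.

Definition dot x y : R := \sum_k x ord0 k * y ord0 k.

Lemma coordB x y k : (x - y) ord0 k = x ord0 k - y ord0 k.
Proof. by rewrite !mxE. Qed.

Lemma norm2_ge0 x : 0 <= norm2 x. Proof. exact: sqrtr_ge0. Qed.

Lemma sqr_norm2 x : norm2 x ^+ 2 = \sum_k x ord0 k ^+ 2.
Proof. by rewrite sqr_sqrtr// sumr_ge0// => k _; exact: sqr_ge0. Qed.

Lemma dot_le x y : dot x y <= norm2 x * norm2 y.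
Proof. exact: cauchy_schwarz_sum. Qed.

Lemma dotZr a x y : dot x (a *: y) = a * dot x y.
Proof. by rewrite /dot mulr_sumr; apply: eq_bigr => k _; rewrite mxE mulrCA. Qed.

Lemma norm2Z a x : norm2 (a *: x) = `|a| * norm2 x.
Proof.
rewrite /norm2 -(sqrtr_sqr a) -sqrtrM ?sqr_ge0// mulr_sumr; congr Num.sqrt.
by apply: eq_bigr => k _; rewrite mxE exprMn.
Qed.

Lemma norm2N x : norm2 (- x) = norm2 x.
Proof. by rewrite -scaleN1r norm2Z normrN1 mul1r. Qed.

Lemma norm2_sub_sym x y : norm2 (x - y) = norm2 (y - x).
Proof. by rewrite -norm2N opprB. Qed.

Lemma norm2_0 : norm2 (0 : 'rV[R]_m) = 0.
Proof. by rewrite /norm2 big1 ?sqrtr0// => k _; rewrite mxE expr0n. Qed.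

Lemma dot_ge x y : - (norm2 x * norm2 y) <= dot x y.
Proof.
rewrite lerNl -(norm2N y) (_ : - dot x y = dot x (- y)) ?dot_le//.
by rewrite /dot -sumrN; apply: eq_bigr => k _; rewrite mxE mulrN.
Qed.

(** Only [x] is enlarged from the block to the whole vector. Keeping [b] on its block is what later
    produces the square root of the block dimension instead of that of [d]. *)
Lemma block_sum_ge (p : pred 'I_m) x (b : 'I_m -> R) :
  - (norm2 x * Num.sqrt (\sum_(k | p k) b k ^+ 2)) <= \sum_(k | p k) x ord0 k * b k.
Proof.
have le2 : Num.sqrt (\sum_(k | p k) (- x) ord0 k ^+ 2) <= norm2 x.
  rewrite -(norm2N x) ler_wsqrtr// [leRHS](bigID p)/= lerDl.
  by apply: sumr_ge0 => k _; exact: sqr_ge0.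
rewrite lerNl -sumrN (eq_bigr (fun k => (- x) ord0 k * b k)); last first.
  by move=> k _; rewrite mxE mulNr.
apply: le_trans (cauchy_schwarz_sum _ _ _) _.
by rewrite ler_wpM2r ?sqrtr_ge0.
Qed.

Lemma block_dot_ge (p : pred 'I_m) x y :
  - (norm2 x * norm2 y) <= \sum_(k | p k) x ord0 k * y ord0 k.
Proof.
apply: le_trans (block_sum_ge p x (y ord0)); rewrite lerN2 ler_wpM2l ?norm2_ge0//.
rewrite ler_wsqrtr// [leRHS](bigID p)/= lerDl.
by apply: sumr_ge0 => k _; exact: sqr_ge0.
Qed.

Lemma block_dot_le (p : pred 'I_m) x y :
  \sum_(k | p k) x ord0 k * y ord0 k <= norm2 x * norm2 y.
Proof.
rewrite -(norm2N x) -lerN2; apply: le_trans (block_dot_ge p _ _) _.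
by rewrite -sumrN ler_sum// => k _; rewrite mxE mulNr.
Qed.

Lemma norm2D x y : norm2 (x + y) <= norm2 x + norm2 y.
Proof.
rewrite -ler_sqr ?nnegrE ?addr_ge0 ?norm2_ge0// sqrrD !sqr_norm2.
have -> : \sum_k (x + y) ord0 k ^+ 2 =
    \sum_k x ord0 k ^+ 2 + dot x y *+ 2 + \sum_k y ord0 k ^+ 2.
  rewrite -sumrMnl -!big_split /=; apply: eq_bigr => k _.
  by rewrite mxE sqrrD.
by rewrite lerD2r lerD2l lerMn2r dot_le orbT.
Qed.

Lemma norm2_sum (J : Type) (r : seq J) (p : pred J) (F : J -> 'rV[R]_m) :
  norm2 (\sum_(j <- r | p j) F j) <= \sum_(j <- r | p j) norm2 (F j).
Proof.
elim/big_ind2 : _ => [||//]; first by rewrite norm2_0.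
by move=> x1 x2 y1 y2 h1 h2; apply: le_trans (norm2D _ _) _; exact: lerD.
Qed.

Lemma coord_le_norm2 x k : `|x ord0 k| <= norm2 x.
Proof.
rewrite -sqrtr_sqr ler_wsqrtr// (bigD1 k)//= lerDl.
by apply: sumr_ge0 => j _; exact: sqr_ge0.
Qed.

Lemma norm2_le_sum x : norm2 x <= \sum_k `|x ord0 k|.
Proof.
rewrite {1}(row_sum_delta x); apply: le_trans (norm2_sum _ _ _) _.
apply: ler_sum => k _; rewrite norm2Z.
rewrite (_ : norm2 _ = 1) ?mulr1// /norm2 (bigD1 k)//= mxE !eqxx expr1n.
by rewrite big1 ?addr0 ?sqrtr1// => j /negPf jk; rewrite mxE jk andbF expr0n.
Qed.

Lemma norm2_delta k : norm2 (delta_mx ord0 k : 'rV[R]_m) = 1.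
Proof.
rewrite /norm2 (bigD1 k)//= mxE !eqxx expr1n.
by rewrite big1 ?addr0 ?sqrtr1// => j /negPf jk; rewrite mxE jk andbF expr0n.
Qed.

(* [g(X w) < a] iff [g q + K |X w - q|_1 < a] for some rational point [q]. *)
Lemma measurable_lipschitz d (T : measurableType d) (g : 'rV[R]_m -> R) (K : R)
    (X : T -> 'rV[R]_m) :
  lipschitz2 K g -> (forall k, measurable_fun setT (fun w => X w ord0 k)) ->
  measurable_fun setT (fun w => g (X w)).
Proof.
move=> gK mX; pose K' := `|K| + 1.
have K'0 : 0 < K' by rewrite ltr_wpDl.
have gK' x y : `|g x - g y| <= K' * \sum_k `|x ord0 k - y ord0 k|.
  apply: le_trans (gK x y) _; apply: (@le_trans _ _ (K' * norm2 (x - y))).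
    by rewrite ler_wpM2r ?norm2_ge0// (le_trans (ler_norm K))// lerDl.
  rewrite ler_wpM2l ?(ltW K'0)//; apply: le_trans (norm2_le_sum _) _.
  by apply: ler_sum => k _; rewrite !mxE.
pose Q (q : {ffun 'I_m -> rat}) : 'rV[R]_m := \row_k ratr (q k).
apply: (measurability _ (RGenInftyO.measurableE R)) => _ [_ [a ->] <-]; rewrite setTI.
have -> : (fun w => g (X w)) @^-1` `]-oo, a[%classic =
    \bigcup_q [set w | g (Q q) + K' * \sum_k `|X w ord0 k - ratr (q k)| < a].
  apply/seteqP; split => w /=; rewrite in_itv /=.
    (* The error [K' * (m * e)] is met twice, in [g (Q q)] and in the sum; [m.+1] in place of [m]
       keeps the total strictly below the gap, also for [m = 0]. *)
    move=> ga; pose e := (a - g (X w)) / (K' * (2 * m.+1%:R)).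
    have e0 : 0 < e by rewrite divr_gt0 ?subr_gt0// !mulr_gt0.
    have qP k : exists q : rat, `|X w ord0 k - ratr q| < e.
      have [q] := @rat_in_itvoo R (X w ord0 k - e) (X w ord0 k + e) ltac:(lra).
      by rewrite in_itv /= => ?; exists q; rewrite distrC ltr_distl.
    pose q := [ffun k => projT1 (cid (qP k))].
    have S : \sum_k `|X w ord0 k - ratr (q k)| <= m%:R * e.
      rewrite -[m in m%:R]card_ord mulr_natl -sumr_const; apply: ler_sum => k _.
      by rewrite ffunE; case: cid => /= r /ltW.
    exists q => //=.
    have h1 : g (Q q) <= g (X w) + K' * (m%:R * e).
      rewrite -lerBlDl (le_trans (ler_norm _))// (le_trans (gK' _ _))//.
      rewrite ler_pM2l// (le_trans _ S)//; apply: ler_sum => k _.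
      by rewrite mxE distrC.
    have h2 : K' * \sum_k `|X w ord0 k - ratr (q k)| <= K' * (m%:R * e) by rewrite ler_pM2l.
    apply: le_lt_trans (lerD h1 h2) _.
    have h3 : K' * (m%:R * e) < (a - g (X w)) / 2.
      rewrite (_ : K' * (m%:R * e) = (m%:R / m.+1%:R) * ((a - g (X w)) / 2)).
        rewrite gtr_pMl ?divr_gt0 ?subr_gt0//.
        by rewrite ltr_pdivrMr ?ltr0n// mul1r ltr_nat.
      rewrite /e; field; rewrite (gt_eqF K'0) /=.
      by rewrite (_ : 1 + m%:R = m.+1%:R) ?pnatr_eq0// -natr1 addrC.
    by lra.
  move=> [q _ /=]; apply: le_lt_trans.
  rewrite -lerBlDl (le_trans (ler_norm _))// (le_trans (gK' _ _))//.
  by rewrite ler_pM2l//; apply: ler_sum => k _; rewrite mxE.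
apply: countable_bigcupT_measurable; first exact: countableP.
move=> q; rewrite -[X in measurable X]setTI.
apply: measurable_fun_ltr => //.
apply: measurable_funD => //; apply: measurable_funM => //.
apply: measurable_sum => k; apply: measurableT_comp => //.
exact: measurable_funB.
Qed.

End euclidean.

(** * Smooth functions *)

Section gradient.
Context {R : realType} {m : nat}.
Implicit Types (f : 'rV[R]_m -> R) (x y v : 'rV[R]_m).

Lemma derive_gradient f x v : differentiable f x -> 'D_v f x = dot (gradient f x) v.
Proof.
move=> df; rewrite deriveE// {1}(row_sum_delta v) linear_sum /dot.
apply: eq_bigr => k _; rewrite linearZ /= mxE deriveE// mulrC.
by rewrite /GRing.scale /=.
Qed.

(** The difference quotients of the restriction to the line are those of [f] in the direction
    [v]. *)
Lemma is_derive_line f x v (t : R) : differentiable f (x + t *: v) ->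
  is_derive t 1 (fun s : R => f (x + s *: v)) (dot (gradient f (x + t *: v)) v).
Proof.
move=> df; rewrite -derive_gradient//.
have E : (fun h : R => h^-1 *: (((fun s : R => f (x + s *: v)) \o shift t) (h *: 1)
      - f (x + t *: v))) =
    (fun h : R => h^-1 *: ((f \o shift (x + t *: v)) (h *: v) - f (x + t *: v))).
  apply/funext => h /=; congr (_ *: (f _ - _)).
  have -> : h *: (1 : R) = h by exact: mulr1.
  by rewrite scalerDl addrCA.
have dv : derivable f (x + t *: v) v by exact: diff_derivable.
by apply: DeriveDef; rewrite /derivable /derive E.
Qed.

(** The derivative in the direction of the gradient itself is the squared norm of the gradient,
    while the Lipschitz bound on the difference quotients gives [G] times that norm. *)
Lemma gradient_norm_le f (G : R) x : 0 <= G -> lipschitz2 G f ->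
  differentiable f x -> norm2 (gradient f x) <= G.
Proof.
move=> G0 fG df; set v := gradient f x.
have [->//|v0] := eqVneq (norm2 v) 0.
have vp : 0 < norm2 v by rewrite lt0r v0 norm2_ge0.
rewrite -(ler_pM2r vp) -expr2 sqr_norm2.
have <- : 'D_v f x = \sum_k v ord0 k ^+ 2.
  by rewrite derive_gradient// /dot; apply: eq_bigr => k _; rewrite expr2.
apply: limr_le; first exact: diff_derivable.
near=> h.
have h0 : h != 0 by near: h; exact: nbhs_dnbhs_neq.
rewrite (le_trans (ler_norm _))// /GRing.scale /= normrM normfV.
rewrite ler_pdivrMl ?normr_gt0// (le_trans (fG _ _))//.
by rewrite addrK norm2Z mulrCA.
Unshelve. all: by end_near. Qed.

(* Along the segment, [f] minus its quadratic upper model is nonincreasing. *)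
Lemma smooth_descent f (L : R) x v : smooth2 L f ->
  f (x + v) <= f x + dot (gradient f x) v + L / 2 * norm2 v ^+ 2.
Proof.
move=> [df Lf].
pose c := dot (gradient f x) v; pose q := L * norm2 v ^+ 2.
pose psi (s : R) := f (x + s *: v) - (c * s + q / 2 * s ^+ 2).
have dpsi (s : R) : is_derive s 1 psi (dot (gradient f (x + s *: v)) v - (c + q * s)).
  have d1 := is_derive_line (df (x + s *: v)).
  have d2 : is_derive s 1 (fun s : R => c * s + q / 2 * s ^+ 2) (c + q * s).
    have -> : (fun s : R => c * s + q / 2 * s ^+ 2) =
        c *: (id : R -> R) + (q / 2) *: (id : R -> R) ^+ 2 by [].
    apply: (is_derive_eq (is_deriveD (is_deriveZ c (is_derive_id s 1))
      (is_deriveZ (q / 2) (is_deriveX 2 (is_derive_id s 1))))).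
    by change (c * 1 + q / 2 * (2%:R * s ^+ 1 * 1) = c + q * s); rewrite expr1; field.
  exact: (is_deriveB d1 d2).
have cpsi : continuous psi.
  by move=> s; apply: differentiable_continuous; apply/derivable1_diffP; exact: ex_derive.
have : psi 1 <= psi 0.
  apply: (@ler0_derive1_le_cc R psi 0 1) => //; last by rewrite in_itv /= lexx ler01.
  - move=> s; rewrite in_itv /= => /andP[s0 s1]; rewrite derive1E derive_val subr_le0 -lerBlDl.
    have -> : dot (gradient f (x + s *: v)) v - c =
        dot (gradient f (x + s *: v) - gradient f x) v.
      by rewrite /c /dot -sumrB; apply: eq_bigr => k _; rewrite coordB mulrBl.
    apply: le_trans (dot_le _ _) _.
    apply: (@le_trans _ _ (L * norm2 (x + s *: v - x) * norm2 v)).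
      by rewrite ler_wpM2r ?norm2_ge0//; exact: Lf.
    rewrite addrC addKr norm2Z ger0_norm ?(ltW s0)// /q expr2.
    by rewrite le_eqVlt; apply/orP; left; apply/eqP; ring.
  - exact: continuous_subspaceT.
  - by rewrite in_itv /= lexx ler01.
rewrite /psi scale1r scale0r addr0 mulr0 mulr1 expr0n /= expr1n mulr0 addr0 subr0 mulr1.
by rewrite /q /c; lra.
Qed.

Lemma smooth_partial_lipschitz f (L : R) k : smooth2 L f ->
  lipschitz2 L (fun x => gradient f x ord0 k).
Proof.
move=> [_ Lf] x y; apply: le_trans (Lf x y).
by apply: le_trans (coord_le_norm2 _ k); rewrite !mxE.
Qed.

Lemma lipschitz_line_continuous (g : 'rV[R]_m -> R) (K : R) y v : lipschitz2 K g ->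
  continuous (fun s : R => g (y + s *: v)).
Proof.
move=> gK s; pose C := `|K| * norm2 v + 1.
have C0 : 0 < C by rewrite ltr_wpDl// mulr_ge0 ?norm2_ge0.
apply/cvgrPdist_lt => e e0; near=> s'.
apply: le_lt_trans (gK _ _) _.
have -> : y + s *: v - (y + s' *: v) = (s - s') *: v.
  by rewrite opprD addrACA subrr add0r scalerBl.
apply: (@le_lt_trans _ _ (`|s - s'| * C)).
  rewrite norm2Z mulrCA ler_wpM2l// /C.
  apply: (@le_trans _ _ (`|K| * norm2 v)); last by rewrite lerDl.
  by rewrite ler_wpM2r ?norm2_ge0// ler_norm.
rewrite -ltr_pdivlMr//; near: s'.
exact: (@nbhsx_ballx R R s _ (divr_gt0 e0 C0)).
Unshelve. all: by end_near. Qed.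

Lemma dot_delta y (r : R) k : dot y (r *: delta_mx ord0 k) = r * y ord0 k.
Proof.
rewrite /dot (bigD1 k)//= !mxE !eqxx /= mulr1 mulrC big1 ?addr0// => l /negPf lk.
by rewrite !mxE lk andbF !mulr0.
Qed.

Lemma lipschitz2_norm2 : lipschitz2 1 (@norm2 R m).
Proof.
move=> x y; rewrite mul1r ler_norml; apply/andP; split.
  by rewrite lerBrDl lerBlDr norm2_sub_sym addrC -{1}(subrK x y) norm2D.
by rewrite lerBlDr -{1}(subrK y x) norm2D.
Qed.

End gradient.

(** * Passage from the local costs to the objective *)

Section objective_facts.
Context {R : realType} {n : nat} {dim : 'I_n -> nat} (G L : R)
  (f : 'I_n -> profile R dim -> R).
Hypothesis fP : problem G L f.
Hypothesis n0 : (0 < n)%N.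

Lemma objective_differentiable x : differentiable (objective f) x.
Proof.
have -> : objective f = n%:R^-1 *: (\sum_i f i).
  by apply/funext => y; rewrite /objective fctE /= fct_sumE.
apply: differentiableZ; apply: differentiable_sum => i.
by have [] := cost_smooth fP i.
Qed.

Lemma objective_gradient x : gradient (objective f) x = n%:R^-1 *: \sum_i gradient (f i) x.
Proof.
apply/rowP => k; rewrite !mxE summxE.
have -> : objective f = n%:R^-1 *: (\sum_i f i).
  by apply/funext => y; rewrite /objective fctE /= fct_sumE.
have di i : derivable (f i) x (delta_mx ord0 k).
  by apply: diff_derivable; have [] := cost_smooth fP i.
rewrite deriveZ; last exact: derivable_sum.
rewrite derive_sum//; congr (_ * _).
by apply: eq_bigr => i _; rewrite mxE.
Qed.

Lemma mean_norm2_le (m : nat) (v : 'I_n -> 'rV[R]_m) (c : R) :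
  (forall i, norm2 (v i) <= c) -> norm2 (n%:R^-1 *: \sum_i v i) <= c.
Proof.
move=> vc; rewrite norm2Z ger0_norm ?invr_ge0// ler_pdivrMl ?ltr0n//.
apply: le_trans (norm2_sum _ _ _) _; rewrite mulr_natl -[n in _ *+ n]card_ord -sumr_const.
by apply: ler_sum.
Qed.

Lemma objective_lipschitz : lipschitz2 G (objective f).
Proof.
move=> x y; rewrite /objective -mulrBr normrM ger0_norm ?invr_ge0//.
rewrite ler_pdivrMl ?ltr0n// -sumrB (le_trans (ler_norm_sum _ _ _))//.
rewrite mulr_natl -[n in _ *+ n]card_ord -sumr_const.
by apply: ler_sum => i _; exact: (cost_lipschitz fP).
Qed.

Lemma objective_smooth : smooth2 L (objective f).
Proof.
split; first exact: objective_differentiable.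
move=> x y; rewrite !objective_gradient -scalerBr -sumrB.
by apply: mean_norm2_le => i; have [_] := cost_smooth fP i.
Qed.

End objective_facts.

(** * Real-valued expectations *)

Section real_expectation.
Context {d : measure_display} {Omega : measurableType d} {R : realType}
  (P : probability Omega R).
Implicit Types X Y : Omega -> R.

Definition integrable_rv X := P.-integrable setT (EFin \o X).
Definition expect X : R := \int[P]_w X w.

Lemma integ_measurable X : integrable_rv X -> measurable_fun setT X.
Proof. by move=> /measurable_int /measurable_EFinP. Qed.

Lemma integral_Ex X : integrable_rv X -> (\int[P]_w (X w)%:E = (expect X)%:E)%E.
Proof. by move=> iX; rewrite /expect /Rintegral fineK// integrable_fin_num. Qed.

Lemma integ_le X Y : measurable_fun setT X -> (forall w, `|X w| <= Y w) ->
  integrable_rv Y -> integrable_rv X.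
Proof.
move=> mX XY iY; apply: (le_integrable measurableT _ _ iY).
  exact/measurable_EFinP.
by move=> w _ /=; rewrite lee_fin (le_trans (XY w)) ?ler_norm.
Qed.

Lemma integ_cst c : integrable_rv (fun=> c).
Proof. exact: finite_measure_integrable_cst. Qed.

Lemma integD X Y : integrable_rv X -> integrable_rv Y -> integrable_rv (fun w => X w + Y w).
Proof. by move=> iX iY; have := integrableD measurableT iX iY. Qed.

Lemma integZ c X : integrable_rv X -> integrable_rv (fun w => c * X w).
Proof. by move=> iX; have := integrableZl measurableT c iX. Qed.

Lemma integB X Y : integrable_rv X -> integrable_rv Y -> integrable_rv (fun w => X w - Y w).
Proof. by move=> iX iY; have := integrableB measurableT iX iY. Qed.

Lemma integ_sum (J : Type) (r : seq J) (p : pred J) (X : J -> Omega -> R) :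
  (forall j, p j -> integrable_rv (X j)) -> integrable_rv (fun w => \sum_(j <- r | p j) X j w).
Proof.
move=> iX; have := integrable_sum measurableT r iX.
by apply: eq_integrable => // w _; rewrite /= sumEFin.
Qed.

Lemma integ_norm X : integrable_rv X -> integrable_rv (fun w => `|X w|).
Proof. by move=> iX; have := integrable_abse iX. Qed.

Lemma expect_cst c : expect (fun=> c) = c.
Proof.
rewrite /expect Rintegral_cst// (_ : fine _ = 1) ?mulr1//.
exact: (congr1 fine (probability_setT P)).
Qed.

Lemma expectD X Y : integrable_rv X -> integrable_rv Y ->
  expect (fun w => X w + Y w) = expect X + expect Y.
Proof. by move=> iX iY; rewrite /expect RintegralD. Qed.

Lemma expectB X Y : integrable_rv X -> integrable_rv Y ->
  expect (fun w => X w - Y w) = expect X - expect Y.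
Proof. by move=> iX iY; rewrite /expect RintegralB. Qed.

Lemma expectZ c X : integrable_rv X -> expect (fun w => c * X w) = c * expect X.
Proof. by move=> iX; rewrite /expect RintegralZl. Qed.

Lemma expect_sum (J : Type) (r : seq J) (p : pred J) (X : J -> Omega -> R) :
  (forall j, p j -> integrable_rv (X j)) ->
  expect (fun w => \sum_(j <- r | p j) X j w) = \sum_(j <- r | p j) expect (X j).
Proof.
move=> iX; elim: r => [|j r IH].
  rewrite big_nil -[RHS]expect_cst; congr expect.
  by apply/funext => w; rewrite big_nil.
rewrite big_cons -IH; case: ifPn => pj; last first.
  by congr expect; apply/funext => w; rewrite big_cons (negPf pj).
rewrite -expectD; [|exact: iX|exact: integ_sum].
by congr expect; apply/funext => w; rewrite big_cons pj.
Qed.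

Lemma expect_le X Y : integrable_rv X -> integrable_rv Y ->
  (forall w, X w <= Y w) -> expect X <= expect Y.
Proof. by move=> iX iY XY; apply: le_Rintegral. Qed.

Definition square_integrable X := measurable_fun setT X /\ integrable_rv (fun w => X w ^+ 2).

Lemma integM X Y : square_integrable X -> square_integrable Y ->
  integrable_rv (fun w => X w * Y w).
Proof.
move=> [mX iX] [mY iY]; apply: integ_le (integD iX iY).
  exact: measurable_funM.
move=> w; rewrite normrM -(real_normK (num_real (X w))) -(real_normK (num_real (Y w))).
have := sqr_ge0 (`|X w| - `|Y w|).
have := normr_ge0 (X w); have := normr_ge0 (Y w).
by rewrite sqrrB mulr2n; nra.
Qed.

Lemma square_integ_integ X : square_integrable X -> integrable_rv X.
Proof.
move=> [mX iX]; apply: integ_le (integD (integ_cst 1) iX) => // w.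
rewrite -(real_normK (num_real (X w))).
by have := sqr_ge0 (`|X w| - 1); rewrite sqrrB mulr2n expr1n; nra.
Qed.

Lemma square_integ_cst c : square_integrable (fun=> c).
Proof. by split => //; exact: integ_cst. Qed.

Lemma square_integZ c X : square_integrable X -> square_integrable (fun w => c * X w).
Proof.
move=> [mX iX]; split; first exact: measurable_funM.
rewrite (_ : (fun w => (c * X w) ^+ 2) = (fun w => c ^+ 2 * X w ^+ 2)).
  exact: integZ.
by apply/funext => w; exact: exprMn.
Qed.

Lemma square_integD X Y : square_integrable X -> square_integrable Y ->
  square_integrable (fun w => X w + Y w).
Proof.
move=> sX sY; have [[mX iX] [mY iY]] := (sX, sY); split; first exact: measurable_funD.
rewrite (_ : (fun w => _) = (fun w => X w ^+ 2 + (2 * (X w * Y w) + Y w ^+ 2))).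
  by apply: integD => //; apply: integD => //; apply: integZ; exact: integM.
by apply/funext => w; ring.
Qed.

Lemma square_integ_sum (J : Type) (r : seq J) (p : pred J) (X : J -> Omega -> R) :
  (forall j, p j -> square_integrable (X j)) ->
  square_integrable (fun w => \sum_(j <- r | p j) X j w).
Proof.
move=> sX; elim: r => [|j r IH].
  rewrite (_ : (fun w => _) = fun=> 0); first exact: square_integ_cst.
  by apply/funext => w; rewrite big_nil.
have [pj|pj] := boolP (p j).
  rewrite (_ : (fun w => _) = (fun w => X j w + \sum_(j <- r | p j) X j w)).
    by apply: square_integD => //; exact: sX.
  by apply/funext => w; rewrite big_cons pj.
rewrite (_ : (fun w => _) = (fun w => \sum_(j <- r | p j) X j w))//.
by apply/funext => w; rewrite big_cons (negPf pj).
Qed.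

Lemma square_integ_bounded c X Y : measurable_fun setT X -> (forall w, `|X w| <= c) ->
  square_integrable Y -> square_integrable (fun w => X w * Y w).
Proof.
move=> mX Xc [mY iY]; split; first exact: measurable_funM.
apply: integ_le (integZ (c ^+ 2) iY); first by apply: measurable_funX; exact: measurable_funM.
move=> w; rewrite ger0_norm ?sqr_ge0// exprMn ler_wpM2r ?sqr_ge0//.
rewrite -(real_normK (num_real (X w))) ler_sqr ?nnegrE//.
exact: le_trans (Xc w).
Qed.

(** Young's inequality with a free weight [t], optimal at [sqrt b / sqrt a]. The hypotheses take
    bounds on the moments, so that worst-case bounds can be inserted directly. *)
Lemma expect_cauchy_schwarz X Y (a b : R) : square_integrable X -> square_integrable Y ->
  expect (fun w => X w ^+ 2) <= a -> expect (fun w => Y w ^+ 2) <= b -> 0 < a -> 0 <= b ->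
  expect (fun w => X w * Y w) <= Num.sqrt a * Num.sqrt b.
Proof.
move=> sX sY Xa Yb a0 b0; have [[mX iX] [mY iY]] := (sX, sY).
have young t : 0 < t -> expect (fun w => X w * Y w) <= (t * a + t^-1 * b) / 2.
  move=> t0; apply: (@le_trans _ _ (expect (fun w => t / 2 * X w ^+ 2 + t^-1 / 2 * Y w ^+ 2))).
    apply: expect_le; first exact: integM.
      by apply: integD; exact: integZ.
    move=> w; rewrite -subr_ge0.
    have -> : t / 2 * X w ^+ 2 + t^-1 / 2 * Y w ^+ 2 - X w * Y w =
       (t * X w - Y w) ^+ 2 / (2 * t) by field; rewrite gt_eqF.
    by rewrite divr_ge0 ?sqr_ge0// mulr_ge0// ltW.
  rewrite expectD ?expectZ//; [|exact: integZ|exact: integZ].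
  have := ler_wpM2l (ltW t0) Xa; have ti : 0 <= t^-1 by rewrite invr_ge0 ltW.
  have := ler_wpM2l ti Yb.
  by lra.
have [b00|b1] := eqVneq b 0.
  rewrite b00 sqrtr0 mulr0 leNgt; apply/negP => E0.
  (* With [b = 0] the weight [E / a] turns a positive expectation [E] into [E <= E / 2]. *)
  have := young (expect (fun w => X w * Y w) / a) (divr_gt0 E0 a0).
  by rewrite b00 mulr0 addr0 divfK ?gt_eqF//; lra.
have bp : 0 < b by rewrite lt0r b1.
have sa : 0 < Num.sqrt a by rewrite sqrtr_gt0.
have sb : 0 < Num.sqrt b by rewrite sqrtr_gt0.
apply: le_trans (young (Num.sqrt b / Num.sqrt a) (divr_gt0 sb sa)) _.
rewrite -{2}(sqr_sqrtr (ltW a0)) -{3}(sqr_sqrtr (ltW bp)) le_eqVlt; apply/orP; left.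
by apply/eqP; field; rewrite !gt_eqF.
Qed.

End real_expectation.

(** * Integrating out a single variable *)

Section independent_expectations.
Context {d : measure_display} {Omega : measurableType d} {R : realType}
  {P : probability Omega R} {I : choiceType} (xi : I -> {RV P >-> R}).
Hypothesis xi_indep : mutually_independent xi.
Local Notation knowing S := (g_sigma_algebraType (cylinders xi S)).
Local Notation Ex := (expect P).

(** One statement for several uses: with [a = b] and two integrands it transports Stein's identity
    or a vanishing mean; with two variables of equal law and one integrand it exchanges them. *)
Lemma indep_Ex_eq (S : set I) a b (Phi Psi : R -> Omega -> R) : ~ S a -> ~ S b ->
  measurable_fun setT (fun y : R * knowing S => Phi y.1 y.2) ->
  measurable_fun setT (fun y : R * knowing S => Psi y.1 y.2) ->
  integrable_rv P (fun w => Phi (xi a w) w) -> integrable_rv P (fun w => Psi (xi b w) w) ->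
  (forall w, \int[distribution P (xi a)]_s (Phi s w)%:E =
             \int[distribution P (xi b)]_s (Psi s w)%:E)%E ->
  Ex (fun w => Phi (xi a w) w) = Ex (fun w => Psi (xi b w) w).
Proof.
move=> Sa Sb mPhi mPsi iPhi iPsi H; rewrite /Ex /Rintegral; congr fine.
have E1 := @indep_fubini _ _ _ _ _ _ xi_indep S a (fun y => (Phi y.1 y.2)%:E) Sa.
have E2 := @indep_fubini _ _ _ _ _ _ xi_indep S b (fun y => (Psi y.1 y.2)%:E) Sb.
have m1 : measurable_fun setT (fun y : R * knowing S => (Phi y.1 y.2)%:E).
  by apply/measurable_EFinP.
have m2 : measurable_fun setT (fun y : R * knowing S => (Psi y.1 y.2)%:E).
  by apply/measurable_EFinP.
rewrite (E1 m1 iPhi) (E2 m2 iPsi).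
by apply: eq_integral => w _; exact: H.
Qed.

Lemma indep_Ex_mean0 (S : set I) a (Y : Omega -> R) : ~ S a ->
  measurable_fun setT (Y : knowing S -> R) -> integrable_rv P (xi a) ->
  Ex (xi a) = 0 -> integrable_rv P (fun w => xi a w * Y w) ->
  Ex (fun w => xi a w * Y w) = 0.
Proof.
move=> Sa mY ia Ea iaY.
rewrite -[RHS](expect_cst P 0).
apply: (@indep_Ex_eq S a a (fun s w => s * Y w) (fun _ _ => 0)) => //.
- apply: measurable_funM => //.
  exact: (measurableT_comp mY measurable_snd).
- exact: integ_cst.
move=> w; rewrite integral0.
under eq_integral do rewrite mulrC EFinM.
have m1 : measurable_fun [set: R] (fun s : R => s%:E) by apply/measurable_EFinP.
have i1 : (distribution P (xi a)).-integrable setT (fun s : R => s%:E).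
  by apply: integrable_pushforward.
rewrite integralZl//.
rewrite integral_distribution// (_ : (\int[P]_w0 _ = 0)%E) ?mule0//.
by rewrite -[RHS]/(0%:E) -Ea -integral_Ex.
Qed.

(** Tonelli computes the integral of the squared product before its finiteness is known, so that
    integrability comes out as a conclusion. *)
Lemma indep_Ex_square (S : set I) a (Y : Omega -> R) : ~ S a ->
  measurable_fun setT (Y : knowing S -> R) -> square_integrable P (xi a) ->
  square_integrable P Y ->
  square_integrable P (fun w => xi a w * Y w) /\
  Ex (fun w => (xi a w * Y w) ^+ 2) =
    Ex (fun w => xi a w ^+ 2) * Ex (fun w => Y w ^+ 2).
Proof.
move=> Sa mY [ma ia] [mY' iY].
have E1 := @indep_tonelli _ _ _ _ _ _ xi_indep S a (fun y => ((y.1 * Y y.2) ^+ 2)%:E) Sa.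
have mS : measurable_fun setT (fun y : R * knowing S => ((y.1 * Y y.2) ^+ 2)%:E).
  apply/measurable_EFinP; apply: measurable_funX; apply: measurable_funM => //.
  exact: (measurableT_comp mY measurable_snd).
have Y0 : forall y : R * knowing S, (0 <= ((y.1 * Y y.2) ^+ 2)%:E)%E.
  by move=> y; rewrite lee_fin sqr_ge0.
have m2 : measurable_fun [set: R] (fun s : R => (s ^+ 2)%:E).
  by apply/measurable_EFinP; exact: measurable_funX.
have E2 : (\int[P]_w ((xi a w * Y w) ^+ 2)%:E =
    (Ex (fun w => xi a w ^+ 2) * Ex (fun w => Y w ^+ 2))%:E)%E.
  rewrite (E1 mS Y0) /=.
  have inner w : (\int[distribution P (xi a)]_s ((s * Y w) ^+ 2)%:E =
      (Ex (fun w => xi a w ^+ 2))%:E * (Y w ^+ 2)%:E)%E.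
    under eq_integral do rewrite exprMn EFinM.
    rewrite ge0_integralZr//; last 2 first.
      by move=> s _; rewrite lee_fin sqr_ge0.
      by rewrite lee_fin sqr_ge0.
    rewrite ge0_integral_distribution//; last by move=> s; rewrite lee_fin sqr_ge0.
    by rewrite integral_Ex.
  under eq_integral do rewrite inner.
  by rewrite integralZl//= integral_Ex.
have iS : integrable_rv P (fun w => (xi a w * Y w) ^+ 2).
  apply/integrableP; split.
    by apply/measurable_EFinP; apply: measurable_funX; exact: measurable_funM.
  under eq_integral do rewrite /= ger0_norm ?sqr_ge0//.
  by rewrite E2 ltry.
split; first by split => //; exact: measurable_funM.
by apply: EFin_inj; rewrite -integral_Ex.
Qed.

End independent_expectations.

(** * The iteration *)

Lemma stepwise_eq (T : Type) (E : nat -> T) (N : nat) :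
  (forall m, (m < N)%N -> E m = E m.+1) -> E 0%N = E N.
Proof.
elim: N => // N IH step; rewrite -step//; apply: IH => m mN.
by apply: step; exact: ltnW.
Qed.

Section algorithm.
Context {d : measure_display} {Omega : measurableType d} {R : realType}
  {P : probability Omega R} {n : nat} {dim : 'I_n -> nat}.
Variables (G L sigma u eta : R) (f : 'I_n -> profile R dim -> R).
Hypotheses (fP : problem G L f) (n0 : (0 < n)%N) (G0 : 0 <= G) (L0 : 0 < L)
  (u0 : 0 < u) (eta0 : 0 < eta).
Variables (z : forall i : 'I_n, nat -> 'I_(dim i) -> {RV P >-> R})
  (noiseP noiseM : 'I_n -> nat -> {RV P >-> R}).
Hypothesis rand : zfo_randomness z noiseP noiseM sigma.
Local Notation D := (\sum_i dim i)%N.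
Local Notation idx := (nat * ({i : 'I_n & 'I_(dim i)} + ('I_n + 'I_n)))%type.
Local Notation xi := (primitive_variable z noiseP noiseM).
Local Notation knowing S := (g_sigma_algebraType (cylinders xi S)).
Local Notation Ex := (expect P).
Local Notation integ := (integrable_rv P).
Local Notation square_integ := (square_integrable P).

(** [tagnat.sig] splits a flat coordinate into its agent and its place in the agent's block;
    [tagnat.sig1] returns the agent alone. *)
Definition coord_index (t : nat) (k : 'I_D) : idx := (t, inl (tagnat.sig k)).
Definition noiseP_index (t : nat) (j : 'I_n) : idx := (t, inr (inl j)).
Definition noiseM_index (t : nat) (j : 'I_n) : idx := (t, inr (inr j)).

Definition Z (t : nat) (w : Omega) : profile R dim := stack (perturbation z w) t.

Lemma ZE t w k : Z t w ord0 k = xi (coord_index t k) w.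
Proof. by rewrite /Z /stack !mxE. Qed.

Lemma ZE_fun t k : (fun w => Z t w ord0 k) = xi (coord_index t k).
Proof. by apply/funext => w; exact: ZE. Qed.

Lemma coord_index_inj t k l : coord_index t k = coord_index t l -> k = l.
Proof. by move=> [] /(can_inj tagnat.sigK). Qed.

Definition past (t : nat) : set idx := [set b | (b.1 < t)%N].
Definition others (a : idx) : set idx := [set b | b != a].

Variables (X : nat -> Omega -> profile R dim) (x0 : profile R dim).
Variable tau : nat -> 'I_n -> 'I_n -> int.
Hypothesis tau_le : forall t i j, tau t i j <= t%:Z.
Hypothesis X_init : forall w, X 0 w = x0.

Definition observed (j : 'I_n) (t : nat) (w : Omega) : R :=
  ((f j (X t w + u *: Z t w) + noiseP j t w)
   - (f j (X t w - u *: Z t w) + noiseM j t w)) / (2 * u).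

Definition sample (j : 'I_n) (k : 'I_D) (t : nat) (w : Omega) : R :=
  observed j t w * Z t w ord0 k.

Definition estimate (t : nat) (w : Omega) : profile R dim :=
  \row_k (n%:R^-1 *
    \sum_j at_stamp (fun s => sample j k s w) (tau t (tagnat.sig1 k) j)).

Hypothesis X_step : forall t w, X t.+1 w = X t w - eta *: estimate t w.

(** * What the iterates depend on *)

Lemma Z_known (S : set idx) t k : S (coord_index t k) ->
  measurable_fun setT ((fun w => Z t w ord0 k) : knowing S -> R).
Proof. by move=> Sk; rewrite ZE_fun; exact: knowing_xi. Qed.

Lemma shifted_known (S : set idx) (g : profile R dim -> R) (K r : R) t :
  lipschitz2 K g -> (forall k, S (coord_index t k)) ->
  (forall k, measurable_fun setT ((fun w => X t w ord0 k) : knowing S -> R)) ->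
  measurable_fun setT ((fun w => g (X t w + r *: Z t w)) : knowing S -> R).
Proof.
move=> gK Sz mX; apply: (measurable_lipschitz gK) => k.
rewrite (_ : (fun w => _) = (fun w => X t w ord0 k + r * Z t w ord0 k)).
  apply: measurable_funD; first exact: mX.
  by apply: measurable_funM => //; exact: Z_known.
by apply/funext => w; rewrite !mxE.
Qed.

Lemma observed_known (S : set idx) j t :
  (forall k, S (coord_index t k)) -> S (noiseP_index t j) -> S (noiseM_index t j) ->
  (forall k, measurable_fun setT ((fun w => X t w ord0 k) : knowing S -> R)) ->
  measurable_fun setT (observed j t : knowing S -> R).
Proof.
move=> Sz SP SM mX; apply: measurable_funM => //; apply: measurable_funB.
  apply: measurable_funD; first exact: (shifted_known _ (cost_lipschitz fP j)).
  exact: (knowing_xi SP).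
apply: measurable_funD; last exact: (knowing_xi SM).
rewrite (_ : (fun w => _) = (fun w => f j (X t w + (- u) *: Z t w))).
  exact: (shifted_known _ (cost_lipschitz fP j)).
by apply/funext => w; rewrite scaleNr.
Qed.

(** Strong induction over the recursion, for all [S] at once: each summand of the step is 0 or a
    sample of a fixed time [s <= t], whose variables all lie in the past of [t.+1]. *)
Lemma X_known (S : set idx) t k : past t `<=` S ->
  measurable_fun setT ((fun w => X t w ord0 k) : knowing S -> R).
Proof.
elim/ltn_ind : t S k => t IH S k tS; case: t => [|t] in IH tS *.
  by rewrite (_ : (fun w => _) = fun=> x0 ord0 k)//; apply/funext => w; rewrite X_init.
have pS s : (s <= t)%N -> past s `<=` S.
  by move=> st b bs; apply: tS; rewrite /past /=; exact: leq_trans bs (leqW st).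
rewrite (_ : (fun w => _) = (fun w => X t w ord0 k - eta * (n%:R^-1 *
    \sum_j at_stamp (fun s => sample j k s w) (tau t (tagnat.sig1 k) j)))); last first.
  by apply/funext => w; rewrite X_step !mxE.
apply: measurable_funB; first by apply: IH => //; exact: pS.
apply: measurable_funM => //; apply: measurable_funM => //.
apply: measurable_sum => j; have := tau_le t (tagnat.sig1 k) j.
case: (tau t _ j) => [s|s] /= st; last exact: measurable_cst.
have st' : (s <= t)%N by move: st; lia.
have Sin c : S (s, c) by apply: tS; rewrite /past /=; lia.
apply: measurable_funM; last by apply: Z_known; exact: Sin.
apply: observed_known => [l|||l]; [exact: Sin..|].
by apply: IH => //; exact: pS.
Qed.

Lemma past_others t a : ~ (a.1 < t)%N -> past t `<=` others a.
Proof. by move=> ta b bt; apply/eqP => ba; apply: ta; rewrite -ba. Qed.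

Lemma X_measurable t k : measurable_fun setT (fun w => X t w ord0 k).
Proof. exact: (knowing_fun (X_known k (@subsetT _ _))). Qed.

Lemma Z_measurable t k : measurable_fun setT (fun w => Z t w ord0 k).
Proof. by rewrite ZE_fun; exact: measurable_funP. Qed.

(** * Moments of the perturbations, the noises and the samples *)

Lemma law_coord t k (g : R -> \bar R) : measurable_fun setT g ->
  (\int[distribution P (xi (coord_index t k))]_s g s = \int[normal_prob 0 1]_s g s)%E.
Proof.
by move=> mg; apply: normal_law_integral => // A mA; exact: (rand_gaussian rand).
Qed.

Lemma coord_integ (g : R -> R) (K : R) t k : measurable_fun setT g ->
  (forall s, `|g s| <= K * (1 + s ^+ 4)) -> integ (fun w => g (Z t w ord0 k)).
Proof.
move=> mg gK; apply/integrableP; split.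
  by apply/measurable_EFinP; apply: measurableT_comp => //; exact: Z_measurable.
have /integrableP[mgE] := normal_integrable mg gK.
have mgR : measurable_fun [set: R] (fun s : R => `|(g s)%:E|)%E.
  by apply: measurableT_comp => //; exact/measurable_EFinP.
rewrite -(law_coord t k mgR) ge0_integral_distribution//.
by apply: le_lt_trans; rewrite le_eqVlt; apply/orP; left; apply/eqP;
  apply: eq_integral => w _; rewrite /= ZE.
Qed.

Lemma coord_Ex (g : R -> R) (K : R) t k : measurable_fun setT g ->
  (forall s, `|g s| <= K * (1 + s ^+ 4)) ->
  ((Ex (fun w => g (Z t w ord0 k)))%:E = \int[normal_prob 0 1]_s (g s)%:E)%E.
Proof.
move=> mg gK; rewrite -integral_Ex; last exact: coord_integ gK.
have mgR : measurable_fun [set: R] (fun s : R => (g s)%:E) by exact/measurable_EFinP.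
rewrite -(law_coord t k mgR) integral_distribution//.
- by apply: eq_integral => w _; rewrite /= ZE.
have := coord_integ t k mg gK; rewrite /integrable_rv; congr (_.-integrable _ _).
by apply/funext => w; rewrite /= ZE.
Qed.

Lemma pow_growth (m : nat) (s : R) : (m <= 4)%N -> `|s ^+ m| <= 1 * (1 + s ^+ 4).
Proof.
move=> m4; rewrite mul1r normrX (_ : s ^+ 4 = `|s| ^+ 4); last first.
  by rewrite -normrX ger0_norm// exprn_even_ge0.
have := normr_ge0 s; move: `|s| => y y0.
have [y1|y1] := lerP y 1.
  by rewrite (le_trans (exprn_ile1 _ y0 y1))// lerDl exprn_ge0.
by rewrite (le_trans (ler_weXn2l (ltW y1) m4))// lerDr.
Qed.

Lemma Z_second_moment t k : square_integ (fun w => Z t w ord0 k) /\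
  Ex (fun w => Z t w ord0 k ^+ 2) = 1.
Proof.
have m2 : measurable_fun [set: R] (fun s : R => s ^+ 2) by exact: measurable_funX.
split; first split; first exact: Z_measurable.
  by apply: (@coord_integ (fun s => s ^+ 2) 1) => // s; exact: pow_growth.
apply: EFin_inj; rewrite (@coord_Ex (fun s => s ^+ 2) 1)// => [|s].
  exact: normal_second_moment.
exact: pow_growth.
Qed.

Lemma Z_fourth_moment t k : square_integ (fun w => Z t w ord0 k ^+ 2) /\
  Ex (fun w => (Z t w ord0 k ^+ 2) ^+ 2) = gaussian_kurtosis.
Proof.
have m2 : measurable_fun [set: R] (fun s : R => s ^+ 4) by exact: measurable_funX.
have E : (fun w => (Z t w ord0 k ^+ 2) ^+ 2) = (fun w => Z t w ord0 k ^+ 4).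
  by apply/funext => w; rewrite -exprM.
rewrite /square_integrable E; split; first split.
- by apply: measurable_funX; exact: Z_measurable.
- by apply: (@coord_integ (fun s => s ^+ 4) 1) => // s; exact: pow_growth.
apply: EFin_inj; rewrite (@coord_Ex (fun s => s ^+ 4) 1)// => [|s].
  exact: normal_fourth_moment.
exact: pow_growth.
Qed.

Lemma normZ_measurable t : measurable_fun setT (fun w => norm2 (Z t w)).
Proof.
by apply: (measurable_lipschitz lipschitz2_norm2) => k; exact: Z_measurable.
Qed.

Lemma normZ_moment t : square_integ (fun w => norm2 (Z t w)) /\
  Ex (fun w => norm2 (Z t w) ^+ 2) = D%:R.
Proof.
have E : (fun w => norm2 (Z t w) ^+ 2) = (fun w => \sum_k Z t w ord0 k ^+ 2).
  by apply/funext => w; exact: sqr_norm2.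
have i k : integ (fun w => Z t w ord0 k ^+ 2) by have [[]] := Z_second_moment t k.
rewrite /square_integrable E; split; first split; [exact: normZ_measurable|exact: integ_sum|].
rewrite expect_sum// (eq_bigr (fun=> 1)); last by move=> k _; exact: (Z_second_moment t k).2.
by rewrite sumr_const card_ord.
Qed.

(** [2 a b <= a^2 + b^2] for [a = Z_l^2] and [b = Z_k^2] reduces every term to fourth moments and
    treats [l = k] like the others. *)
Lemma normZ_coord_moment t k : square_integ (fun w => norm2 (Z t w) * Z t w ord0 k) /\
  Ex (fun w => (norm2 (Z t w) * Z t w ord0 k) ^+ 2) <= D%:R * gaussian_kurtosis.
Proof.
have E : (fun w => (norm2 (Z t w) * Z t w ord0 k) ^+ 2) =
    (fun w => \sum_l Z t w ord0 l ^+ 2 * Z t w ord0 k ^+ 2).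
  by apply/funext => w; rewrite exprMn sqr_norm2 mulr_suml.
have i l : integ (fun w => Z t w ord0 l ^+ 2 * Z t w ord0 k ^+ 2).
  by apply: integM; [have [] := Z_fourth_moment t l|have [] := Z_fourth_moment t k].
rewrite /square_integrable E; split; first split.
- by apply: measurable_funM; [exact: normZ_measurable|exact: Z_measurable].
- exact: integ_sum.
rewrite expect_sum// (_ : D%:R * gaussian_kurtosis = \sum_(l < D) gaussian_kurtosis);
  last by rewrite sumr_const card_ord mulr_natl.
apply: ler_sum => l _.
have [[_ il] El] := Z_fourth_moment t l; have [[_ ik] Ek] := Z_fourth_moment t k.
apply: (@le_trans _ _ (Ex (fun w => 2^-1 * ((Z t w ord0 l ^+ 2) ^+ 2 + (Z t w ord0 k ^+ 2) ^+ 2)))).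
  apply: expect_le => //; first by apply: integZ; exact: integD.
  by move=> w; have := sqr_ge0 (Z t w ord0 l ^+ 2 - Z t w ord0 k ^+ 2); rewrite sqrrB mulr2n; nra.
by rewrite expectZ ?expectD//; [rewrite El Ek; lra|exact: integD].
Qed.

(** With mean zero the variance is the integral of the square, so the variance bound also supplies
    the integrability of [Y ^+ 2]. *)
Lemma noise_moments (Y : {RV P >-> R}) : ('E_P[Y] = 0)%E -> ('V_P[Y] <= (sigma ^+ 2)%:E)%E ->
  [/\ square_integ Y, Ex Y = 0 & Ex (fun w => Y w ^+ 2) <= sigma ^+ 2].
Proof.
move=> EX VX.
have E2 : (\int[P]_w (Y w ^+ 2)%:E <= (sigma ^+ 2)%:E)%E.
  move: VX; rewrite /variance covariance.unlock EX expectation.unlock.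
  apply: le_trans; rewrite le_eqVlt; apply/orP; left; apply/eqP.
  by apply: eq_integral => w _ /=; rewrite !fctE /= subr0 expr2.
have iX : integ (fun w => Y w ^+ 2).
  apply/integrableP; split.
    by apply/measurable_EFinP; apply: measurable_funX; exact: measurable_funP.
  under eq_integral do rewrite /= ger0_norm ?sqr_ge0//.
  exact: le_lt_trans E2 (ltry _).
split; first by split => //; exact: measurable_funP.
- by move: EX; rewrite expectation.unlock /expect /Rintegral => ->.
- by rewrite -lee_fin -integral_Ex.
Qed.

Lemma noiseP_moments t j : [/\ square_integ (xi (noiseP_index t j)),
  Ex (xi (noiseP_index t j)) = 0 &
  Ex (fun w => xi (noiseP_index t j) w ^+ 2) <= sigma ^+ 2].
Proof. by apply: noise_moments; [exact: (rand_meanP rand)|exact: (rand_varP rand)]. Qed.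

Lemma noiseM_moments t j : [/\ square_integ (xi (noiseM_index t j)),
  Ex (xi (noiseM_index t j)) = 0 &
  Ex (fun w => xi (noiseM_index t j) w ^+ 2) <= sigma ^+ 2].
Proof. by apply: noise_moments; [exact: (rand_meanM rand)|exact: (rand_varM rand)]. Qed.

(** The value at [X t] cancels in the symmetric difference; once it is subtracted, the Lipschitz
    bound by [norm2 (Z t w)] gives integrability directly. *)
Definition cost_increment (j : 'I_n) (t : nat) (r : R) (w : Omega) : R :=
  f j (X t w + r *: Z t w) - f j (X t w).

Lemma cost_increment_le j t r w :
  `|cost_increment j t r w| <= `|r| * G * norm2 (Z t w).
Proof.
apply: le_trans (cost_lipschitz fP j _ _) _.
by rewrite addrC addKr norm2Z mulrA (mulrC G).
Qed.

Lemma cost_increment_known (S : set idx) j t r : past t `<=` S ->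
  (forall k, S (coord_index t k)) ->
  measurable_fun setT (cost_increment j t r : knowing S -> R).
Proof.
move=> tS Sz; apply: measurable_funB.
  by apply: (shifted_known _ (cost_lipschitz fP j)) => // k; exact: X_known.
by apply: (measurable_lipschitz (cost_lipschitz fP j)) => k; exact: X_known.
Qed.

Lemma cost_increment_measurable j t r : measurable_fun setT (cost_increment j t r).
Proof.
by apply: (@knowing_fun _ _ _ _ _ xi setT); apply: cost_increment_known.
Qed.

Definition cost_slope (j : 'I_n) (t : nat) (w : Omega) : R :=
  (cost_increment j t u w - cost_increment j t (- u) w) / (2 * u).

Lemma cost_slope_le j t w : `|cost_slope j t w| <= G * norm2 (Z t w).
Proof.
have u2 : 0 < 2 * u by rewrite mulr_gt0.
rewrite /cost_slope normrM normfV (gtr0_norm u2) ler_pdivrMr//.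
apply: le_trans (ler_normB _ _) _.
have := cost_increment_le j t u w; have := cost_increment_le j t (- u) w.
by rewrite normrN (gtr0_norm u0); nra.
Qed.

Lemma sampleE j k t w : sample j k t w = cost_slope j t w * Z t w ord0 k +
  (xi (coord_index t k) w * xi (noiseP_index t j) w -
   xi (coord_index t k) w * xi (noiseM_index t j) w) / (2 * u).
Proof.
rewrite /sample /observed /cost_slope /cost_increment -ZE scaleNr.
change (xi (noiseP_index t j) w) with (noiseP j t w).
change (xi (noiseM_index t j) w) with (noiseM j t w).
by field; rewrite gt_eqF.
Qed.

Lemma coord_noiseP t k j :
  square_integ (fun w => xi (coord_index t k) w * xi (noiseP_index t j) w) /\
  Ex (fun w => (xi (coord_index t k) w * xi (noiseP_index t j) w) ^+ 2) <= sigma ^+ 2.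
Proof.
have [sP _ eP] := noiseP_moments t j.
have [sz ez] := Z_second_moment t k; rewrite ZE_fun in sz.
have ez' : Ex (fun w => xi (coord_index t k) w ^+ 2) = 1.
  by rewrite -ez; congr Ex; apply/funext => w; rewrite ZE.
have [||||] := @indep_Ex_square _ _ _ _ _ _ (rand_indep rand) (others (coord_index t k))
  (coord_index t k) (xi (noiseP_index t j)) => //.
- by rewrite /others /= eqxx.
- by apply: knowing_xi; apply/eqP; discriminate.
by move=> ? ->; rewrite ez' mul1r.
Qed.

Lemma coord_noiseM t k j :
  square_integ (fun w => xi (coord_index t k) w * xi (noiseM_index t j) w) /\
  Ex (fun w => (xi (coord_index t k) w * xi (noiseM_index t j) w) ^+ 2) <= sigma ^+ 2.
Proof.
have [sP _ eP] := noiseM_moments t j.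
have [sz ez] := Z_second_moment t k; rewrite ZE_fun in sz.
have ez' : Ex (fun w => xi (coord_index t k) w ^+ 2) = 1.
  by rewrite -ez; congr Ex; apply/funext => w; rewrite ZE.
have [||||] := @indep_Ex_square _ _ _ _ _ _ (rand_indep rand) (others (coord_index t k))
  (coord_index t k) (xi (noiseM_index t j)) => //.
- by rewrite /others /= eqxx.
- by apply: knowing_xi; apply/eqP; discriminate.
by move=> ? ->; rewrite ez' mul1r.
Qed.

(** Integrating out the plus noise kills the mixed term, so the two noises together contribute
    [sigma^2 / (2 u^2)] and not twice as much. *)
Lemma noise_cross t k j :
  Ex (fun w => (xi (coord_index t k) w * xi (noiseP_index t j) w) *
    (xi (coord_index t k) w * xi (noiseM_index t j) w)) = 0.
Proof.
have [sP mP _] := noiseP_moments t j.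
have E : (fun w => (xi (coord_index t k) w * xi (noiseP_index t j) w) *
    (xi (coord_index t k) w * xi (noiseM_index t j) w)) =
  (fun w => xi (noiseP_index t j) w *
    (xi (coord_index t k) w ^+ 2 * xi (noiseM_index t j) w)).
  by apply/funext => w; ring.
rewrite E; apply: (@indep_Ex_mean0 _ _ _ _ _ _ (rand_indep rand)
  (others (noiseP_index t j)) (noiseP_index t j)) => //.
- by rewrite /others /= eqxx.
- apply: measurable_funM; last by apply: knowing_xi; apply/eqP; discriminate.
  by apply: measurable_funX; apply: knowing_xi; apply/eqP; discriminate.
- exact: square_integ_integ.
- by rewrite -E; apply: integM; [have [] := coord_noiseP t k j|have [] := coord_noiseM t k j].
Qed.

(** 5/8 is the Young weight 5/4 times the 1/2 of the noise part [sigma^2 / (2 u^2)]; the second term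
    bounds the part coming from the costs and does not grow as [u] tends to 0. *)
Definition sample_bound : R :=
  5 / 8 * (sigma ^+ 2 / u ^+ 2) + 5 * G ^+ 2 * (D%:R * gaussian_kurtosis).

Lemma sample_measurable j k t : measurable_fun setT (sample j k t).
Proof.
apply: measurable_funM; last exact: Z_measurable.
apply: (@knowing_fun _ _ _ _ _ xi setT); apply: observed_known => // l.
exact: X_known.
Qed.

(* Young's inequality with weights 5/4 and 5 leaves the noise term dominant. *)
Lemma sample_moment j k t : square_integ (sample j k t) /\
  Ex (fun w => sample j k t w ^+ 2) <= sample_bound.
Proof.
have [sP eP] := coord_noiseP t k j; have [sM eM] := coord_noiseM t k j.
have [[mZ iZ] eZ] := normZ_coord_moment t k.
have eX := noise_cross t k j; have iX := integM sP sM.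
have [[mP iP] [mM iM]] := (sP, sM).
pose p w := xi (coord_index t k) w * xi (noiseP_index t j) w.
pose m w := xi (coord_index t k) w * xi (noiseM_index t j) w.
pose c := 5 / (16 * u ^+ 2).
pose Y w := c * (p w ^+ 2 - 2 * (p w * m w) + m w ^+ 2) +
  5 * G ^+ 2 * (norm2 (Z t w) * Z t w ord0 k) ^+ 2.
have i1 : integ (fun w => p w ^+ 2 - 2 * (p w * m w)) by apply: integB => //; exact: integZ.
have i2 : integ (fun w => p w ^+ 2 - 2 * (p w * m w) + m w ^+ 2) by exact: integD.
have iY : integ Y by apply: integD; exact: integZ.
have bY w : sample j k t w ^+ 2 <= Y w.
  have -> : Y w = 5 / 4 * ((p w - m w) / (2 * u)) ^+ 2 +
      5 * (G * norm2 (Z t w) * Z t w ord0 k) ^+ 2.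
    by rewrite /Y /c; field; rewrite gt_eqF.
  rewrite sampleE -/(p w) -/(m w).
  have sl : (cost_slope j t w * Z t w ord0 k) ^+ 2 <= (G * norm2 (Z t w) * Z t w ord0 k) ^+ 2.
    rewrite ![(_ * Z t w ord0 k) ^+ 2]exprMn ler_wpM2r ?sqr_ge0//.
    rewrite -(real_normK (num_real (cost_slope j t w))) ler_sqr ?nnegrE//.
      exact: cost_slope_le.
    by rewrite mulr_ge0 ?norm2_ge0.
  move: sl; move: (cost_slope j t w * Z t w ord0 k)
    ((G * norm2 (Z t w) * Z t w ord0 k) ^+ 2) ((p w - m w) / (2 * u)) => A B N AB.
  apply: (@le_trans _ _ (5 / 4 * N ^+ 2 + 5 * A ^+ 2)); last by lra.
  by rewrite -subr_ge0 (_ : _ - _ = (2 * A - N / 2) ^+ 2) ?sqr_ge0//; field.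
have iS : integ (fun w => sample j k t w ^+ 2).
  apply: integ_le iY; first by apply: measurable_funX; exact: sample_measurable.
  by move=> w; rewrite ger0_norm ?sqr_ge0.
split; first by split => //; exact: sample_measurable.
apply: le_trans (expect_le iS iY bY) _.
rewrite /Y expectD; [|exact: integZ|exact: integZ].
rewrite !expectZ// expectD// expectB//; last exact: integZ.
rewrite expectZ// eX mulr0 subr0 /sample_bound.
have c0 : 0 <= c by rewrite divr_ge0// mulr_ge0// sqr_ge0.
have G20 : 0 <= 5 * G ^+ 2 by rewrite mulr_ge0// sqr_ge0.
apply: lerD; last exact: ler_wpM2l.
apply: le_trans (ler_wpM2l c0 (lerD eP eM)) _.
by rewrite /c le_eqVlt; apply/orP; left; apply/eqP; field; rewrite gt_eqF.
Qed.

(** Makes one coordinate of the perturbation an explicit real argument, the form in which Fubini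
    integrates it; by [replace_coord_line] this argument moves the point along a straight line. *)
Definition replace_coord (k : 'I_D) (s : R) (y : profile R dim) : profile R dim :=
  \row_l (if l == k then s else y ord0 l).

Lemma replace_coord_line k s (y v : profile R dim) r :
  y + r *: replace_coord k s v =
  (y + r *: replace_coord k 0 v) + s *: (r *: delta_mx ord0 k).
Proof.
apply/rowP => l; rewrite !mxE eqxx /=.
by case: eqP => _ /=; ring.
Qed.

Lemma replace_coord_id k (y : profile R dim) : replace_coord k (y ord0 k) y = y.
Proof. by apply/rowP => l; rewrite mxE; case: eqP => [->|]. Qed.

Lemma partial_le j y k : `|gradient (f j) y ord0 k| <= G.
Proof.
apply: le_trans (coord_le_norm2 _ _) _.
by apply: gradient_norm_le => //; [exact: cost_lipschitz fP j|have [] := cost_smooth fP j].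
Qed.

Lemma replaced_known (S : set idx) (g : profile R dim -> R) (K r : R) (k : 'I_D) t
    (V : Omega -> profile R dim) :
  lipschitz2 K g -> past t `<=` S ->
  (forall l, l != k -> measurable_fun setT ((fun w => V w ord0 l) : knowing S -> R)) ->
  measurable_fun setT (fun y : R * knowing S =>
    g (X t y.2 + r *: replace_coord k y.1 (V y.2))).
Proof.
move=> gK tS mV; apply: (measurable_lipschitz gK) => l.
have mX : measurable_fun setT (fun y : R * knowing S => X t y.2 ord0 l).
  exact: (measurableT_comp (X_known l tS) measurable_snd).
have [lk|lk] := eqVneq l k.
  rewrite (_ : (fun y => _) = fun y : R * knowing S => X t y.2 ord0 l + r * y.1).
    by apply: measurable_funD => //; exact: measurable_funM.
  by apply/funext => y; rewrite !mxE lk eqxx.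
rewrite (_ : (fun y => _) = fun y : R * knowing S => X t y.2 ord0 l + r * V y.2 ord0 l).
  apply: measurable_funD => //; apply: measurable_funM => //.
  exact: (measurableT_comp (mV l lk) measurable_snd).
by apply/funext => y; rewrite !mxE (negPf lk).
Qed.

(** * Conditional means, tested against bounded weights known before time [t] *)

Section test_weight.
Variables (t : nat) (v : Omega -> R) (c : R).
Hypothesis v_known : measurable_fun setT (v : knowing (past t) -> R).
Hypothesis v_le : forall w, `|v w| <= c.

Let v_sub (S : set idx) : past t `<=` S -> measurable_fun setT (v : knowing S -> R).
Proof. by move=> tS; exact: knowing_sub v_known. Qed.

Let v_measurable : measurable_fun setT v.
Proof. exact: knowing_fun v_known. Qed.

Lemma weighted_partial_integ j k r s :
  integ (fun w => v w * gradient (f j) (X t w + r *: Z s w) ord0 k).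
Proof.
have mg : measurable_fun setT (fun w => gradient (f j) (X t w + r *: Z s w) ord0 k).
  apply: (measurable_lipschitz (smooth_partial_lipschitz k (cost_smooth fP j))) => l.
  rewrite (_ : (fun w => _) = (fun w => X t w ord0 l + r * Z s w ord0 l)).
    apply: measurable_funD; first exact: X_measurable.
    by apply: measurable_funM => //; exact: Z_measurable.
  by apply/funext => w; rewrite !mxE.
apply: (integ_le _ _ (integ_cst P (c * G))); first exact: measurable_funM.
by move=> w; rewrite normrM ler_pM// ?partial_le.
Qed.

Lemma weighted_increment_integ j k r :
  integ (fun w => v w * (Z t w ord0 k * cost_increment j t r w)).
Proof.
have := integZ (c * (`|r| * G)) (integ_norm (square_integ_integ (normZ_coord_moment t k).1)).
apply: integ_le.
  apply: measurable_funM => //; apply: measurable_funM; first exact: Z_measurable.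
  exact: cost_increment_measurable.
move=> w; rewrite !normrM (ger0_norm (norm2_ge0 _)) -!mulrA ler_pM//.
by rewrite mulrC !mulrA ler_wpM2r// (le_trans (cost_increment_le j t r w))//.
Qed.

(** With all other variables frozen, the increment is a function of the coordinate [k] along a line
    of direction [r e_k]; Stein's identity applies to it and the chain rule yields the factor
    [r]. *)
Lemma stein_coord j k r :
  Ex (fun w => v w * (Z t w ord0 k * cost_increment j t r w)) =
  r * Ex (fun w => v w * gradient (f j) (X t w + r *: Z t w) ord0 k).
Proof.
pose a := coord_index t k; pose S := others a.
have Sa : ~ S a by rewrite /S /others /= eqxx.
have tS : past t `<=` S by apply: past_others; rewrite /= ltnn.
have Sz l : l != k -> S (coord_index t l).
  by move=> lk; apply/eqP => /coord_index_inj E; rewrite E eqxx in lk.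
pose Phi (s : R) w := v w * (s * (f j (X t w + r *: replace_coord k s (Z t w)) - f j (X t w))).
pose Psi (s : R) w := v w * (r * gradient (f j) (X t w + r *: replace_coord k s (Z t w)) ord0 k).
have PhiE w : Phi (xi a w) w = v w * (Z t w ord0 k * cost_increment j t r w).
  by rewrite /Phi /cost_increment -ZE replace_coord_id.
have PsiE w : Psi (xi a w) w = r * (v w * gradient (f j) (X t w + r *: Z t w) ord0 k).
  by rewrite /Psi -ZE replace_coord_id mulrCA.
rewrite -expectZ; last exact: weighted_partial_integ.
rewrite -(funext PhiE) -(funext PsiE).
have mv : measurable_fun setT (fun y : R * knowing S => v y.2).
  exact: (measurableT_comp (v_sub tS) measurable_snd).
have mf : measurable_fun setT (fun y : R * knowing S => f j (X t y.2)).
  have mfX : measurable_fun setT ((fun w => f j (X t w)) : knowing S -> R).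
    by apply: (measurable_lipschitz (cost_lipschitz fP j)) => l; exact: X_known.
  exact: (measurableT_comp mfX measurable_snd).
apply: (@indep_Ex_eq _ _ _ _ _ _ (rand_indep rand) S a a Phi Psi) => //.
- apply: measurable_funM => //; apply: measurable_funM => //; apply: measurable_funB => //.
  by apply: (@replaced_known S _ _ r k t (Z t) (cost_lipschitz fP j)) => // l /Sz; exact: Z_known.
- apply: measurable_funM => //; apply: measurable_funM => //.
  apply: (@replaced_known S _ _ r k t (Z t)
    (smooth_partial_lipschitz k (cost_smooth fP j))) => // l /Sz.
  exact: Z_known.
- by rewrite (funext PhiE); exact: weighted_increment_integ.
- by rewrite (funext PsiE); apply: integZ; exact: weighted_partial_integ.
move=> w.
pose y := X t w + r *: replace_coord k 0 (Z t w).
have df := (cost_smooth fP j).1.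
pose g (s : R) := v w * (f j (y + s *: (r *: delta_mx ord0 k)) - f j (X t w)).
pose g' (s : R) := v w * (r * gradient (f j) (y + s *: (r *: delta_mx ord0 k)) ord0 k).
(* Growth of [g] along the line: its size at [s = 0] plus a slope of at most [|r| * G], which also
   bounds [g']. *)
pose K := `|v w| * (`|f j y - f j (X t w)| + `|r| * G).
have dg s : is_derive (s : R) 1 g (g' s).
  have d1 := is_derive_line (df (y + s *: (r *: delta_mx ord0 k))).
  apply: (is_derive_eq (is_deriveZ (v w) (is_deriveB d1 (is_derive_cst (f j (X t w)) s 1)))).
  by rewrite dot_delta subr0.
have cg' : continuous g'.
  move=> s; apply: cvgM; first exact: cvg_cst.
  apply: cvgM; first exact: cvg_cst.
  exact: lipschitz_line_continuous (smooth_partial_lipschitz k (cost_smooth fP j)) s.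
have gK s : `|g s| <= K * (1 + `|s|).
  rewrite /g /K normrM -mulrA ler_wpM2l//.
  have h1 := cost_lipschitz fP j (y + s *: (r *: delta_mx ord0 k)) y.
  rewrite (addrC _ (- y)) addKr !norm2Z norm2_delta mulr1 in h1.
  have h2 := ler_normD (f j (y + s *: (r *: delta_mx ord0 k)) - f j y) (f j y - f j (X t w)).
  rewrite subrKA in h2.
  have := normr_ge0 (f j y - f j (X t w)); have := normr_ge0 s; have := normr_ge0 r.
  by have := mulr_ge0 (normr_ge0 r) G0; nra.
have g'K s : `|g' s| <= K.
  rewrite /g' /K !normrM ler_wpM2l//.
  apply: (@le_trans _ _ (`|r| * G)); last by rewrite lerDr.
  by rewrite ler_wpM2l// partial_le.
have PhiG s : Phi s w = s * g s by rewrite /Phi /g /y -replace_coord_line mulrCA.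
have PsiG s : Psi s w = g' s by rewrite /Psi /g' /y -replace_coord_line.
have cg : continuous g.
  by move=> s; apply: differentiable_continuous; apply/derivable1_diffP; exact: ex_derive.
have mg : measurable_fun setT g by exact: continuous_measurable_fun.
have mg' : measurable_fun setT g' by exact: continuous_measurable_fun.
under eq_integral do rewrite PhiG.
under [RHS]eq_integral do rewrite PsiG.
rewrite !law_coord; [|exact/measurable_EFinP|].
  exact: stein dg cg' gK g'K.
by apply/measurable_EFinP; exact: measurable_funM.
Qed.

Lemma weighted_noiseP0 j k :
  Ex (fun w => v w * (xi (coord_index t k) w * xi (noiseP_index t j) w)) = 0.
Proof.
have [sP mP _] := noiseP_moments t j; have [spz _] := coord_noiseP t k j.
have E : (fun w => v w * (xi (coord_index t k) w * xi (noiseP_index t j) w)) =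
  (fun w => xi (noiseP_index t j) w * (v w * xi (coord_index t k) w)).
  by apply/funext => w; ring.
rewrite E; apply: (@indep_Ex_mean0 _ _ _ _ _ _ (rand_indep rand)
  (others (noiseP_index t j)) (noiseP_index t j)) => //.
- by rewrite /others /= eqxx.
- apply: measurable_funM; last by apply: knowing_xi; apply/eqP; discriminate.
  by apply: v_sub; apply: past_others; rewrite /= ltnn.
- exact: square_integ_integ.
- by rewrite -E; apply: square_integ_integ; exact: (square_integ_bounded _ v_le).
Qed.

Lemma weighted_noiseM0 j k :
  Ex (fun w => v w * (xi (coord_index t k) w * xi (noiseM_index t j) w)) = 0.
Proof.
have [sP mP _] := noiseM_moments t j; have [spz _] := coord_noiseM t k j.
have E : (fun w => v w * (xi (coord_index t k) w * xi (noiseM_index t j) w)) =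
  (fun w => xi (noiseM_index t j) w * (v w * xi (coord_index t k) w)).
  by apply/funext => w; ring.
rewrite E; apply: (@indep_Ex_mean0 _ _ _ _ _ _ (rand_indep rand)
  (others (noiseM_index t j)) (noiseM_index t j)) => //.
- by rewrite /others /= eqxx.
- apply: measurable_funM; last by apply: knowing_xi; apply/eqP; discriminate.
  by apply: v_sub; apply: past_others; rewrite /= ltnn.
- exact: square_integ_integ.
- by rewrite -E; apply: square_integ_integ; exact: (square_integ_bounded _ v_le).
Qed.

(** Stein's identity at the radii [u] and [- u]: the sign of the second increment cancels that of
    its radius, so the difference quotient becomes an average of partial derivatives. The noise
    terms vanish in the mean. *)
Lemma weighted_sample j k : integ (fun w => v w * sample j k t w) /\
  Ex (fun w => v w * sample j k t w) =
  2^-1 * (Ex (fun w => v w * gradient (f j) (X t w + u *: Z t w) ord0 k) +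
          Ex (fun w => v w * gradient (f j) (X t w + (- u) *: Z t w) ord0 k)).
Proof.
have [sP _] := coord_noiseP t k j; have [sM _] := coord_noiseM t k j.
have iP := square_integ_integ (square_integ_bounded v_measurable v_le sP).
have iM := square_integ_integ (square_integ_bounded v_measurable v_le sM).
have i1 := weighted_increment_integ j k u.
have i2 := weighted_increment_integ j k (- u).
have E : (fun w => v w * sample j k t w) = (fun w => (2 * u)^-1 *
    ((v w * (Z t w ord0 k * cost_increment j t u w) -
      v w * (Z t w ord0 k * cost_increment j t (- u) w)) +
     (v w * (xi (coord_index t k) w * xi (noiseP_index t j) w) -
      v w * (xi (coord_index t k) w * xi (noiseM_index t j) w)))).
  by apply/funext => w; rewrite sampleE /cost_slope; field; rewrite gt_eqF.
have i12 := integB i1 i2; have iPM := integB iP iM.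
rewrite E; split; first by apply: integZ; exact: integD.
rewrite expectZ; last exact: integD.
rewrite expectD// !expectB// weighted_noiseP0 weighted_noiseM0 !stein_coord.
by move: (Ex _) (Ex _) => p m; field; rewrite gt_eqF.
Qed.

(** In the application [t] is the stale time and [s] the current one; the first [m] coordinates have
    already been exchanged. *)
Definition hybrid (s : nat) (m : nat) (w : Omega) : profile R dim :=
  \row_l (if (l < m)%N then Z s w ord0 l else Z t w ord0 l).

(* Exchanges the perturbation at time [t] for that at time [s], one coordinate
   at a time. *)
Lemma weighted_partial_swap j k r s : (t <= s)%N ->
  Ex (fun w => v w * gradient (f j) (X t w + r *: Z t w) ord0 k) =
  Ex (fun w => v w * gradient (f j) (X t w + r *: Z s w) ord0 k).
Proof.
rewrite leq_eqVlt => /predU1P[<-//|ts].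
pose E m := Ex (fun w => v w * gradient (f j) (X t w + r *: hybrid s m w) ord0 k).
have h0 w : hybrid s 0 w = Z t w by apply/rowP => l; rewrite [LHS]mxE.
have hD w : hybrid s D w = Z s w by apply/rowP => l; rewrite [LHS]mxE ltn_ord.
suff H : E 0%N = E D.
  by move: H; rewrite /E (funext h0) (funext hD).
apply: stepwise_eq => m mD; pose o := Ordinal mD.
pose a := coord_index t o; pose b := coord_index s o.
(* Both the outgoing and the incoming variable must be absent; the past of [t] still fits because
   both carry times at least [t]. *)
pose S : set idx := [set i | i != a /\ i != b].
have Sa : ~ S a by rewrite /S /= eqxx => -[].
have Sb : ~ S b by rewrite /S /= eqxx => -[].
have tS : past t `<=` S.
  move=> i it; split; apply/eqP => ia; move: it; rewrite /past /= ia /=; lia.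
have Szt l : l != o -> S (coord_index t l).
  move=> lo; split; apply/eqP.
    by move=> /coord_index_inj E1; rewrite E1 eqxx in lo.
  by move=> [] E1 _; move: ts; rewrite E1 ltnn.
have Szs l : l != o -> S (coord_index s l).
  move=> lo; split; apply/eqP.
    by move=> [] E1 _; move: ts; rewrite E1 ltnn.
  by move=> /coord_index_inj E1; rewrite E1 eqxx in lo.
pose Phi (y : R) w := v w *
  gradient (f j) (X t w + r *: replace_coord o y (hybrid s m w)) ord0 k.
have Ea : (fun w => v w * gradient (f j) (X t w + r *: hybrid s m w) ord0 k) =
    (fun w => Phi (xi a w) w).
  apply/funext => w; rewrite /Phi.
  suff -> : replace_coord o (xi a w) (hybrid s m w) = hybrid s m w by [].
  apply/rowP => l; rewrite [LHS]mxE; case: eqP => [->|//].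
  by rewrite [RHS]mxE /= ltnn ZE.
have Eb : (fun w => v w * gradient (f j) (X t w + r *: hybrid s m.+1 w) ord0 k) =
    (fun w => Phi (xi b w) w).
  apply/funext => w; rewrite /Phi.
  suff -> : replace_coord o (xi b w) (hybrid s m w) = hybrid s m.+1 w by [].
  apply/rowP => l; rewrite [LHS]mxE [RHS]mxE; case: eqP => [->|lo].
    by rewrite /= ltnSn ZE.
  have lm : l <> m :> nat by move=> lm; apply: lo; exact: val_inj.
  by rewrite [LHS]mxE (_ : (l < m.+1)%N = (l < m)%N)//; lia.
have mPhi : measurable_fun setT (fun y : R * knowing S => Phi y.1 y.2).
  apply: measurable_funM; first exact: (measurableT_comp (v_sub tS) measurable_snd).
  apply: (@replaced_known S _ _ r o t (hybrid s m)
    (smooth_partial_lipschitz k (cost_smooth fP j))) => // l lo.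
  rewrite (_ : (fun w => _) = fun w => if (l < m)%N then Z s w ord0 l else Z t w ord0 l);
    last by apply/funext => w; rewrite mxE.
  by case: (l < m)%N; [apply: Z_known; exact: Szs|apply: Z_known; exact: Szt].
have iPhi c' : integ (fun w => Phi (xi c' w) w).
  apply: (integ_le _ _ (integ_cst P (c * G))).
    have mc : measurable_fun setT (fun w => (xi c' w, w) : R * knowing S).
      exact: (@measurable_with_xi _ _ _ _ _ xi S c').
    exact: (measurableT_comp mPhi mc).
  by move=> w; rewrite normrM ler_pM// ?partial_le.
rewrite /E Ea Eb.
apply: (@indep_Ex_eq _ _ _ _ _ _ (rand_indep rand) S a b Phi Phi) => // w.
apply: eq_measure_integral => A mA _.
have la : distribution P (xi a) A = normal_prob 0 1 A by exact: (rand_gaussian rand).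
have lb : distribution P (xi b) A = normal_prob 0 1 A by exact: (rand_gaussian rand).
exact: etrans la (esym lb).
Qed.

End test_weight.

Local Notation own k := (tagnat.sig1 k).
Local Notation F := (objective f).

Lemma sample_bound_ge0 : 0 <= sample_bound.
Proof.
have s0 : 0 <= sigma ^+ 2 / u ^+ 2 by rewrite -expr_div_n sqr_ge0.
have g0 : 0 <= 5 * G ^+ 2 by rewrite mulr_ge0 ?sqr_ge0.
rewrite addr_ge0//; first by rewrite mulr_ge0.
by rewrite mulr_ge0// mulr_ge0// gaussian_kurtosis_ge0.
Qed.

Lemma stamped_moment j k (s : int) :
  square_integ (fun w => at_stamp (fun r => sample j k r w) s) /\
  Ex (fun w => at_stamp (fun r => sample j k r w) s ^+ 2) <= sample_bound.
Proof.
case: s => s /=; first exact: sample_moment.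
split; first exact: square_integ_cst.
by rewrite (_ : (fun w => _) = fun=> 0) ?expect_cst ?sample_bound_ge0//;
  apply/funext => w; rewrite expr0n.
Qed.

(** Convexity of the square over [j]: averaging over the agents keeps the bound of a single sample,
    whatever the dependence between the samples. *)
Lemma estimate_coord_moment t k : square_integ (fun w => estimate t w ord0 k) /\
  Ex (fun w => estimate t w ord0 k ^+ 2) <= sample_bound.
Proof.
pose a j w := at_stamp (fun r => sample j k r w) (tau t (own k) j).
have E : (fun w => estimate t w ord0 k) = fun w => n%:R^-1 * \sum_j a j w.
  by apply/funext => w; rewrite mxE.
have sq : square_integ (fun w => estimate t w ord0 k).
  rewrite E; apply: square_integZ; apply: square_integ_sum => j _.
  exact: (stamped_moment _ _ _).1.
split => //.
have ia j : integ (fun w => a j w ^+ 2) by have [[]] := stamped_moment j k (tau t (own k) j).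
have is' : integ (fun w => \sum_j a j w ^+ 2) by exact: integ_sum.
apply: (@le_trans _ _ (Ex (fun w => n%:R^-1 * \sum_j a j w ^+ 2))).
  apply: expect_le; [by have [] := sq|exact: integZ|].
  by move=> w; rewrite mxE; exact: sqr_mean_le.
rewrite expectZ// expect_sum// ler_pdivrMl ?ltr0n//.
rewrite (_ : n%:R * sample_bound = \sum_(j < n) sample_bound);
  last by rewrite sumr_const card_ord mulr_natl.
by apply: ler_sum => j _; exact: (stamped_moment _ _ _).2.
Qed.

Lemma norm_estimate_measurable t : measurable_fun setT (fun w => norm2 (estimate t w)).
Proof.
apply: (measurable_lipschitz lipschitz2_norm2) => k.
by have [[]] := estimate_coord_moment t k.
Qed.

Lemma norm_estimate_moment t : square_integ (fun w => norm2 (estimate t w)) /\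
  Ex (fun w => norm2 (estimate t w) ^+ 2) <= D%:R * sample_bound.
Proof.
have E : (fun w => norm2 (estimate t w) ^+ 2) =
    (fun w => \sum_k estimate t w ord0 k ^+ 2).
  by apply/funext => w; exact: sqr_norm2.
have i k : integ (fun w => estimate t w ord0 k ^+ 2).
  by have [[]] := estimate_coord_moment t k.
rewrite /square_integrable E; split.
  by split; [exact: norm_estimate_measurable|exact: integ_sum].
rewrite expect_sum// (_ : D%:R * sample_bound = \sum_(l < D) sample_bound);
  last by rewrite sumr_const card_ord mulr_natl.
by apply: ler_sum => k _; exact: (estimate_coord_moment t k).2.
Qed.

Lemma drift_le s t w : (s <= t)%N ->
  norm2 (X t w - X s w) <= eta * \sum_(s <= r < t) norm2 (estimate r w).
Proof.
move=> st; rewrite -(subnKC st); elim: (t - s)%N => [|p IH].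
  by rewrite addn0 subrr norm2_0 big_geq// mulr0.
rewrite addnS big_nat_recr ?leq_addr//= mulrDr X_step addrAC.
apply: le_trans (norm2D _ _) _; rewrite norm2N norm2Z (gtr0_norm eta0).
by rewrite lerD2r.
Qed.

Definition block_norm (i j : 'I_n) (s : nat) (w : Omega) : R :=
  Num.sqrt (\sum_(k | own k == i) sample j k s w ^+ 2).

Definition block_size (i : 'I_n) : nat := #|[pred k : 'I_D | own k == i]|.

Lemma block_norm_moment i j s : square_integ (block_norm i j s) /\
  Ex (fun w => block_norm i j s w ^+ 2) <= (block_size i)%:R * sample_bound.
Proof.
have nn w : 0 <= \sum_(k | own k == i) sample j k s w ^+ 2.
  by apply: sumr_ge0 => k _; exact: sqr_ge0.
have E : (fun w => block_norm i j s w ^+ 2) =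
    (fun w => \sum_(k | own k == i) sample j k s w ^+ 2).
  by apply/funext => w; rewrite sqr_sqrtr.
have ik k : integ (fun w => sample j k s w ^+ 2) by have [[]] := sample_moment j k s.
have ik' (k : 'I_D) : own k == i -> integ (fun w => sample j k s w ^+ 2) by move=> _; exact: ik.
rewrite /square_integrable E; split; first split; last 2 first.
- exact: (integ_sum (index_enum _) ik').
- rewrite (expect_sum (index_enum _) ik') 
    (_ : (block_size i)%:R * sample_bound = \sum_(k : 'I_D | own k == i) sample_bound);
    last by rewrite sumr_const mulr_natl.
  by apply: ler_sum => k _; exact: (sample_moment j k s).2.
have msqrt : measurable_fun [set: R] (fun y : R => Num.sqrt y).
  by apply: continuous_measurable_fun; exact: sqrt_continuous.
apply: (measurableT_comp msqrt).
exact: (integ_measurable (integ_sum (index_enum _) ik')).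
Qed.

Lemma block_sizes : \sum_i (block_size i)%:R = D%:R :> R.
Proof.
rewrite -natr_sum; congr (_%:R).
rewrite -[RHS]card_ord -sum1_card (partition_big (fun k : 'I_D => own k) predT)//=.
by apply: eq_bigr => i _; rewrite sum1_card.
Qed.

(** The Gaussian-smoothed gradient is the mean of this over a normal [y]. Leaving [y] explicit lets
    the bias and the Lipschitz bound hold for each outcome. *)
Definition smoothed_gradient (j : 'I_n) (x y : profile R dim) : profile R dim :=
  2^-1 *: (gradient (f j) (x + u *: y) + gradient (f j) (x + (- u) *: y)).

Lemma smoothed_gradientE j x y k : smoothed_gradient j x y ord0 k =
  2^-1 * (gradient (f j) (x + u *: y) ord0 k + gradient (f j) (x + (- u) *: y) ord0 k).
Proof.
rewrite /smoothed_gradient.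
by move: (gradient _ _) (gradient _ _) => a b; rewrite !mxE.
Qed.

Lemma cost_gradient_le j x : norm2 (gradient (f j) x) <= G.
Proof.
by apply: gradient_norm_le => //; [exact: cost_lipschitz fP j|have [] := cost_smooth fP j].
Qed.

Lemma objective_gradient_le x : norm2 (gradient F x) <= G.
Proof.
apply: gradient_norm_le => //; first exact: objective_lipschitz fP n0.
exact: objective_differentiable fP x.
Qed.

Lemma half_sum_norm2 (x y : profile R dim) (c : R) : norm2 x <= c -> norm2 y <= c ->
  norm2 (2^-1 *: (x + y)) <= c.
Proof.
move=> xc yc; rewrite norm2Z ger0_norm ?invr_ge0//.
by have := norm2D x y; lra.
Qed.

Lemma smoothed_gradient_le j x y : norm2 (smoothed_gradient j x y) <= G.
Proof. by apply: half_sum_norm2; exact: cost_gradient_le. Qed.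

(** The common perturbation [y] cancels in the difference, so that moving from a stale iterate to
    the current one costs the drift only. *)
Lemma smoothed_gradient_lipschitz j x x' y :
  norm2 (smoothed_gradient j x y - smoothed_gradient j x' y) <= L * norm2 (x - x').
Proof.
have Lf := (cost_smooth fP j).2.
have shift r : x + r *: y - (x' + r *: y) = x - x'.
  by rewrite opprD addrACA subrr addr0.
rewrite /smoothed_gradient -scalerBr opprD addrACA.
by apply: half_sum_norm2; rewrite -?(shift u) -?(shift (- u)); first exact: Lf;
  rewrite shift -(shift (- u)); exact: Lf.
Qed.

Lemma smoothed_gradient_bias j x y :
  norm2 (smoothed_gradient j x y - gradient (f j) x) <= L * (u * norm2 y).
Proof.
have Lf := (cost_smooth fP j).2.
have -> : smoothed_gradient j x y - gradient (f j) x =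
    2^-1 *: ((gradient (f j) (x + u *: y) - gradient (f j) x) +
             (gradient (f j) (x + (- u) *: y) - gradient (f j) x)).
  have half (a b c : profile R dim) : 2^-1 *: (a + b) - c = 2^-1 *: ((a - c) + (b - c)).
    by apply/rowP => k; rewrite !mxE; field.
  exact: half.
have shift r : `|r| = u -> norm2 (gradient (f j) (x + r *: y) - gradient (f j) x)
    <= L * (u * norm2 y).
  by move=> ru; apply: le_trans (Lf _ _) _; rewrite (addrC x) addrK norm2Z ru.
by apply: half_sum_norm2; apply: shift; rewrite ?normrN gtr0_norm.
Qed.

(** The local gradients average to [g], so only the biases remain; [a b <= a^2 / 8 + 2 b^2] spends
    1/8 of the squared gradient on them. *)
Lemma smoothed_alignment x y :
  n%:R * (7 / 8 * norm2 (gradient F x) ^+ 2 - 2 * L ^+ 2 * u ^+ 2 * norm2 y ^+ 2) <=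
  \sum_j dot (gradient F x) (smoothed_gradient j x y).
Proof.
set g := gradient F x.
have -> : \sum_j dot g (smoothed_gradient j x y) =
    n%:R * norm2 g ^+ 2 + \sum_j dot g (smoothed_gradient j x y - gradient (f j) x).
  have -> : n%:R * norm2 g ^+ 2 = \sum_j dot g (gradient (f j) x).
    rewrite sqr_norm2 /dot exchange_big /= mulr_sumr; apply: eq_bigr => k _.
    rewrite -mulr_sumr expr2 mulrCA; congr (_ * _).
    rewrite /g (objective_gradient fP) mxE mulVKf ?pnatr_eq0 -?lt0n//.
    by rewrite summxE.
  rewrite -big_split; apply: eq_bigr => j _; rewrite /dot -big_split.
  by apply: eq_bigr => k _; rewrite !mxE /=; ring.
have bias j : - (norm2 g ^+ 2 / 8 + 2 * L ^+ 2 * u ^+ 2 * norm2 y ^+ 2) <=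
    dot g (smoothed_gradient j x y - gradient (f j) x).
  apply: le_trans (dot_ge _ _); rewrite lerN2.
  apply: (@le_trans _ _ (norm2 g * (L * (u * norm2 y)))).
    by rewrite ler_wpM2l ?norm2_ge0// smoothed_gradient_bias.
  rewrite -subr_ge0.
  rewrite (_ : _ - _ = (norm2 g - 4 * (L * (u * norm2 y))) ^+ 2 / 8); last by field.
  by rewrite divr_ge0 ?sqr_ge0.
have : n%:R * - (norm2 g ^+ 2 / 8 + 2 * L ^+ 2 * u ^+ 2 * norm2 y ^+ 2) <=
    \sum_j dot g (smoothed_gradient j x y - gradient (f j) x).
  rewrite mulr_natl -[X in _ *+ X]card_ord -sumr_const.
  by apply: ler_sum => j _; exact: bias.
by move: (\sum_j _) (2 * L ^+ 2 * u ^+ 2 * norm2 y ^+ 2) (norm2 g ^+ 2) => S A N; lra.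
Qed.

Lemma objective_integ t : integ (fun w => F (X t w)).
Proof.
have drift : integ (fun w => `|F x0| + G * (eta * \sum_(0 <= r < t) norm2 (estimate r w))).
  apply: integD; first exact: integ_cst.
  apply: integZ; apply: integZ; apply: integ_sum => r _.
  exact: square_integ_integ (norm_estimate_moment r).1.
apply: integ_le drift.
  apply: (measurable_lipschitz (objective_lipschitz fP n0)) => k.
  exact: X_measurable.
move=> w; have := objective_lipschitz fP n0 (X t w) x0; rewrite -(X_init w) => h.
have := ler_wpM2l G0 (drift_le w (leq0n t)).
have := ler_normD (F (X t w) - F (X 0 w)) (F (X 0 w)); rewrite subrK.
by lra.
Qed.

Lemma drift_measurable s t : measurable_fun setT (fun w => norm2 (X t w - X s w)).
Proof.
apply: (measurable_lipschitz lipschitz2_norm2) => k.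
rewrite (_ : (fun w => _) = (fun w => X t w ord0 k - X s w ord0 k)).
  by apply: measurable_funB; exact: X_measurable.
by apply/funext => w; rewrite !mxE.
Qed.

Lemma drift_square_integ s t : (s <= t)%N -> square_integ (fun w => norm2 (X t w - X s w)).
Proof.
move=> st; split; first exact: drift_measurable.
have [_ i] : square_integ (fun w => eta * \sum_(s <= r < t) norm2 (estimate r w)).
  apply: square_integZ; apply: square_integ_sum => r _.
  exact: (norm_estimate_moment r).1.
apply: integ_le i; first by apply: measurable_funX; exact: drift_measurable.
move=> w; rewrite ger0_norm ?sqr_ge0// ler_sqr ?nnegrE ?norm2_ge0 ?drift_le//.
by apply: le_trans (norm2_ge0 _) (drift_le w st).
Qed.

(** The drift may be correlated with [Y], so Cauchy-Schwarz is applied to each summand of the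
    pathwise bound [drift_le]; [Y] will be 1 or a block norm. *)
Lemma weighted_drift (Y : Omega -> R) (c : R) s t : (s <= t)%N -> (0 < D)%N ->
  0 < sample_bound -> square_integ Y -> (forall w, 0 <= Y w) -> 0 <= c ->
  Ex (fun w => Y w ^+ 2) <= c ->
  Ex (fun w => norm2 (X t w - X s w) * Y w) <=
  eta * (t - s)%:R * (Num.sqrt (D%:R * sample_bound) * Num.sqrt c).
Proof.
move=> st D0 sb0 sY Y0 c0 Yc.
have iE r : integ (fun w => norm2 (estimate r w) * Y w).
  by apply: integM => //; exact: (norm_estimate_moment r).1.
have iS : integ (fun w => \sum_(s <= r < t) norm2 (estimate r w) * Y w) by exact: integ_sum.
apply: (@le_trans _ _ (Ex (fun w => eta * \sum_(s <= r < t) norm2 (estimate r w) * Y w))).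
  apply: expect_le.
  - by apply: integM => //; exact: drift_square_integ.
  - exact: integZ.
  - move=> w; rewrite -mulr_suml mulrA ler_wpM2r//; exact: drift_le.
rewrite expectZ// -mulrA ler_pM2l// expect_sum//.
rewrite (_ : (t - s)%:R * _ = \sum_(s <= r < t) (Num.sqrt (D%:R * sample_bound) * Num.sqrt c));
  last by rewrite sumr_const_nat mulr_natl.
apply: ler_sum => r _; have [sE eE] := norm_estimate_moment r.
by apply: expect_cauchy_schwarz => //; rewrite mulr_gt0 ?ltr0n.
Qed.

(** * Expected descent over one step *)

Section one_step.
Variables (t : nat) (sg b : 'I_n -> 'I_n -> nat).
Hypothesis tauE : forall i j, tau t i j = (sg i j)%:Z.
Hypothesis sg_delay : forall i j, (t - sg i j <= b i j)%N.
Hypotheses (D_gt0 : (0 < D)%N) (sb_gt0 : 0 < sample_bound).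

Let sg_le i j : (sg i j <= t)%N.
Proof. by have := tau_le t i j; rewrite tauE lez_nat. Qed.

Let drift i j w := norm2 (X t w - X (sg i j) w).

(** The error of weighting the sample by the gradient at the stale iterate, which is known before
    the sample is drawn, instead of the gradient at [X t]. *)
Let stale k j w :=
  (gradient F (X t w) ord0 k - gradient F (X (sg (own k) j) w) ord0 k) *
  sample j k (sg (own k) j) w.

(** What the stale-weighted sample becomes in the mean: the iterate is stale, but the perturbation
    is that of the current time [t]. *)
Let fresh k j w :=
  gradient F (X (sg (own k) j) w) ord0 k *
  smoothed_gradient j (X (sg (own k) j) w) (Z t w) ord0 k.

Let objective_partial_known s k :
  measurable_fun setT ((fun w => gradient F (X s w) ord0 k) : knowing (past s) -> R).
Proof.
apply: (measurable_lipschitz (smooth_partial_lipschitz k (objective_smooth fP n0))) => l.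
exact: X_known.
Qed.

Let objective_partial_le x k : `|gradient F x ord0 k| <= G.
Proof. exact: le_trans (coord_le_norm2 _ _) (objective_gradient_le x). Qed.

(** [weighted_sample] with the stale partial derivative as weight, then [weighted_partial_swap] at
    the radii [u] and [- u]. *)
Let fresh_mean k j :
  [/\ integ (fun w => gradient F (X (sg (own k) j) w) ord0 k * sample j k (sg (own k) j) w),
      integ (fresh k j) &
  Ex (fun w => gradient F (X (sg (own k) j) w) ord0 k * sample j k (sg (own k) j) w) =
  Ex (fresh k j)].
Proof.
set s := sg (own k) j; pose v w : R := gradient F (X s w) ord0 k.
have vk := @objective_partial_known s k.
have vl w : `|v w| <= G by exact: objective_partial_le.
have [i1 e1] := weighted_sample vk vl j k.
have i2 := weighted_partial_integ vk vl j k u t.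
have i3 := weighted_partial_integ vk vl j k (- u) t.
have E : fresh k j = (fun w => 2^-1 *
    (v w * gradient (f j) (X s w + u *: Z t w) ord0 k +
     v w * gradient (f j) (X s w + (- u) *: Z t w) ord0 k)).
  by apply/funext => w; rewrite /fresh -/s smoothed_gradientE mulrCA mulrDr.
have e2 := weighted_partial_swap vk vl j k u (sg_le (own k) j).
have e3 := weighted_partial_swap vk vl j k (- u) (sg_le (own k) j).
have i23 := integD i2 i3.
split; first exact: i1.
  by rewrite E; exact: integZ i23.
refine (etrans e1 (etrans (congr2 (fun p q => 2^-1 * (p + q)) e2 e3) _)).
refine (etrans _ (congr1 (expect P) (esym E))).
exact (esym (etrans (expectZ _ i23) (congr1 (fun p => 2^-1 * p) (expectD i2 i3)))).
Qed.

Let stale_integ k j : integ (stale k j).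
Proof.
apply: square_integ_integ; apply: (@square_integ_bounded _ _ _ _ (G + G)).
- apply: measurable_funB; exact: knowing_fun (@objective_partial_known _ k).
- move=> w; apply: le_trans (ler_normB _ _) _.
  by apply: lerD; exact: objective_partial_le.
- exact: (sample_moment _ _ _).1.
Qed.

(** The stale time depends on [k] only through its owner, so after this regrouping all coordinates
    of an inner sum refer to the same iterate. *)
Let sum_blocks (g : 'I_D -> 'I_n -> R) :
  \sum_k \sum_j g k j = \sum_i \sum_j \sum_(k | own k == i) g k j.
Proof.
rewrite (partition_big (fun k : 'I_D => own k) predT)//=.
by apply: eq_bigr => i _; rewrite exchange_big.
Qed.

Let stale_ge w : - (\sum_i \sum_j L * (drift i j w * block_norm i j (sg i j) w)) <=
  \sum_k \sum_j stale k j w.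
Proof.
rewrite sum_blocks -sumrN; apply: ler_sum => i _; rewrite -sumrN; apply: ler_sum => j _.
rewrite (eq_bigr (fun k => (gradient F (X t w) - gradient F (X (sg i j) w)) ord0 k *
    sample j k (sg i j) w)); last first.
  by move=> k /eqP ki; rewrite /stale ki coordB.
apply: le_trans (block_sum_ge _ _ _); rewrite lerN2 mulrA.
by rewrite ler_wpM2r ?sqrtr_ge0//; exact: (objective_smooth fP n0).2.
Qed.

(** Moving either factor from the stale iterate to [X t] costs at most [G * L] times the drift, for
    each pair of agents; then [smoothed_alignment] applies. *)
Let fresh_ge w :
  n%:R * (7 / 8 * norm2 (gradient F (X t w)) ^+ 2
          - 2 * L ^+ 2 * u ^+ 2 * norm2 (Z t w) ^+ 2)
  - \sum_i \sum_j 2 * G * L * drift i j w <= \sum_k \sum_j fresh k j w.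
Proof.
apply: (@le_trans _ _ (\sum_j dot (gradient F (X t w)) (smoothed_gradient j (X t w) (Z t w))
   - \sum_i \sum_j 2 * G * L * drift i j w)).
  by rewrite lerD2r smoothed_alignment.
rewrite /dot exchange_big /= !sum_blocks -sumrB; apply: ler_sum => i _.
rewrite -sumrB; apply: ler_sum => j _; rewrite lerBlDl -lerBlDr -sumrB.
rewrite (eq_bigr (fun k =>
   (gradient F (X t w) - gradient F (X (sg i j) w)) ord0 k * smoothed_gradient j (X t w) (Z t w) ord0 k
   + gradient F (X (sg i j) w) ord0 k *
     (smoothed_gradient j (X t w) (Z t w) - smoothed_gradient j (X (sg i j) w) (Z t w)) ord0 k));
  last first.
  by move=> k /eqP ki; rewrite /fresh ki !coordB; ring.
rewrite big_split /=.
apply: le_trans (lerD (block_dot_le _ _ _) (block_dot_le _ _ _)) _.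
have h1 : norm2 (gradient F (X t w) - gradient F (X (sg i j) w)) *
    norm2 (smoothed_gradient j (X t w) (Z t w)) <= L * drift i j w * G.
  apply: ler_pM; rewrite ?norm2_ge0 ?smoothed_gradient_le//.
  exact: (objective_smooth fP n0).2.
have h2 : norm2 (gradient F (X (sg i j) w)) *
    norm2 (smoothed_gradient j (X t w) (Z t w) - smoothed_gradient j (X (sg i j) w) (Z t w))
    <= G * (L * drift i j w).
  apply: ler_pM; rewrite ?norm2_ge0 ?objective_gradient_le//.
  exact: smoothed_gradient_lipschitz.
apply: le_trans (lerD h1 h2) _.
by rewrite le_eqVlt; apply/orP; left; apply/eqP; ring.
Qed.

Let drift_integ i j : square_integ (drift i j).
Proof. exact: drift_square_integ. Qed.

Lemma gradient_norm_integ s : integ (fun w => norm2 (gradient F (X s w)) ^+ 2).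
Proof.
apply: (integ_le _ _ (integ_cst P (G ^+ 2))).
  apply: measurable_funX; apply: (measurable_lipschitz lipschitz2_norm2) => k.
  exact: knowing_fun (@objective_partial_known s k).
move=> w; rewrite ger0_norm ?sqr_ge0// ler_sqr ?nnegrE ?norm2_ge0//.
exact: objective_gradient_le.
Qed.

Lemma drift_mean_le i j :
  Ex (drift i j) <= eta * (b i j)%:R * Num.sqrt (D%:R * sample_bound).
Proof.
have := @weighted_drift (fun=> 1) 1 (sg i j) t (sg_le i j) D_gt0 sb_gt0
  (square_integ_cst P 1) (fun=> ler01) ler01.
rewrite (_ : (fun w => 1 ^+ 2) = fun=> 1) ?expect_cst; last by apply/funext => w; rewrite expr1n.
move=> /(_ (lexx 1)); rewrite sqrtr1 mulr1.
rewrite (_ : (fun w => norm2 (X t w - X (sg i j) w) * 1) = drift i j);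
  last by apply/funext => w; rewrite mulr1.
move=> /le_trans; apply; rewrite ler_wpM2r ?sqrtr_ge0// ler_wpM2l ?(ltW eta0)//.
by rewrite ler_nat.
Qed.

Lemma drift_block_mean_le i j :
  Ex (fun w => drift i j w * block_norm i j (sg i j) w) <=
  eta * (b i j)%:R *
    (Num.sqrt (D%:R * sample_bound) * Num.sqrt ((block_size i)%:R * sample_bound)).
Proof.
have [sq e] := block_norm_moment i j (sg i j).
have := weighted_drift (sg_le i j) D_gt0 sb_gt0 sq (fun w => sqrtr_ge0 _) _ e.
move=> /(_ (mulr_ge0 (ler0n _ _) (ltW sb_gt0))) /le_trans; apply.
rewrite ler_wpM2r ?mulr_ge0 ?sqrtr_ge0// ler_wpM2l ?(ltW eta0)//.
by rewrite ler_nat.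
Qed.

(** The first term bounds the mean of the [stale] errors and is linear in [sample_bound]; the second
    pays for moving [fresh] and grows only like its square root, which makes it of higher order in
    [eps]. *)
Definition delay_error : R := n%:R^-1 * \sum_i \sum_j
  (L * (eta * (b i j)%:R *
     (Num.sqrt (D%:R * sample_bound) * Num.sqrt ((block_size i)%:R * sample_bound))) +
   2 * G * L * (eta * (b i j)%:R * Num.sqrt (D%:R * sample_bound))).

Lemma estimate_dotE w : n%:R * dot (gradient F (X t w)) (estimate t w) =
  \sum_k \sum_j gradient F (X t w) ord0 k * sample j k (sg (own k) j) w.
Proof.
rewrite /dot mulr_sumr; apply: eq_bigr => k _.
rewrite [estimate t w ord0 k]mxE mulrCA mulVKf ?pnatr_eq0 -?lt0n// mulr_sumr.
by apply: eq_bigr => j _; rewrite tauE.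
Qed.

(** The inner product splits into the [stale] errors and the stale-weighted samples [A]; the latter
    have the mean of [fresh], and the pathwise bounds [stale_ge] and [fresh_ge] are then
    integrated. *)
Lemma expected_alignment :
  integ (fun w => dot (gradient F (X t w)) (estimate t w)) /\
  7 / 8 * Ex (fun w => norm2 (gradient F (X t w)) ^+ 2) <=
  Ex (fun w => dot (gradient F (X t w)) (estimate t w)) +
    2 * L ^+ 2 * u ^+ 2 * D%:R + delay_error.
Proof.
have n_neq0 : n%:R != 0 :> R by rewrite pnatr_eq0 -lt0n.
pose A k j w := gradient F (X (sg (own k) j) w) ord0 k * sample j k (sg (own k) j) w.
have iA k j : integ (A k j) by have [] := fresh_mean k j.
have iF k j : integ (fresh k j) by have [] := fresh_mean k j.
have eA k j : Ex (A k j) = Ex (fresh k j) by have [] := fresh_mean k j.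
have iSA : integ (fun w => \sum_k \sum_j A k j w).
  by apply: integ_sum => k _; apply: integ_sum => j _.
have iSF : integ (fun w => \sum_k \sum_j fresh k j w).
  by apply: integ_sum => k _; apply: integ_sum => j _.
have iSS : integ (fun w => \sum_k \sum_j stale k j w).
  by apply: integ_sum => k _; apply: integ_sum => j _; exact: stale_integ.
have dotE : (fun w => dot (gradient F (X t w)) (estimate t w)) =
    (fun w => n%:R^-1 * (\sum_k \sum_j stale k j w + \sum_k \sum_j A k j w)).
  apply/funext => w; apply: (mulfI n_neq0); rewrite mulVKf// estimate_dotE.
  rewrite -big_split; apply: eq_bigr => k _ /=; rewrite -big_split.
  by apply: eq_bigr => j _; rewrite /stale /A /=; ring.
have iV := integD iSS iSA.
rewrite dotE; split; first exact: integZ.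
rewrite (expectZ _ iV) (expectD iSS iSA).
have eSA : Ex (fun w => \sum_k \sum_j A k j w) = Ex (fun w => \sum_k \sum_j fresh k j w).
  rewrite (@expect_sum _ _ _ P _ _ _ (fun k w => \sum_j A k j w)); last first.
    by move=> k _; apply: integ_sum.
  rewrite (@expect_sum _ _ _ P _ _ _ (fun k w => \sum_j fresh k j w)); last first.
    by move=> k _; apply: integ_sum.
  by apply: eq_bigr => k _; rewrite !expect_sum//; apply: eq_bigr => j _; exact: eA.
rewrite eSA.
have iN := gradient_norm_integ t.
have [[_ iZ] eZ] := normZ_moment t.
have iD i j : integ (drift i j) by exact: square_integ_integ.
have iDB i j : integ (fun w => drift i j w * block_norm i j (sg i j) w).
  by apply: integM => //; exact: (block_norm_moment _ _ _).1.
have iSD : integ (fun w => \sum_i \sum_j 2 * G * L * drift i j w).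
  by apply: integ_sum => i _; apply: integ_sum => j _; exact: integZ.
have iSB : integ (fun w => \sum_i \sum_j L * (drift i j w * block_norm i j (sg i j) w)).
  by apply: integ_sum => i _; apply: integ_sum => j _; exact: integZ.
have iNZ : integ (fun w => 7 / 8 * norm2 (gradient F (X t w)) ^+ 2
    - 2 * L ^+ 2 * u ^+ 2 * norm2 (Z t w) ^+ 2).
  by apply: integB; exact: integZ.
have h1 : - Ex (fun w => \sum_i \sum_j L * (drift i j w * block_norm i j (sg i j) w)) <=
    Ex (fun w => \sum_k \sum_j stale k j w).
  rewrite -[leLHS]mulN1r -(expectZ _ iSB); apply: expect_le => //; first exact: integZ.
  by move=> w; rewrite mulN1r; exact: stale_ge.
have h2 : n%:R * (7 / 8 * Ex (fun w => norm2 (gradient F (X t w)) ^+ 2)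
      - 2 * L ^+ 2 * u ^+ 2 * D%:R)
    - Ex (fun w => \sum_i \sum_j 2 * G * L * drift i j w) <=
    Ex (fun w => \sum_k \sum_j fresh k j w).
  rewrite -eZ -(expectZ _ iN) -(expectZ _ iZ) -expectB; [|exact: integZ|exact: integZ].
  rewrite -(expectZ _ iNZ) -expectB//; last exact: integZ.
  by apply: expect_le => //; apply: integB => //; exact: integZ.
have h3 : Ex (fun w => \sum_i \sum_j L * (drift i j w * block_norm i j (sg i j) w)) +
    Ex (fun w => \sum_i \sum_j 2 * G * L * drift i j w) <= n%:R * delay_error.
  rewrite /delay_error mulVKf//.
  rewrite expect_sum; last by move=> i _; apply: integ_sum => j _; exact: integZ.
  rewrite expect_sum; last by move=> i _; apply: integ_sum => j _; exact: integZ.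
  rewrite -big_split; apply: ler_sum => i _ /=.
  rewrite expect_sum; last by move=> j _; exact: integZ.
  rewrite expect_sum; last by move=> j _; exact: integZ.
  rewrite -big_split; apply: ler_sum => j _ /=; rewrite !expectZ//; apply: lerD.
    by rewrite ler_wpM2l ?(ltW L0)//; exact: drift_block_mean_le.
  rewrite ler_wpM2l//; last exact: drift_mean_le.
  by rewrite mulr_ge0 ?(ltW L0)// mulr_ge0.
rewrite -lerBlDr -lerBlDr ler_pdivlMl ?ltr0n//.
apply: le_trans (lerD h1 h2).
by move: h3; move: (Ex _) (Ex _) (Ex _) => a c e; lra.
Qed.

(** The descent lemma along [- eta *: estimate], integrated and divided by [eta]. *)
Lemma expected_descent :
  7 / 8 * Ex (fun w => norm2 (gradient F (X t w)) ^+ 2) <=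
  (Ex (fun w => F (X t w)) - Ex (fun w => F (X t.+1 w))) / eta +
  (L / 2 * eta * (D%:R * sample_bound) + 2 * L ^+ 2 * u ^+ 2 * D%:R + delay_error).
Proof.
have [idot al] := expected_alignment.
have [[_ iE] eE] := norm_estimate_moment t.
have iF := objective_integ t.
have h : Ex (fun w => F (X t.+1 w)) <= Ex (fun w => F (X t w))
    - eta * Ex (fun w => dot (gradient F (X t w)) (estimate t w))
    + L / 2 * eta ^+ 2 * Ex (fun w => norm2 (estimate t w) ^+ 2).
  rewrite -(expectZ _ idot) -(expectZ _ iE) -expectB//; last exact: integZ.
  have i1 := integB iF (integZ eta idot).
  rewrite -expectD//; last exact: integZ.
  apply: expect_le; [exact: objective_integ|by apply: integD => //; exact: integZ|].
  move=> w; rewrite X_step -scaleNr.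
  apply: le_trans (smooth_descent _ _ (objective_smooth fP n0)) _.
  by rewrite norm2Z normrN (gtr0_norm eta0) exprMn mulrA dotZr mulNr.
have pb : Ex (fun w => dot (gradient F (X t w)) (estimate t w)) <=
    (Ex (fun w => F (X t w)) - Ex (fun w => F (X t.+1 w))) / eta +
    L / 2 * eta * (D%:R * sample_bound).
  rewrite -(ler_pM2l eta0).
  have L2 : 0 <= L / 2 * eta ^+ 2 by rewrite mulr_ge0 ?sqr_ge0// divr_ge0// ltW.
  have := ler_wpM2l L2 eE; move: h; move: (Ex _) (Ex _) (Ex _) (Ex _) => a a' p e h h2.
  rewrite mulrDr mulrCA divff ?gt_eqF// mulr1.
  have -> : eta * (L / 2 * eta * (D%:R * sample_bound)) =
    L / 2 * eta ^+ 2 * (D%:R * sample_bound) by ring.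
  by lra.
by lra.
Qed.

End one_step.

Lemma objective_initial_le t : (0 < D)%N -> 0 < sample_bound ->
  Ex (fun w => F (X t w)) <= F x0 + G * (eta * t%:R * Num.sqrt (D%:R * sample_bound)).
Proof.
move=> D_gt0 sb_gt0.
have := @weighted_drift (fun=> 1) 1 0 t (leq0n t) D_gt0 sb_gt0
  (square_integ_cst P 1) (fun=> ler01) ler01.
rewrite (_ : (fun w => 1 ^+ 2) = fun=> 1) ?expect_cst; last by apply/funext => w; rewrite expr1n.
move=> /(_ (lexx 1)); rewrite sqrtr1 mulr1 subn0.
rewrite (_ : (fun w => norm2 (X t w - X 0 w) * 1) = fun w => norm2 (X t w - X 0 w));
  last by apply/funext => w; rewrite mulr1.
have iD := square_integ_integ (drift_square_integ (leq0n t)).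
move=> /(ler_wpM2l G0) h; rewrite -lerBlDl; apply: le_trans h.
rewrite -(expectZ _ iD) -[X in _ - X](expect_cst P) -expectB; last 2 first.
- exact: objective_integ.
- exact: integ_cst.
apply: expect_le; [by apply: integB; [exact: objective_integ|exact: integ_cst]|exact: integZ|].
move=> w; rewrite X_init; apply: le_trans (ler_norm _) _.
exact: (objective_lipschitz fP n0).
Qed.

Lemma infimum_le x : infimum F <= F x.
Proof. by apply: ge_inf; [exact: (objective_bounded fP)|exists x]. Qed.

Lemma infimum_le_Ex t : infimum F <= Ex (fun w => F (X t w)).
Proof.
rewrite -[leLHS](expect_cst P); apply: expect_le; [exact: integ_cst|exact: objective_integ|].
by move=> w; exact: infimum_le.
Qed.

Lemma descent_sum (B T : nat) (b : 'I_n -> 'I_n -> nat) :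
  (0 < D)%N -> 0 < sample_bound -> (B <= T)%N ->
  (forall t i j, (B <= t)%N -> exists2 s : nat, tau t i j = s%:Z & (t - s <= b i j)%N) ->
  7 / 8 * \sum_(B <= t < T.+1) Ex (fun w => norm2 (gradient F (X t w)) ^+ 2) <=
  (F x0 - infimum F + G * (eta * B%:R * Num.sqrt (D%:R * sample_bound))) / eta +
  (T - B + 1)%:R *
    (L / 2 * eta * (D%:R * sample_bound) + 2 * L ^+ 2 * u ^+ 2 * D%:R + delay_error b).
Proof.
move=> D_gt0 sb_gt0 BT delay; set c := (L / 2 * eta * _ + _ + _).
pose a t := Ex (fun w => F (X t w)).
have step t : (B <= t)%N -> 7 / 8 * Ex (fun w => norm2 (gradient F (X t w)) ^+ 2) <=
    (a t - a t.+1) / eta + c.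
  (* Stamps are nonnegative from [B] on, so the absolute value only changes their type. *)
  move=> Bt; apply: (@expected_descent t (fun i j => `|tau t i j|%N) b) => // i j.
    by have [s -> _] := delay t i j Bt.
  by have [s -> ts] := delay t i j Bt.
apply: (@le_trans _ _ (\sum_(B <= t < T.+1) ((a t - a t.+1) / eta + c))).
  rewrite mulr_sumr big_nat_cond [leRHS]big_nat_cond.
  by apply: ler_sum => t /andP[/andP[Bt _] _]; exact: step.
have cE : \sum_(B <= t < T.+1) c = (T - B + 1)%:R * c.
  by rewrite sumr_const_nat mulr_natl subSn// addn1.
rewrite big_split /= cE lerD2r -mulr_suml.
rewrite ler_pM2r ?invr_gt0//.
have -> : \sum_(B <= t < T.+1) (a t - a t.+1) = a B - a T.+1.
  rewrite -[RHS]opprB -telescope_sumr ?leqW// -sumrN.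
  by apply: eq_bigr => t _; rewrite opprB.
have := objective_initial_le B D_gt0 sb_gt0; have := infimum_le_Ex T.+1.
by rewrite -/(a B) -/(a T.+1); lra.
Qed.

(** Cauchy-Schwarz over the pairs [(i, j)], between the delays and the square roots of the block
    sizes: the block sizes sum to [n * D] over the pairs, and with [1 / n] in front the average
    delay times [sqrt n] appears. The higher-order term is bounded crudely by the maximal delay. *)
Lemma delay_error_le (b : 'I_n -> 'I_n -> nat) (Bm : nat) :
  (forall i j, (b i j <= Bm)%N) ->
  delay_error b <=
  L * eta * sample_bound * D%:R *
    (Num.sqrt ((\sum_i \sum_j (b i j)%:R ^+ 2) / n%:R ^+ 2) * Num.sqrt n%:R)
  + 2 * G * L * (n%:R * Bm%:R) * (eta * Num.sqrt (D%:R * sample_bound)).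
Proof.
move=> bB; have n_gt0 : 0 < n%:R :> R by rewrite ltr0n.
have sb0 := sample_bound_ge0.
rewrite /delay_error ler_pdivrMl// [leRHS]mulrDr.
have S0 : 0 <= \sum_i \sum_j (b i j)%:R ^+ 2 :> R.
  by apply: sumr_ge0 => i _; apply: sumr_ge0 => j _; exact: sqr_ge0.
have bbarE : Num.sqrt ((\sum_i \sum_j (b i j)%:R ^+ 2) / n%:R ^+ 2) =
    Num.sqrt (\sum_i \sum_j (b i j)%:R ^+ 2) / n%:R :> R.
  by rewrite sqrtrM// sqrtrV ?sqr_ge0// sqrtr_sqr ger0_norm.
have cs : \sum_i \sum_j (b i j)%:R * Num.sqrt (block_size i)%:R <=
    Num.sqrt (\sum_i \sum_j (b i j)%:R ^+ 2) * (Num.sqrt n%:R * Num.sqrt D%:R) :> R.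
  rewrite !pair_bigA /=; apply: le_trans (cauchy_schwarz_sum _ _ _) _.
  rewrite -[Num.sqrt n%:R * Num.sqrt D%:R]sqrtrM// ler_wpM2l ?sqrtr_ge0// ler_wsqrtr//.
  rewrite -(pair_bigA _ (fun i _ : 'I_n => Num.sqrt (block_size i)%:R ^+ 2)) /=.
  rewrite -block_sizes mulr_sumr; apply: ler_sum => i _.
  by rewrite sumr_const card_ord sqr_sqrtr// mulr_natl.
have sumb : \sum_i \sum_j (b i j)%:R <= n%:R * (n%:R * Bm%:R) :> R.
  have cst (c : R) : n%:R * c = \sum_(i < n) c by rewrite sumr_const card_ord mulr_natl.
  rewrite !cst; apply: ler_sum => i _; apply: ler_sum => j _.
  by rewrite ler_nat.
rewrite (_ : \sum_i _ = L * eta * (Num.sqrt sample_bound ^+ 2 * Num.sqrt D%:R) *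
    (\sum_i \sum_j (b i j)%:R * Num.sqrt (block_size i)%:R) +
  2 * G * L * (eta * (Num.sqrt D%:R * Num.sqrt sample_bound)) *
    \sum_i \sum_j (b i j)%:R); last first.
  rewrite !mulr_sumr -big_split; apply: eq_bigr => i _ /=.
  rewrite !mulr_sumr -big_split; apply: eq_bigr => j _ /=.
  by rewrite !sqrtrM//; ring.
have c1 : 0 <= L * eta * (Num.sqrt sample_bound ^+ 2 * Num.sqrt D%:R).
  by rewrite !mulr_ge0 ?sqr_ge0 ?sqrtr_ge0 ?(ltW L0) ?(ltW eta0).
have c2 : 0 <= 2 * G * L * (eta * (Num.sqrt D%:R * Num.sqrt sample_bound)).
  by rewrite !mulr_ge0 ?sqrtr_ge0 ?(ltW L0) ?(ltW eta0).
apply: lerD.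
  apply: le_trans (ler_wpM2l c1 cs) _; rewrite bbarE.
  rewrite le_eqVlt; apply/orP; left; apply/eqP.
  rewrite (sqr_sqrtr sb0) -[X in L * eta * sample_bound * X](sqr_sqrtr (ler0n R D)).
  by field; rewrite gt_eqF.
apply: le_trans (ler_wpM2l c2 sumb) _; rewrite sqrtrM//.
by rewrite le_eqVlt; apply/orP; left; apply/eqP; ring.
Qed.

End algorithm.

(** * Arithmetic of the rate *)

Section rate.
Context {R : realType}.
Variables (L sigma u eta eps q Dr K : R).
Hypotheses (L0 : 0 < L) (s0 : 0 < sigma) (u0 : 0 < u) (eta0 : 0 < eta) (eps0 : 0 < eps)
  (q1 : 1 <= q) (D1 : 1 <= Dr) (K0 : 0 <= K).
Hypothesis hu : 16 * L ^+ 2 * Dr * u ^+ 2 <= eps.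
Hypothesis heta : 2 * L * q * Dr * sigma ^+ 2 * eta <= eps * u ^+ 2.
Hypothesis hK : 100 * K * eps <= 16 * L ^+ 2 * sigma ^+ 2 * Dr.

(** [q] stands for the average delay times [sqrt n], [Dr] for the dimension, [K] for the cost part
    of the second moment; [m] is then [sample_bound], and [M] the leading part of the delay
    error. *)
Let m := 5 / 8 * (sigma ^+ 2 / u ^+ 2) + K.
Let M := L * eta * m * Dr * q.

Let Lne : 0 < L ^+ 2. Proof. by rewrite exprn_gt0. Qed.
Let sne : 0 < sigma ^+ 2. Proof. by rewrite exprn_gt0. Qed.
Let une : 0 < u ^+ 2. Proof. by rewrite exprn_gt0. Qed.
Let Dr0 : 0 < Dr. Proof. exact: lt_le_trans D1. Qed.
Let q0 : 0 < q. Proof. exact: lt_le_trans q1. Qed.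

(** Multiplying by [2 * sigma ^+ 2] brings in the bound on [eta] and leaves [eps * u ^+ 2 * m]. By
    [hu] and [hK], [K * u ^+ 2 <= sigma ^+ 2 / 100], and [(5/8 + 1/100) / 2 = 127/400]. *)
Lemma variance_share : M <= eps * (127 / 400).
Proof.
have Ku : 100 * K * u ^+ 2 <= sigma ^+ 2.
  have c : 0 < 16 * L ^+ 2 * Dr by rewrite !mulr_gt0.
  rewrite -(ler_pM2l c); apply: le_trans (_ : 100 * K * eps <= _).
    have := ler_wpM2l (mulr_ge0 (ler0n R 100) K0) hu; lra.
  by move: hK; lra.
have um : u ^+ 2 * m = 5 / 8 * sigma ^+ 2 + K * u ^+ 2.
  by rewrite /m; field; rewrite gt_eqF.
have m0 : 0 <= m by rewrite /m addr_ge0// mulr_ge0// divr_ge0// ltW.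
have h := ler_wpM2r m0 heta.
rewrite -(ler_pM2l (_ : 0 < 2 * sigma ^+ 2)); last by rewrite mulr_gt0.
have -> : 2 * sigma ^+ 2 * M = 2 * L * q * Dr * sigma ^+ 2 * eta * m by rewrite /M; ring.
apply: le_trans h _; rewrite -mulrA um.
rewrite (_ : _ * (eps * _) = eps * (2 * sigma ^+ 2 * (127 / 400))); last by ring.
by rewrite ler_pM2l//; lra.
Qed.

(** This is half of [M] without the factor [q], which is at least 1. *)
Lemma quadratic_share : L / 2 * eta * (Dr * m) <= eps * (127 / 800).
Proof.
have m0 : 0 <= m by rewrite /m addr_ge0// mulr_ge0// divr_ge0// ltW.
have : L * eta * (Dr * m) <= M.
  rewrite /M (_ : L * eta * m * Dr * q = L * eta * (Dr * m) * q); last by ring.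
  by rewrite ler_peMr// !mulr_ge0// ltW.
by have := variance_share; lra.
Qed.

(** The square of [eta * sqrt (Dr * m)] is [eta] times [eta * Dr * m], where
    [L * eta * Dr * m <= eps] by [quadratic_share] and [32 * L ^+ 3 * sigma ^+ 2 * eta <= eps ^+ 2]
    by the bounds on [eta] and [u]. Hence it is of order [eps ^+ 3], and a small [eps] absorbs any
    fixed factor [c]. *)
Lemma drift_scale (c : R) : 0 <= c -> 10 ^+ 4 * c ^+ 2 * eps <= 32 * L ^+ 4 * sigma ^+ 2 ->
  c * (eta * Num.sqrt (Dr * m)) <= eps / 100.
Proof.
move=> c0 hc.
have m0 : 0 <= m by rewrite /m addr_ge0// mulr_ge0// divr_ge0// ltW.
have Dm0 : 0 <= Dr * m by rewrite mulr_ge0// ltW.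
rewrite -ler_sqr ?nnegrE ?mulr_ge0 ?sqrtr_ge0 ?(ltW eta0) ?(ltW eps0)//.
rewrite !exprMn sqr_sqrtr//.
have h1 : eta * (Dr * m) * L <= eps.
  by have := quadratic_share; move: eps0; lra.
have h2 : 32 * L ^+ 3 * sigma ^+ 2 * eta <= eps ^+ 2.
  have c1 : 0 < 2 * L * q * Dr * sigma ^+ 2 by rewrite !mulr_gt0.
  have e1 : 2 * L * sigma ^+ 2 * eta <= 2 * L * q * Dr * sigma ^+ 2 * eta.
    rewrite (_ : 2 * L * q * Dr * sigma ^+ 2 * eta = (2 * L * sigma ^+ 2 * eta) * (q * Dr)); last by ring.
    by rewrite ler_peMr ?mulr_ege1// ?mulr_ge0// ltW.
  have e2 : 16 * L ^+ 2 * u ^+ 2 <= eps.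
    apply: le_trans hu; rewrite (_ : _ * Dr * _ = (16 * L ^+ 2 * u ^+ 2) * Dr); last by ring.
    by rewrite ler_peMr// !mulr_ge0// ltW.
  have e3 := le_trans e1 heta.
  have l16 : 0 <= 16 * L ^+ 2 by rewrite mulr_ge0// ltW.
  have := ler_wpM2l l16 e3; have := ler_wpM2l (ltW eps0) e2.
  rewrite (_ : 16 * L ^+ 2 * (2 * L * sigma ^+ 2 * eta) = 32 * L ^+ 3 * sigma ^+ 2 * eta); last by ring.
  by rewrite expr2; lra.
have L3 : 0 < 32 * L ^+ 4 * sigma ^+ 2 by rewrite !mulr_gt0// exprn_gt0.
rewrite -(ler_pM2l L3).
have h3 : (32 * L ^+ 3 * sigma ^+ 2 * eta) * (eta * (Dr * m) * L) <= eps ^+ 2 * eps.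
  apply: ler_pM => //; rewrite !mulr_ge0 ?exprn_ge0 ?(ltW L0) ?(ltW s0) ?(ltW eta0) ?(ltW Dr0)//.
have c20 : 0 <= c ^+ 2 by exact: sqr_ge0.
have h4 := ler_wpM2l c20 h3.
have h5 := ler_wpM2r (sqr_ge0 eps) hc.
rewrite (_ : 32 * L ^+ 4 * sigma ^+ 2 * (c ^+ 2 * (eta ^+ 2 * (Dr * m))) =
  c ^+ 2 * (32 * L ^+ 3 * sigma ^+ 2 * eta * (eta * (Dr * m) * L))); last by ring.
apply: le_trans h4 _.
rewrite -(ler_pM2l (_ : 0 < 10 ^+ 4)) ?exprn_gt0//.
rewrite (_ : _ * (c ^+ 2 * _) = 10 ^+ 4 * c ^+ 2 * eps * eps ^+ 2); last by ring.
by apply: le_trans h5 _; rewrite le_eqVlt; apply/orP; left; apply/eqP; field.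
Qed.

Variables (G Bm nr N gap0 : R).
Hypotheses (G0 : 0 <= G) (Bm0 : 0 <= Bm) (nr0 : 0 <= nr) (N0 : 0 < N) (eps1 : eps <= 1).
Hypothesis hN : 6 * Num.max gap0 1 <= eta * eps * N.
Hypothesis hc : 10 ^+ 4 * (2 * G * L * (nr * Bm) + G * Bm) ^+ 2 * eps <=
  32 * L ^+ 4 * sigma ^+ 2.

Lemma rate_arithmetic :
  (gap0 + G * (eta * Bm * Num.sqrt (Dr * m))) / eta / N +
  (L / 2 * eta * (Dr * m) + 2 * L ^+ 2 * u ^+ 2 * Dr +
   (L * eta * m * Dr * q + 2 * G * L * (nr * Bm) * (eta * Num.sqrt (Dr * m)))) <=
  7 / 8 * eps.
Proof.
have c0 : 0 <= 2 * G * L * (nr * Bm) + G * Bm.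
  by rewrite addr_ge0 ?mulr_ge0// ltW.
have hd := drift_scale c0 hc.
set rho := eta * Num.sqrt (Dr * m).
have rho0 : 0 <= rho by rewrite mulr_ge0 ?sqrtr_ge0// ltW.
have -> : G * (eta * Bm * Num.sqrt (Dr * m)) = G * Bm * rho by rewrite /rho; ring.
have h1 : (gap0 + G * Bm * rho) / eta / N <= eps / 6 + G * Bm * rho.
  pose mx := Num.max gap0 1; have hmx : 6 * mx <= eta * eps * N := hN.
  have mx1 : 1 <= mx by rewrite /mx le_max lexx orbT.
  have mxg : gap0 <= mx by rewrite /mx le_max lexx.
  have g0 : 0 <= G * Bm * rho by exact: mulr_ge0 (mulr_ge0 G0 Bm0) rho0.
  rewrite ler_pdivrMr// ler_pdivrMr//.
  (* Since [mx] is at least 1, the initial drift may be multiplied by it and is then divided by the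
     number of iterations together with the gap. *)
  apply: (@le_trans _ _ (mx * (1 + G * Bm * rho))).
    rewrite mulrDr mulr1; apply: lerD => //.
    by rewrite ler_peMl.
  apply: (@le_trans _ _ (eta * eps * N / 6 * (1 + G * Bm * rho))).
    by rewrite ler_wpM2r ?addr_ge0//; lra.
  have : eta * N * (eps / 6 * (G * Bm * rho)) <= eta * N * (G * Bm * rho).
    rewrite ler_pM2l ?mulr_gt0// ler_piMl//.
    by move: eps1; lra.
  by lra.
have h2 := variance_share; have h3 := quadratic_share.
have h4 : 2 * L ^+ 2 * u ^+ 2 * Dr <= eps / 8 by move: hu; lra.
have : (2 * G * L * (nr * Bm) + G * Bm) * rho <= eps / 100 by exact: hd.
(* The shares are 1/6, 127/400, 127/800, 1/8 and 1/100, with sum below 7/8. *)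
move: h1 h2 h3; rewrite /M; move: eps0 => ?.
rewrite mulrDl; lra.
Qed.

End rate.

(** * Order of magnitude of the number of iterations *)

Section complexity.
Context {R : realType}.
Variables (L sigma eps q Dr gap gap0 eta N T Bm : R).
Hypotheses (L0 : 0 < L) (s0 : 0 < sigma) (eps0 : 0 < eps) (eps1 : eps <= 1)
  (q1 : 1 <= q) (D1 : 1 <= Dr) (gap_le : gap0 <= gap).
Hypothesis etaE : eta = (eps * (eps / (16 * L ^+ 2 * Dr)) / sigma ^+ 2) / (2 * L * q * Dr).
Hypotheses (N_ge : 6 / (eta * eps) * Num.max gap0 1 <= N)
  (N_lt : N < 6 / (eta * eps) * Num.max gap0 1 + 1).
Hypotheses (N_le : N <= T + 1) (T_le : T <= N + Bm - 1).
Hypotheses (eps_c : eps <= 96 * L ^+ 3 * sigma ^+ 2) (eps_B : eps * (Bm + 1) <= 1).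

Let M := q * Dr ^+ 2 / eps ^+ 3.

(** At equality [6 / (eta * eps)] equals [192 * L ^+ 3 * sigma ^+ 2 * M]. Half of it pays for the 1
    in [T >= N - 1]; the additional [M] of the upper bound pays for [Bm <= eps^-1 <= M]. *)
Lemma complexity_arithmetic :
  96 * L ^+ 3 * sigma ^+ 2 * M <= T /\
  T <= (192 * L ^+ 3 * sigma ^+ 2 * Num.max gap 1 + 1) * M.
Proof.
have Dr0 : 0 < Dr := lt_le_trans ltr01 D1.
have q0 : 0 < q := lt_le_trans ltr01 q1.
pose k := L ^+ 3 * sigma ^+ 2.
have k0 : 0 < k by rewrite mulr_gt0// exprn_gt0.
have XE : 6 / (eta * eps) = 192 * k * M.
  by rewrite etaE /M /k; field; rewrite !gt_eqF.
have M_ge : eps^-1 <= M.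
  rewrite -[leLHS]mul1r /M; apply: ler_pM; rewrite ?invr_ge0 ?(ltW eps0)//.
    by rewrite mulr_ege1// exprn_ege1.
  rewrite lef_pV2 ?posrE ?exprn_gt0// exprS.
  by rewrite ger_pMr// exprn_ile1// ltW.
have M0 : 0 < M by apply: lt_le_trans M_ge; rewrite invr_gt0.
have m1 : 1 <= Num.max gap0 1 by rewrite le_max lexx orbT.
have mg : Num.max gap0 1 <= Num.max gap 1.
  by rewrite ge_max !le_max gap_le lexx orbT.
have kM : 1 <= 96 * k * M.
  apply: (@le_trans _ _ (96 * k * eps^-1)).
    by rewrite ler_pdivlMr// mul1r /k mulrA.
  by rewrite ler_wpM2l// mulr_ge0// ltW.
have BM : Bm <= M.
  apply: le_trans M_ge; rewrite -[leRHS]mul1r ler_pdivlMr// mulrC.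
  by apply: le_trans eps_B; rewrite ler_pM2l// lerDl.
have kM0 : 0 <= 192 * k * M by exact: mulr_ge0 (mulr_ge0 (ler0n _ _) (ltW k0)) (ltW M0).
have l1 := ler_wpM2l kM0 m1; have l2 := ler_wpM2l kM0 mg.
move: N_ge N_lt; rewrite XE => h1 h2; split.
  rewrite (_ : 96 * L ^+ 3 * sigma ^+ 2 = 96 * k); last by rewrite /k mulrA.
  by move: N_le; lra.
rewrite (_ : 192 * L ^+ 3 * sigma ^+ 2 = 192 * k); last by rewrite /k mulrA.
rewrite mulrDl mul1r.
rewrite (_ : 192 * k * Num.max gap 1 * M = 192 * k * M * Num.max gap 1); last by ring.
by move: T_le; lra.
Qed.

End complexity.

(** * Stamps and delays *)

Section stamps.
Context {R : realType} {n : nat} {dim : 'I_n -> nat}.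
Variables (e : rel 'I_n) (arr : nat -> 'I_n -> 'I_n -> seq nat)
  (f : 'I_n -> profile R dim -> R) (u eta : R) (x0 : profile R dim).
Hypothesis arr_lt : forall t i k s, s \in arr t i k -> (s < t)%N.

(** Covers the sources of a candidate: the initial pair, the agent's own previous pair, and an
    earlier entry of a neighbour. *)
Lemma candidate_ind (Q : R * int -> Prop) (tab : @table R n) t i j :
  Q (0, -1) -> (forall s k, (s < t)%N -> Q (tab s k j)) ->
  forall p, p \in candidate_pairs e arr tab t i j -> Q p.
Proof.
move=> Q0 IH p /flattenP[l /mapP[k _ ->]].
case E : (arr t i k) => [|s l'].
  rewrite inE => /eqP ->; case: t IH E => //= t IH _; exact: IH.
by rewrite -E => /mapP[r rin ->]; apply: IH; exact: arr_lt rin.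
Qed.

Lemma candidate_stamps (tab tab' : @table R n) t i j :
  (forall s k, (s < t)%N -> (tab s k j).2 = (tab' s k j).2) ->
  [seq p.2 | p <- candidate_pairs e arr tab t i j] =
  [seq p.2 | p <- candidate_pairs e arr tab' t i j].
Proof.
move=> IH; rewrite /candidate_pairs !map_flatten -!map_comp; congr flatten.
apply: eq_map => k /=; case E : (arr t i k) => [|s l].
  by case: t IH E => //= t IH _; rewrite IH.
rewrite -E -!map_comp; apply/eq_in_map => r rin /=.
by apply: IH; exact: arr_lt rin.
Qed.

Lemma run_values z nP nM x tab : zfo_run e arr f u eta x0 z nP nM x tab ->
  forall t i j, (tab t i j).1 =
      at_stamp (observed_difference f u z nP nM x j) (tab t i j).2 /\
    (tab t i j).2 <= t%:Z.
Proof.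
move=> run; elim/ltn_ind => t IH i j.
have [->|ij] := eqVneq i j; first by rewrite (run_own run).
have [tin _] := run_adopt run t ij.
apply: (candidate_ind (Q := fun p => p.1 =
  at_stamp (observed_difference f u z nP nM x j) p.2 /\ p.2 <= t%:Z) _ _ tin) => //.
by move=> s k st; have [-> le] := IH s st k j; split => //; lia.
Qed.

(** Adoption maximises the stamp and the arrivals are shared, so the list of candidate stamps
    determines the adopted one; perturbations, noises and values never influence it. Applied to two
    outcomes, this makes the stamps deterministic. *)
Lemma run_stamps z nP nM x tab z' nP' nM' x' tab' :
  zfo_run e arr f u eta x0 z nP nM x tab ->
  zfo_run e arr f u eta x0 z' nP' nM' x' tab' ->
  forall t i j, (tab t i j).2 = (tab' t i j).2.
Proof.
move=> run run'; elim/ltn_ind => t IH i j.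
have [->|ij] := eqVneq i j; first by rewrite (run_own run) (run_own run').
have [tin tmax] := run_adopt run t ij; have [tin' tmax'] := run_adopt run' t ij.
have E : [seq p.2 | p <- candidate_pairs e arr tab t i j] =
    [seq p.2 | p <- candidate_pairs e arr tab' t i j].
  by apply: candidate_stamps => s k st; exact: IH.
apply/eqP; rewrite eq_le; apply/andP; split.
  have : (tab t i j).2 \in [seq p.2 | p <- candidate_pairs e arr tab' t i j].
    by rewrite -E; exact: map_f.
  by move=> /mapP[p pin ->]; exact: tmax'.
have : (tab' t i j).2 \in [seq p.2 | p <- candidate_pairs e arr tab t i j].
  by rewrite E; exact: map_f.
by move=> /mapP[p pin ->]; exact: tmax.
Qed.

End stamps.

(** * Graph distances and the average delay *)

Section delays.
Context {R : realType} {n : nat} (e : rel 'I_n) (Delta : nat).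

(** A search that returns 0 has found the empty path, which ends at [i]. *)
Lemma gdist_gt0 i j : i != j -> (0 < gdist e i j)%N.
Proof.
move=> ij; rewrite lt0n; apply/negP => /eqP d0.
have n0 : (0 < n)%N by case: n i {j ij d0} => [[]|].
have hs : has (fun k => [exists p : k.-tuple 'I_n, path e i p && (last i p == j)]) (iota 0 n).
  by rewrite has_find size_iota -/(gdist e i j) d0.
have := nth_find 0%N hs; rewrite -/(gdist e i j) d0 nth_iota//= add0n.
by move=> /existsP[p]; rewrite (tuple0 p) /= (negPf ij).
Qed.

Lemma delay_le_max i j : (gdist e i j + Delta <= max_delay e Delta)%N.
Proof.
rewrite leq_add2r; apply: leq_trans (leq_bigmax i).
exact: (leq_bigmax (F := fun j => gdist e i j) j).
Qed.

(** Squared, the claim is that the squared delays sum to at least [n]. For [n >= 2] every row has an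
    off-diagonal delay of at least 1; for [n = 1] the sum is a natural number, positive by
    hypothesis. *)
Lemma avg_delay_sqrt_ge1 : 0 < avg_delay R e Delta ->
  1 <= avg_delay R e Delta * Num.sqrt n%:R.
Proof.
set S : R := \sum_i \sum_j (gdist e i j + Delta)%:R ^+ 2.
rewrite /avg_delay -/S => a0.
have sq0 i j : 0 <= (gdist e i j + Delta)%:R ^+ 2 :> R by exact: sqr_ge0.
have S0 : 0 < S / n%:R ^+ 2 by rewrite -sqrtr_gt0.
have n0 : (0 < n)%N.
  rewrite lt0n; apply/eqP => nE; move: S0.
  by rewrite [X in _ / X ^+ 2](_ : _ = 0) ?expr0n ?invr0 ?mulr0 ?ltxx// nE.
have ns : 0 < n%:R :> R by rewrite ltr0n.
suff nS : n%:R <= S.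
  rewrite -sqrtrM ?(ltW S0)// -{1}(@sqrtr1 R) ler_wsqrtr//.
  rewrite (_ : S / n%:R ^+ 2 * n%:R = S / n%:R); last by field; rewrite gt_eqF.
  by rewrite ler_pdivlMr// mul1r.
have row i j : i != j -> 1 <= \sum_j (gdist e i j + Delta)%:R ^+ 2 :> R.
  move=> ij; rewrite (bigD1 j)//= -[leLHS]addr0 lerD ?sumr_ge0//.
  by rewrite -natrX ler1n expn_gt0 addn_gt0 gdist_gt0.
have [n1|n2] := leqP n 1; last first.
  rewrite (_ : n%:R = \sum_(i < n) 1); last by rewrite sumr_const card_ord.
  apply: ler_sum => i _.
  have [j ij] : exists j, i != j.
    have : (1 < #|'I_n|)%N by rewrite card_ord.
    rewrite (cardD1 i) inE /= add1n ltnS => /card_gt0P[j]; rewrite !inE andbT => ji.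
    by exists j; rewrite eq_sym.
  exact: row ij.
have {}n1 : n = 1%N by apply/eqP; rewrite eqn_leq n1.
have Spos : 0 < S by move: S0; rewrite pmulr_lgt0// invr_gt0 exprn_gt0.
have : S = (\sum_i \sum_j (gdist e i j + Delta) ^ 2)%N%:R.
  rewrite /S natr_sum; apply: eq_bigr => i _; rewrite natr_sum; apply: eq_bigr => j _.
  by rewrite natrX.
by move=> E; move: Spos; rewrite E ltr0n ler_nat; apply: leq_trans; rewrite n1.
Qed.

End delays.

(** * From the runs of the protocol to the flat iteration *)

Section convergence.
Context {d : measure_display} {Omega : measurableType d} {R : realType}
  {P : probability Omega R} {n : nat} {dim : 'I_n -> nat}.
Variables (G L sigma u eta : R) (f : 'I_n -> profile R dim -> R) (x0 : profile R dim).
Hypotheses (fP : problem G L f) (n0 : (0 < n)%N) (D0 : (0 < \sum_i dim i)%N)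
  (L0 : 0 < L) (s0 : 0 < sigma) (u0 : 0 < u) (eta0 : 0 < eta).
Variables (e : rel 'I_n) (Delta : nat) (arr : nat -> 'I_n -> 'I_n -> seq nat).
Variables (z : forall i : 'I_n, nat -> 'I_(dim i) -> {RV P >-> R})
  (noiseP noiseM : 'I_n -> nat -> {RV P >-> R})
  (x : Omega -> nat -> profile R dim) (tab : Omega -> @table R n).
Hypothesis rand : zfo_randomness z noiseP noiseM sigma.
Hypothesis arr_lt : forall t i k s, s \in arr t i k -> (s < t)%N.
Hypothesis run : forall w, zfo_run e arr f u eta x0 (perturbation z w)
  (fun i t => noiseP i t w) (fun i t => noiseM i t w) (x w) (tab w).
Hypothesis delay : forall w t i j,
  t%:Z - (tab w t i j).2 <= (gdist e i j + Delta)%N%:Z.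
Local Notation D := (\sum_i dim i)%N.
Local Notation F := (objective f).
Local Notation B := (max_delay e Delta).

Lemma lipschitz_constant_ge0 : 0 <= G.
Proof.
have := cost_lipschitz fP (Ordinal n0) (delta_mx ord0 (Ordinal D0)) 0.
by rewrite subr0 norm2_delta mulr1; apply: le_trans.
Qed.

Lemma gradient_sum_le (T : nat) : (B <= T)%N ->
  let m := sample_bound (dim := dim) G sigma u in
  exists2 E : nat -> R,
    forall t, ('E_P[fun w => (norm2 (gradient F (x w t)) ^+ 2)%R] = (E t)%:E)%E &
    7 / 8 * \sum_(B <= t < T.+1) E t <=
    (F x0 - infimum F + G * (eta * B%:R * Num.sqrt (D%:R * m))) / eta +
    (T - B + 1)%:R *
      (L / 2 * eta * (D%:R * m) + 2 * L ^+ 2 * u ^+ 2 * D%:R +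
       (L * eta * m * D%:R * (avg_delay R e Delta * Num.sqrt n%:R) +
        2 * G * L * (n%:R * B%:R) * (eta * Num.sqrt (D%:R * m)))).
Proof.
move=> BT m; have G0 := lipschitz_constant_ge0.
(* [point] is an arbitrary reference outcome; by [run_stamps] its stamps are those of every
   outcome. *)
pose tau t i j := (tab point t i j).2.
pose X t w := x w t.
have stampE w t i j : (tab w t i j).2 = tau t i j by exact: (run_stamps arr_lt (run w) (run point)).
have tau_le t i j : tau t i j <= t%:Z by have [] := run_values arr_lt (run point) t i j.
have X_init w : X 0 w = x0 by exact: run_init (run w).
have X_step t w : X t.+1 w = X t w - eta *: estimate u f z noiseP noiseM X tau t w.
  rewrite /X (run_step (run w)); congr (_ - _ *: _).
  apply/rowP => k; rewrite [LHS]mxE [RHS]mxE /local_estimate [LHS]mxE; congr (_ * _).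
  rewrite summxE; apply: eq_bigr => j _; rewrite [LHS]mxE stampE.
  have [-> _] := run_values arr_lt (run w) t (tagnat.sig1 k) j; rewrite stampE.
  case: (tau t _ j) => s /=; last by rewrite mul0r.
  by rewrite /sample /Z /stack; congr (_ * _); rewrite [RHS]mxE.
have sb_gt0 : 0 < m.
  have k0 : 0 <= 5 * G ^+ 2 * (D%:R * @gaussian_kurtosis R).
    by rewrite !mulr_ge0 ?sqr_ge0 ?gaussian_kurtosis_ge0.
  by rewrite /m /sample_bound ltr_pwDl// mulr_gt0// divr_gt0 ?exprn_gt0.
have gi := gradient_norm_integ fP n0 G0 L0 u0 eta0 tau_le X_init X_step.
exists (fun t => expect P (fun w => norm2 (gradient F (X t w)) ^+ 2)).
  by move=> t; rewrite expectation.unlock; exact: (integral_Ex (gi t)).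
pose b i j := (gdist e i j + Delta)%N.
have bB i j : (b i j <= B)%N by exact: delay_le_max.
(* From time [B] on, a delay of at most [B] forces a nonnegative stamp. *)
have fresh t i j : (B <= t)%N -> exists2 s : nat, tau t i j = s%:Z & (t - s <= b i j)%N.
  move=> Bt; have := delay point t i j; have := bB i j; rewrite -/(tau t i j) /b.
  by case: (tau t i j) => s h1 h2; [exists s => //|exfalso]; lia.
apply: le_trans (descent_sum fP n0 G0 L0 u0 eta0 rand tau_le X_init X_step D0 sb_gt0 BT fresh) _.
rewrite lerD2l ler_wpM2l// lerD2l.
exact: (delay_error_le sigma u n0 G0 L0 eta0 bB).
Qed.

End convergence.

(** * What the parameter conditions imply *)

Section parameters.
Context {R : realType}.

(** A quotient with zero denominator is 0, and a negative [L] makes it nonpositive; neither can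
    bound a positive [u] from above. *)
Lemma radius_positive (eps L : R) (D : nat) (u : R) : 0 < u ->
  u <= Num.sqrt eps / (4 * L * Num.sqrt D%:R) -> 0 < L /\ (0 < D)%N.
Proof.
move=> u0 hu; have := lt_le_trans u0 hu.
have [L0|L0] := lerP L 0.
  rewrite ltNge => /negP[]; rewrite mulr_ge0_le0 ?sqrtr_ge0// invr_le0.
  by rewrite mulr_le0_ge0 ?sqrtr_ge0// mulr_ge0_le0.
by case: D {hu} => [|D] //; rewrite sqrtr0 mulr0 invr0 mulr0 ltxx.
Qed.

Lemma radius_square (eps L u : R) (D : nat) : 0 < eps -> 0 < u -> 0 < L -> (0 < D)%N ->
  u <= Num.sqrt eps / (4 * L * Num.sqrt D%:R) ->
  16 * L ^+ 2 * D%:R * u ^+ 2 <= eps.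
Proof.
move=> e0 u0 L0 D0; have sD : 0 < Num.sqrt D%:R :> R by rewrite sqrtr_gt0 ltr0n.
have c0 : 0 < 4 * L * Num.sqrt D%:R by rewrite !mulr_gt0.
rewrite ler_pdivlMr// => h.
have : (u * (4 * L * Num.sqrt D%:R)) ^+ 2 <= Num.sqrt eps ^+ 2.
  by rewrite ler_sqr ?nnegrE ?sqrtr_ge0// mulr_ge0// ltW.
rewrite (sqr_sqrtr (ltW e0)); apply: le_trans.
rewrite -{1}(@sqr_sqrtr R D%:R)// le_eqVlt; apply/orP; left; apply/eqP; ring.
Qed.

Lemma stepsize_positive (a L bbar : R) (n D : nat) (eta : R) : 0 < eta -> 0 <= bbar ->
  eta <= a / (2 * L * bbar * Num.sqrt n%:R * D%:R) -> 0 < bbar /\ (0 < n)%N.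
Proof.
move=> eta0 b0 h; have := lt_le_trans eta0 h.
case: n {h} => [|n] h; first by move: h; rewrite sqrtr0 mulr0 mul0r invr0 mulr0 ltxx.
split => //; rewrite lt0r b0 andbT; apply/eqP => bE; move: h.
by rewrite bE mulr0 !mul0r invr0 mulr0 ltxx.
Qed.

Lemma stepsize_scaled (a L bbar sigma eta : R) (n D : nat) :
  0 < L -> 0 < sigma -> 0 < bbar -> (0 < n)%N -> (0 < D)%N ->
  eta <= (a / sigma ^+ 2) / (2 * L * bbar * Num.sqrt n%:R * D%:R) ->
  2 * L * (bbar * Num.sqrt n%:R) * D%:R * sigma ^+ 2 * eta <= a.
Proof.
move=> L0 s0 b0 n0 D0.
have c0 : 0 < 2 * L * bbar * Num.sqrt n%:R * D%:R by rewrite !mulr_gt0 ?sqrtr_gt0 ?ltr0n.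
rewrite ler_pdivlMr// ler_pdivlMr ?exprn_gt0//; apply: le_trans.
by rewrite le_eqVlt; apply/orP; left; apply/eqP; ring.
Qed.

End parameters.

Theorem theorem4 (R : realType) (G L sigma gap : R) (sigma_gt0 : 0 < sigma) :
  exists c C : R, [/\ 0 < c, 0 < C &
  forall (n : nat) (dim : 'I_n -> nat) (e : rel 'I_n) (Delta : nat),
    connected_graph e ->
  let d := (\sum_i dim i)%N in
  let bbar := avg_delay R e Delta in
  let B := max_delay e Delta in
  exists eps0 : R, 0 < eps0 /\
  forall eps : R, 0 < eps -> eps <= eps0 ->
  forall (f : 'I_n -> profile R dim -> R) (x0 : profile R dim),
    problem G L f ->
  let F := objective f in
  let gap0 := F x0 - infimum F in
  forall (u eta : R) (T : nat), 0 < u -> 0 < eta -> (B <= T)%N ->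
    (u <= Num.sqrt eps / (4 * L * Num.sqrt d%:R) ->
     eta <= (eps * u ^+ 2 / sigma ^+ 2) / (2 * L * bbar * Num.sqrt n%:R * d%:R) ->
     Num.ceil (6 / (eta * eps) * Num.max gap0 1) <= (T - B + 1)%N%:Z ->
     forall (disp : measure_display) (Omega : measurableType disp)
       (P : probability Omega R)
       (z : forall i : 'I_n, nat -> 'I_(dim i) -> {RV P >-> R})
       (noiseP noiseM : 'I_n -> nat -> {RV P >-> R})
       (arr : nat -> 'I_n -> 'I_n -> seq nat)
       (x : Omega -> nat -> profile R dim) (tab : Omega -> table),
       zfo_randomness z noiseP noiseM sigma ->
       (forall t i k s, s \in arr t i k -> (s < t)%N) ->
       (forall w, zfo_run e arr f u eta x0 (perturbation z w)
          (fun i t => noiseP i t w) (fun i t => noiseM i t w) (x w) (tab w)) ->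
       (forall w t i j, t%:Z - (tab w t i j).2 <= (gdist e i j + Delta)%N%:Z) ->
       (((T - B + 1)%:R^-1)%:E *
          \sum_(B <= t < T.+1) 'E_P[fun w => (norm2 (gradient F (x w t)) ^+ 2)%R]
        <= eps%:E)%E)
    /\
    (gap0 <= gap ->
     u = Num.sqrt eps / (4 * L * Num.sqrt d%:R) ->
     eta = (eps * u ^+ 2 / sigma ^+ 2) / (2 * L * bbar * Num.sqrt n%:R * d%:R) ->
     (T - B + 1)%N%:Z = Num.ceil (6 / (eta * eps) * Num.max gap0 1) ->
     c * (bbar * Num.sqrt n%:R * d%:R ^+ 2 / eps ^+ 3) <= T%:R /\
     T%:R <= C * (bbar * Num.sqrt n%:R * d%:R ^+ 2 / eps ^+ 3))].
Proof.
(* For [L <= 0] no positive [u] meets either condition on the radius, so any constants serve. *)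
have [L0|L0] := lerP L 0.
  exists 1, 1; split => // n dim e Delta _ /=; exists 1; split => // eps _ _ f x0 _ u eta T u0 _ _.
  have nL u' : 0 < u' -> u' <= Num.sqrt eps / (4 * L * Num.sqrt (\sum_i dim i)%:R) -> False.
    by move=> v0 /(radius_positive v0) [L1]; rewrite ltNge L0 in L1.
  by split => [/(nL _ u0)//|_ uE]; case: (nL u u0); rewrite -uE.
(* [c] and [C] depend on [L], [sigma] and [gap] alone; [eps0], chosen later, may depend on the
   dimensions, the graph and [Delta]. *)
pose c := 96 * L ^+ 3 * sigma ^+ 2.
pose C := 192 * L ^+ 3 * sigma ^+ 2 * Num.max gap 1 + 1.
have c0 : 0 < c by rewrite !mulr_gt0 ?exprn_gt0.
have C0 : 0 < C.
  rewrite ltr_wpDl// !mulr_ge0 ?exprn_ge0 ?(ltW L0) ?(ltW sigma_gt0)//.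
  by rewrite le_max ler01 orbT.
exists c, C; split => // n dim e Delta _ /=.
set D := (\sum_i dim i)%N; set bbar := avg_delay R e Delta; set B := max_delay e Delta.
pose K := 5 * G ^+ 2 * (D%:R * @gaussian_kurtosis R).
(* Collects the coefficients of [eta * sqrt (D * m)]: moving to the current iterate, and the phase
   before [B]. *)
pose h := 2 * G * L * (n%:R * B%:R) + G * B%:R.
(* [e1] keeps the cost part of the second moment below 1/100 of [sigma^2 / u^2], [e2]
   keeps the drift below [eps / 100]; the last two bounds absorb the rounding and the
   initial delay in [T]. *)
pose e1 := 16 * L ^+ 2 * sigma ^+ 2 / (100 * K + 1).
pose e2 := 32 * L ^+ 4 * sigma ^+ 2 / (10 ^+ 4 * h ^+ 2 + 1).
have K0 : 0 <= K.
  exact: mulr_ge0 (mulr_ge0 (ler0n _ _) (sqr_ge0 _)) (mulr_ge0 (ler0n _ _) gaussian_kurtosis_ge0).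
have K1 : 0 < 100 * K + 1 by rewrite ltr_wpDl// mulr_ge0.
have h1 : 0 < 10 ^+ 4 * h ^+ 2 + 1.
  by rewrite ltr_wpDl//; exact: mulr_ge0 (exprn_ge0 _ (ler0n _ _)) (sqr_ge0 _).
exists (Num.min 1 (Num.min e1 (Num.min e2 (Num.min c (B%:R + 1)^-1)))).
split.
  rewrite !lt_min ltr01 /e1 /e2 c0 invr_gt0 ltr_wpDl// !andbT /=.
  by rewrite !divr_gt0// !mulr_gt0// exprn_gt0.
move=> eps eps0; rewrite !le_min => /and5P[eps1 epse1 epse2 epsc epsB].
move=> f x0 fP u eta T u0 eta0 BT.
have D1P : (0 < D)%N -> 1 <= D%:R :> R by move=> ?; rewrite ler1n.
split.
  move=> hu heta hN disp Omega P z noiseP noiseM arr x tab rand arr_lt run delay.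
  have [_ D0] := radius_positive u0 hu.
  have hu2 := radius_square eps0 u0 L0 D0 hu.
  have [b0 n0] := stepsize_positive eta0 (sqrtr_ge0 _) heta.
  have heta2 := stepsize_scaled L0 sigma_gt0 b0 n0 D0 heta.
  have q1 := avg_delay_sqrt_ge1 b0.
  have G0 := lipschitz_constant_ge0 fP n0 D0.
  have [E EE ES] := gradient_sum_le fP n0 D0 L0 sigma_gt0 u0 eta0 rand arr_lt run delay BT.
  pose N : R := (T - B + 1)%:R.
  have N0 : 0 < N by rewrite ltr0n addn1.
  have hN' : 6 * Num.max (objective f x0 - infimum (objective f)) 1 <= eta * eps * N.
    move: hN; rewrite ceil_le_int -pmulrn -/N mulrAC ler_pdivrMr ?mulr_gt0//.
    by rewrite (mulrC N).
  have hK : 100 * K * eps <= 16 * L ^+ 2 * sigma ^+ 2 * D%:R.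
    have he : eps * (100 * K + 1) <= 16 * L ^+ 2 * sigma ^+ 2 by rewrite -ler_pdivlMr.
    apply: (@le_trans _ _ (16 * L ^+ 2 * sigma ^+ 2)); first by move: eps0; lra.
    by rewrite ler_peMr ?D1P// !mulr_ge0 ?exprn_ge0 ?(ltW L0) ?(ltW sigma_gt0).
  have hh : 10 ^+ 4 * h ^+ 2 * eps <= 32 * L ^+ 4 * sigma ^+ 2.
    have : eps * (10 ^+ 4 * h ^+ 2 + 1) <= 32 * L ^+ 4 * sigma ^+ 2 by rewrite -ler_pdivlMr.
    by move: eps0; lra.
  have := rate_arithmetic L0 sigma_gt0 u0 eta0 eps0 q1 (D1P D0) K0 hu2 heta2 hK
    G0 (ler0n R B) (ler0n R n) N0 eps1 hN' hh.
  move=> rate.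
  under eq_bigr do rewrite EE.
  rewrite sumEFin -EFinM lee_fin mulrC ler_pdivrMr//.
  have := ler_wpM2l (ltW N0) rate; rewrite [leLHS]mulrDr mulrCA divff ?gt_eqF// mulr1.
  by move=> /(le_trans ES); rewrite -/N; lra.
move=> gap_le uE etaE NE; have eqW (p q : R) : p = q -> p <= q by move=> ->.
have [_ D0] := radius_positive u0 (eqW _ _ uE).
have [b0 n0] := stepsize_positive eta0 (sqrtr_ge0 _) (eqW _ _ etaE).
have u2 : u ^+ 2 = eps / (16 * L ^+ 2 * D%:R).
  rewrite uE expr_div_n (sqr_sqrtr (ltW eps0)) !exprMn sqr_sqrtr//.
  by congr (_ / (_ * _ * _)); ring.
have etaE' : eta = (eps * (eps / (16 * L ^+ 2 * D%:R)) / sigma ^+ 2) /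
    (2 * L * (bbar * Num.sqrt n%:R) * D%:R) by rewrite etaE u2 !mulrA.
have Bm1 : 0 < B%:R + 1 :> R by rewrite ltr_wpDl.
have := @complexity_arithmetic R L sigma eps (bbar * Num.sqrt n%:R) D%:R gap
  (objective f x0 - infimum (objective f)) eta (T - B + 1)%:R T%:R B%:R
  L0 sigma_gt0 eps0 eps1 (avg_delay_sqrt_ge1 b0) (D1P D0) gap_le etaE'.
apply.
- by apply: le_trans (ceil_ge _) _; rewrite -NE -pmulrn.
- by have := ceilB1_lt (6 / (eta * eps) * Num.max (objective f x0 - infimum (objective f)) 1);
    rewrite -NE rmorphB /= -pmulrn ltrBlDr.
(* With [N = T - B + 1] and [B <= T], this and the next goal are [N <= T + 1] and
   [T <= N + B - 1]. *)
- by rewrite natr1 ler_nat addn1 ltnS leq_subr.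
- by rewrite lerBrDr natr1 -natrD ler_nat addnAC subnK// addn1.
- exact: epsc.
- by rewrite -ler_pdivlMr// mul1r.
Qed.
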